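(* Let $f\in L^2([0,1))$, let $Y^n=(Y_1^n,\dots,Y_n^n)$, $n\in\mathbb{N}$, be observations from the regression model described in the context (with noise satisfying Condition (A)), let $(\gamma_n)_{n\in\mathbb{N}}$ be a (possibly random) sequence of smoothing parameters, and let $\hat f_n\in\iota^n(\arg\min H_{\gamma_n}(\cdot,Y^n))$. (i) Assume that $f\in L^2([0,1))$ and $\gamma>0$ are such that $f_\gamma$ is a unique minimizer of $H^\infty_\gamma(\cdot,f)$, and suppose $\gamma_n\to\gamma$ $\mathbb{P}$-almost surely. Then $\hat f_n\to f_\gamma$ in $D([0,1))$ (that is, $\rho_S(\hat f_n,f_\gamma)\to0$) as $n\to\infty$, $\mathbb{P}$-almost surely. (ii) If $f\in D([0,1))$ and $\gamma_n\to0$, $\gamma_n n/\log n\to\infty$ $\mathbb{P}$-almost surely, then $\hat f_n\to f$ in $D([0,1))$ (that is, $\rho_S(\hat f_n,f)\to0$) as $n\to\infty$, $\mathbb{P}$-almost surely. If (in addition) $f$ is continuous on $[0,1]$, then $\hat f_n\to f$ in $L^\infty([0,1])$ as $n\to\infty$, $\mathbb{P}$-almost surely. (iii) If $f\in S([0,1))$ and $\gamma_n\to0$, $\gamma_n n/\log n\to\infty$ $\mathbb{P}$-almost surely, then $$\rho_S(\hat f_n,f)=O\left(\sqrt{\frac{\log n}{n}}\right)\quad\mathbb{P}\text{-almost surely}.$$ Moreover, $$\rho_S(\hat f_n,f)=O_{\mathbb{P}}\left(\sqrt{\frac1n}\right).$$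
   Context: $\|\cdot\|$ is the norm of $L^2([0,1))$. Regression model: for each $n$, with $x_i^n=i/n$ ($0\le i\le n$), one observes $Y_i^n=\overline f_i^n+\xi_i^n$, $i=1,\dots,n$, where $\overline f_i^n=(x_i^n-x_{i-1}^n)^{-1}\int_{x_{i-1}^n}^{x_i^n}f(u)\,du$. Condition (A) on the triangular array of noise variables $(\xi_i^n)_{n\in\mathbb{N},1\le i\le n}$ (zero-mean, defined on a common probability space with measure $\mathbb{P}$): (i) for every $n$ the random variables $(\xi_i^n)_{1\le i\le n}$ are independent; (ii) there is a universal constant $\beta\in\mathbb{R}$ such that $\mathbb{E}e^{\nu\xi_i^n}\le e^{\beta\nu^2}$ for all $\nu\in\mathbb{R}$, $1\le i\le n$, $n\in\mathbb{N}$. Potts functional: for $u,Y\in\mathbb{R}^n$, $H_\gamma(u,Y)=\frac1n\sum_{i=1}^n(u_i-Y_i)^2+\gamma\cdot\#\{i:1\le i\le n-1,\ u_i\ne u_{i+1}\}$. The set of minimizers over $u\in\mathbb{R}^n$ is denoted $\arg\min H_\gamma(\cdot,Y)$; it need not be a singleton, and $\hat f_n$ comes from any choice of minimizer. Embedding: $\iota^n((u_1,\dots,u_n))=\sum_{i=1}^nu_i\mathbf{1}_{[(i-1)/n,i/n)}$ for $(u_1,\dots,u_n)\in\mathbb{R}^n$. $S([0,1))$ is the space of right-continuous step functions $\sum_{i=1}^m\alpha_i\mathbf{1}_{[t_i,t_{i+1})}$, $\alpha_i\in\mathbb{R}$, $0=t_1<\dots<t_{m+1}=1$, $m\in\mathbb{N}$.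 $D([0,1))$ is the space of right-continuous functions on $[0,1]$ with left limits and left-continuous at $1$. Both are regarded as subspaces of $L^2([0,1))$ (identifying a function with its equivalence class, which is injective on these spaces), and step functions in $S([0,1))$ are regarded as elements of $D([0,1))$ by taking the left limit as value at $1$. For $g\in S([0,1))$, $J(g)=\{t\in(0,1):g(t-)\ne g(t+)\}$. Continuous Potts functional, for $\gamma>0$ and $f,g\in L^2([0,1))$: $H_\gamma^\infty(g,f)=\gamma\cdot\#J(g)+\|f-g\|^2$ if $g\in S([0,1))$, and $H^\infty_\gamma(g,f)=\infty$ otherwise. Skorokhod metric: let $\Lambda_1$ be the set of all strictly increasing continuous functions $\lambda:[0,1]\to[0,1]$ which are onto. For $f,g\in D([0,1))$, $$\rho_S(f,g)=\inf\left\{\max\left(L(\lambda),\sup_{0\le t\le1}|f(\lambda(t))-g(t)|\right):\lambda\in\Lambda_1\right\},\qquad L(\lambda)=\sup_{s\ne t}\left|\log\frac{\lambda(t)-\lambda(s)}{t-s}\right|,$$ the supremum in $L(\lambda)$ being over $s\neq t$ in $[0,1]$. Convergence in $D([0,1))$ is with respect to $\rho_S$. ''$O(\cdot)$ $\mathbb{P}$-almost surely'' means that almost surely the ratio is bounded in $n$ (with a possibly random bound); $O_{\mathbb{P}}$ denotes boundedness in probability. *)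

(* Defs.v *)
From HB Require Import structures.
From mathcomp Require Import all_boot all_order all_algebra.
From mathcomp Require Import all_classical all_reals all_analysis.
Set Implicit Arguments.
Unset Strict Implicit.
Unset Printing Implicit Defensive.
Import Order.TTheory GRing.Theory Num.Theory.
Import numFieldNormedType.Exports.
Local Open Scope classical_set_scope.
Local Open Scope ring_scope.

(* Functions on [0,1) or [0,1] are functions [R -> R] whose values elsewhere are
   ignored; indices 1 <= i <= n are shifted to [i : 'I_n]. *)

Section function_spaces.
Context {R : realType}.
Implicit Types f g s : R -> R.

Definition in_L2 f : Prop := (f \_ `[0, 1[) \in Lfun lebesgue_measure 2%:E.

Definition L2norm f : \bar R :=
  'N[lebesgue_measure]_(2%:E)[EFin \o (f \_ `[0%R, 1%R[)]%E.

Definition Linfnorm f : \bar R :=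
  'N[lebesgue_measure]_(+oo)[EFin \o (f \_ `[0%R, 1%R])]%E.

Definition eq_L2 f g : Prop := f = g %[ae lebesgue_measure in `[0, 1[%classic].

Definition in_S g : Prop :=
  exists (m : nat) (alpha : 'I_m -> R) (t : nat -> R),
    [/\ t 0%N = 0, t m = 1, forall i, (i < m)%N -> t i < t i.+1 &
        forall x, 0 <= x < 1 ->
          g x = \sum_(i < m) alpha i * \1_(`[t i, t i.+1[) x].

Definition in_D f : Prop :=
  [/\ forall t : R, 0 <= t < 1 -> f x @[x --> t^'+] --> f t,
      forall t : R, 0 < t < 1 -> cvg (f x @[x --> t^'-]) &
      f x @[x --> 1^'-] --> f 1].

Definition S_to_D g : R -> R :=
  fun t => if t == 1 then lim (g x @[x --> 1^'-]) else g t.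

Definition jump_set g : set R :=
  [set t | 0 < t < 1 /\ lim (g x @[x --> t^'-]) <> lim (g x @[x --> t^'+])].

(* If the L^2 class of [g] contains an element of S([0,1)), this is that element
   (unique on [0,1)); otherwise it is [g] itself, which is then not in S. *)
Definition S_version g : R -> R := xget g [set s | in_S s /\ eq_L2 s g].

Definition potts_limit (gamma : R) g f : \bar R :=
  if `[< in_S (S_version g) >] then
    (gamma%:E * counting (jump_set (S_version g)) + L2norm (f \- g)%R ^+ 2)%E
  else +oo%E.

Definition potts_limit_minimizers (gamma : R) f : set (R -> R) :=
  [set g | in_L2 g /\
     forall h, in_L2 h -> (potts_limit gamma g f <= potts_limit gamma h f)%E].

Definition unique_potts_limit_minimizer (gamma : R) f g : Prop :=
  potts_limit_minimizers gamma f g /\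
  forall h, potts_limit_minimizers gamma f h -> eq_L2 h g.

End function_spaces.

Section skorokhod.
Context {R : realType}.

Definition time_changes : set (R -> R) :=
  [set lam : R -> R | [/\ {in `[0, 1]%R &, {homo lam : s t / s < t}},
                 {within `[0, 1], continuous lam} &
                 lam @` `[0, 1] = `[0, 1]%classic]].

Definition log_slope_sup (lam : R -> R) : \bar R :=
  ereal_sup [set `| ln ((lam st.1 - lam st.2) / (st.1 - st.2)) |%:E
            | st in [set st : R * R |
                [/\ 0 <= st.1 <= 1, 0 <= st.2 <= 1 & st.1 <> st.2]]].

Definition skorokhod (f g : R -> R) : \bar R :=
  ereal_inf [set maxe (log_slope_sup lam)
                      (ereal_sup [set `| f (lam t) - g t |%:E | t in `[0, 1]])
            | lam in time_changes].

End skorokhod.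

Section potts.
Context {R : realType}.

Definition design (n i : nat) : R := i%:R / n%:R.

Definition local_mean (f : R -> R) (n : nat) (i : 'I_n) : R :=
  (design n i.+1 - design n i)^-1 *
  \int[lebesgue_measure]_(x in `[design n i, design n i.+1[) f x.

Definition jump_count (n : nat) (u : 'rV[R]_n) : nat :=
  #|[set i : 'I_n |
      [exists j : 'I_n, (j == i.+1 :> nat) && (u 0 i != u 0 j)]]|.

Definition potts (n : nat) (gamma : R) (u Y : 'rV[R]_n) : R :=
  n%:R^-1 * \sum_(i < n) (u 0 i - Y 0 i) ^+ 2 + gamma * (jump_count u)%:R.

Definition potts_minimizers (n : nat) (gamma : R) (Y : 'rV[R]_n)
    : set 'rV[R]_n :=
  [set u | forall v, potts gamma u Y <= potts gamma v Y].

Definition iota_step (n : nat) (u : 'rV[R]_n) : R -> R :=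
  fun x => \sum_(i < n) u 0 i * \1_(`[design n i, design n i.+1[) x.

End potts.

Section noise.
Context d (T : measurableType d) (R : realType) (P : probability T R).

Definition independent_family (I : finType) (X : I -> T -> R) : Prop :=
  forall (K : {set I}) (A : I -> set R), (forall i, measurable (A i)) ->
    P (\bigcap_(i in [set i | i \in K]) X i @^-1` A i) =
    (\prod_(i in K) P (X i @^-1` A i))%E.

Definition conditionA (xi : forall n, 'I_n -> T -> R) : Prop :=
  [/\ forall n (i : 'I_n), ('E_P[xi n i] = 0)%E,
      forall n, independent_family (xi n) &
      exists beta : R, forall (nu : R) n (i : 'I_n),
        ('M_P (xi n i) nu <= (expR (beta * nu ^+ 2))%:E)%E].

Definition observations (f : R -> R) (xi : forall n, 'I_n -> T -> R)
    (n : nat) (w : T) : 'rV[R]_n :=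
  \row_i (local_mean f i + xi n i w).

(* [Z n] need not be measurable (minimizers are chosen arbitrarily), so the
   exceptional events are covered by measurable ones of small probability. *)
Definition bigO_P (Z : nat -> T -> \bar R) (a : nat -> R) : Prop :=
  forall eps : R, 0 < eps -> exists M : R, forall n, (0 < n)%N ->
    exists A : set T, [/\ measurable A, (P A <= eps%:E)%E &
      forall w, ~ A w -> (Z n w <= (M * a n)%:E)%E].

(* The bound starts at n = 2: for the rate sqrt (log n / n) the ratio is
   undefined at n = 1. *)
Definition bigO_as (Z : nat -> T -> \bar R) (a : nat -> R) : Prop :=
  {ae P, forall w, exists C : R, forall n, (1 < n)%N ->
    (Z n w <= (C * a n)%:E)%E}.

End noise.

(* Main.v *)
Require Import Defs.
From HB Require Import structures.
From mathcomp Require Import all_boot all_order all_algebra.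
From mathcomp Require Import all_classical all_reals all_analysis.
From mathcomp Require Import measurable_realfun ess_sup_inf.
From mathcomp Require finmap.
From mathcomp Require Import ring lra zify.
Import Order.TTheory GRing.Theory Num.Theory.
Import numFieldNormedType.Exports.
Local Open Scope classical_set_scope.
Local Open Scope ring_scope.
Set Implicit Arguments.
Unset Strict Implicit.
Unset Printing Implicit Defensive.

(** Probability is separated from analysis. The main random input is [noise_bound A n z]: over every
    index interval the squared noise sum is at most [A] times the length. The exponential moment
    bound and independence give a Gaussian tail for each interval sum; a union bound over at most
    n^2 intervals and Borel-Cantelli then yield the bound for all large n, almost surely, with [A]
    of order ln n ([noise_as]). Multiplied by n, the functional has penalty [G = gamma * n], which
    dominates [A] in all three regimes, so that fitting noise never pays for a jump. The other
    arguments are deterministic, and the Skorokhod distance is bounded by moving the break points of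
    the estimator onto those of a partition with a piecewise linear time change ([skorokhod_grid]).

    For (i), comparing the minimizer with a sampled version of the limit minimizer ([potts_basic])
    shows that its number of jumps is bounded and that its continuous Potts value is almost minimal.
    Partitions with a bounded number of cells are compact once empty cells are allowed, and
    uniqueness of the minimizer forces almost minimal step functions to be close to it in L^2
    ([limit_minimizer_compact], [near_minimizer]). A step function with no more jumps than the limit
    and close to it in L^2 has its jumps and heights close as well ([step_recovery]).

    For (ii) the number of jumps is not controlled, so local optimality is used instead: overwriting
    the estimator on one interval must not lower the functional. Hence every segment carries its
    data mean, short segments do not occur ([segment_length]), and a segment substantially
    overlapping a cell on which f hardly oscillates has a value close to that of f ([cell_close],
    [minimizer_close]). For continuous f, uniform continuity absorbs the time change
    ([skorokhod_unif]).

    For (iii), the estimator has exactly as many jumps as f, each within O([A]) indices of a true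
    one, with squared height errors O([A] / n) ([step_structure]); this gives the almost sure rate.
    For the rate in probability, a position error of order ln n / n is already negligible against
    n^(-1/2), and each height is essentially a data mean over a fixed cell of f, so only finitely
    many noise sums have to be of order sqrt n ([step_height], [step_rates]). *)

Section discrete_potts.
Context {R : realFieldType}.
Implicit Types (U V W Y g z : nat -> R) (n a b p q : nat) (A G th : R).

(** * Discrete Potts functional and the basic inequality *)

Definition jump U p : bool := U p.-1 != U p.

Definition jumps n U : nat := (\sum_(1 <= p < n) jump U p)%N.

Definition cost n Y U : R := \sum_(0 <= i < n) (U i - Y i) ^+ 2.

(** Signals are functions on [nat] read below [n], and the functional is multiplied by [n], so [G]
    stands for gamma n. *)
Definition nat_minimizer n G Y U : Prop :=
  forall V, cost n Y U + G * (jumps n U)%:R <= cost n Y V + G * (jumps n V)%:R.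

(** The multiscale noise event. Almost surely it holds eventually with [A] of order ln n. *)
Definition noise_bound A n z : Prop :=
  forall a b, (a < b <= n)%N -> (\sum_(a <= i < b) z i) ^+ 2 <= A * (b - a)%:R.

Lemma jumpsS n U : jumps n.+2 U = (jumps n.+1 U + jump U n.+1)%N.
Proof. by rewrite /jumps big_nat_recr. Qed.

Lemma last_block n U : (0 < n)%N -> exists p, [/\ (p < n)%N,
  forall i, (p <= i < n)%N -> U i = U p &
  (p = 0 /\ jumps n U = 0)%N \/ ((0 < p)%N /\ jumps n U = (jumps p U).+1)].
Proof.
case: n => // n _; elim: n => [|n [p [pn cU hJ]]].
  exists 0%N; split=> // [i|]; last by left; rewrite /jumps big_geq.
  by case: i.
case: (eqVneq (U n) (U n.+1)) => E.
  exists p; split; [lia| |].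
    move=> i /andP[pi]; rewrite ltnS leq_eqVlt => /orP[/eqP->|i_n].
      by rewrite -E cU //; lia.
    by rewrite cU // pi.
  by rewrite jumpsS /jump /= E eqxx addn0.
exists n.+1; split=> // [i|]; first by move=> hi; congr (U _); lia.
by right; rewrite jumpsS /jump /= E addn1.
Qed.

Lemma sum_block a b U (c : R) : (a <= b)%N ->
  (forall i, (a <= i < b)%N -> U i = c) ->
  \sum_(a <= i < b) U i = c * (b - a)%:R.
Proof.
move=> ab h; rewrite (eq_big_nat _ _ h) sumr_const_nat.
by rewrite mulr_natr.
Qed.

(** On a block where [W] is constant the noise enters only through its block sum, whose square is at
    most [A] times the length. Completing the square costs [A / th] once per block, and there is one
    block more than there are jumps. *)
Lemma noise_cross A th n N z W : 0 <= A -> 0 < th -> (n <= N)%N ->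
  noise_bound A N z ->
  2 * \sum_(0 <= i < n) W i * z i <=
  th * (\sum_(0 <= i < n) W i ^+ 2) + A / th * (jumps n W).+1%:R.
Proof.
move=> A0 th0 + hz; elim/ltn_ind: n => n IH nN.
have B0 : 0 <= A / th by rewrite divr_ge0 // ltW.
case: (posnP n) => [->|n0].
  by rewrite !big_geq // !mulr0 add0r mulr_ge0.
have [p [pn cW hJ]] := last_block W n0.
have blk : 2 * (\sum_(p <= i < n) W i * z i) <=
   th * (\sum_(p <= i < n) W i ^+ 2) + A / th.
  rewrite (eq_big_nat _ _ (F2 := fun i => W p * z i)); last first.
    by move=> i hi; rewrite cW.
  rewrite -mulr_sumr (@sum_block _ _ (fun i => W i ^+ 2) (W p ^+ 2)) ?(ltnW pn)//;
    last by move=> i hi; rewrite cW.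
  have := hz p n; rewrite pn nN => /(_ isT).
  set S := \sum_(_ <= i < _) _; set L := (n - p)%:R.
  have L0 : 0 < L by rewrite /L ltr0n subn_gt0.
  have eA : A = A / th * th by field; rewrite gt_eqF.
  move: B0 eA; set a := A / th => B0 -> hS.
  (* Multiplied by [th * L], the difference of the two sides is
     [(th * L * W p - S)^2 + (A * L - S^2)]. *)
  rewrite -subr_ge0 -(pmulr_rge0 _ (mulr_gt0 th0 L0)).
  have := sqr_ge0 (th * L * W p - S); nra.
rewrite (@big_cat_nat _ _ _ p) //= ?(ltnW pn)//.
rewrite (@big_cat_nat _ _ _ p 0%N n _ (fun i => W i ^+ 2)) //= ?(ltnW pn)//.
case: hJ => [[p0 ->]|[p0 ->]].
  rewrite p0 in blk *; rewrite !(@big_geq _ _ _ 0%N 0%N) // !add0r mulr1.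
  exact: blk.
have := IH p pn (leq_trans (ltnW pn) nN).
rewrite -[(jumps p W).+2%:R]natr1; lra.
Qed.

Lemma jumps_sub n U V : (jumps n (fun i => U i - V i)%R <= jumps n U + jumps n V)%N.
Proof.
rewrite /jumps -big_split /=; apply: leq_sum => p _; rewrite /jump.
case: (eqVneq (U p.-1) (U p)) => [->|_]; case: (eqVneq (V p.-1) (V p)) => [->|_] //=.
  by rewrite eqxx.
all: by case: (_ != _).
Qed.

(** Optimality of [U] against [V], expanded about the noise-free [g]; the cross term is bounded by
    [noise_cross] for [W = U - V], whose jumps are among those of [U] and [V]. The factor [th] is
    left free: moderate values give a priori bounds, small ones near-optimality. *)
Lemma potts_basic A G th n Y g U V : 0 <= A -> 0 < th ->
  noise_bound A n (fun i => Y i - g i) -> nat_minimizer n G Y U ->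
  cost n g U + G * (jumps n U)%:R <=
  cost n g V + G * (jumps n V)%:R + th * cost n V U +
  A / th * (jumps n U + jumps n V).+1%:R.
Proof.
move=> A0 th0 hz /(_ V) hU.
have := noise_cross (fun i => U i - V i) A0 th0 (leqnn n) hz.
have eq1 : cost n Y U - cost n Y V = cost n g U - cost n g V -
    2 * \sum_(0 <= i < n) (U i - V i) * (Y i - g i).
  rewrite mulr_sumr /cost -!sumrB; apply: eq_bigr => i _; ring.
have hJ : (A / th) * (jumps n (fun i => U i - V i)).+1%:R <=
   A / th * (jumps n U + jumps n V).+1%:R.
  rewrite ler_wpM2l ?divr_ge0 ?(ltW th0)// ler_nat ltnS; exact: jumps_sub.
rewrite -/(cost n V U); lra.
Qed.

Lemma block_partition n U : (0 < n)%N -> exists p : nat -> nat,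
  [/\ p 0%N = 0%N, p (jumps n U).+1 = n,
      forall j, (j <= jumps n U)%N -> (p j < p j.+1)%N &
      forall j i, (j <= jumps n U)%N -> (p j <= i < p j.+1)%N -> U i = U (p j)].
Proof.
elim/ltn_ind: n => n IH n0.
have [q [qn cU hJ]] := last_block U n0.
case: hJ => [[q0 ->]|[q0 ->]].
  exists (fun j => if j == 0%N then 0%N else n); split=> //.
    by case.
  by case=> // i _ /= hi; rewrite (cU i) ?q0.
have [p [p0 pq mp cp]] := IH q qn q0.
exists (fun j => if (j <= (jumps q U).+1)%N then p j else n); split=> //=.
- by rewrite ltnn.
- move=> j hj; have /orP[/eqP->|jJ] : (j == (jumps q U).+1) || (j < (jumps q U).+1)%N by rewrite -leq_eqVlt.
     by rewrite leqnn ltnn pq.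
  by rewrite (ltnW jJ) jJ; exact: mp.
- move=> j i hj; have /orP[/eqP->|jJ] : (j == (jumps q U).+1) || (j < (jumps q U).+1)%N by rewrite -leq_eqVlt.
    by rewrite leqnn ltnn pq => hi; exact: cU.
  by rewrite (ltnW jJ) jJ; exact: cp.
Qed.

End discrete_potts.

Lemma step_homo (s : nat -> nat) m : (forall j, (j < m)%N -> (s j < s j.+1)%N) ->
  forall i j, (i < j <= m)%N -> (s i < s j)%N.
Proof.
move=> h i; elim=> [|j IH]; first by rewrite ltn0.
case/andP; rewrite ltnS leq_eqVlt => /orP[/eqP->|ij] jm; first exact: h.
by apply: ltn_trans (h _ jm); apply: IH; rewrite ij ltnW.
Qed.

(** * Recovering jumps and heights from a small quadratic cost *)

Section step_recovery.
Context {R : realFieldType}.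
Implicit Types (U V W Y g h z : nat -> R) (n a b p q : nat) (A G th : R).

Lemma block_cost_le a b n g U : (a <= b <= n)%N ->
  \sum_(a <= i < b) (U i - g i) ^+ 2 <= cost n g U.
Proof.
case/andP=> ab bn; rewrite /cost.
rewrite (@big_cat_nat _ _ _ a 0 n) //= ?(leq_trans ab)//.
rewrite (@big_cat_nat _ _ _ b a n) //=.
have pos c d : 0 <= \sum_(c <= i < d) (U i - g i) ^+ 2.
  by apply: sumr_ge0 => i _; exact: sqr_ge0.
have := pos 0%N a; have := pos b n; lra.
Qed.

Lemma const_no_jump U p q : (forall i, (p < i < q)%N -> ~~ jump U i) ->
  forall i, (p <= i < q)%N -> U i = U p.
Proof.
move=> h; elim=> [|i IH]; first by case: p h.
case/andP; rewrite leq_eqVlt => /orP[/eqP->//|pi] iq.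
have /negPn/eqP/= <- : ~~ jump U i.+1 by apply: h; rewrite pi.
by apply: IH; rewrite -ltnS pi ltnW.
Qed.

Lemma jumps_count n U : jumps n U = size [seq p <- index_iota 1 n | jump U p].
Proof.
rewrite size_filter -sum1_count big_mkcond /=.
by apply: eq_bigr => p _; case: (jump U p).
Qed.

(** Without a jump within [r] of the break [a j], [U] would be constant on [2 * r] indices where [g]
    takes two values at distance at least [D], costing at least [r * D^2 / 2 > E]. As [2 * r <= L],
    the jumps found near different breaks are distinct, so they exhaust the [m.-1] jumps allowed.
    Between them [U] is constant and shares at least [L - 2 * r] indices with the true cell, which
    bounds the height error. *)
Lemma step_recovery n m (a : nat -> nat) h (L r : nat) (D E : R) U g :
  (0 < m)%N -> a 0%N = 0%N -> a m = n ->
  (forall j, (j < m)%N -> (a j + L <= a j.+1)%N) ->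
  (forall j i, (j < m)%N -> (a j <= i < a j.+1)%N -> g i = h j) ->
  0 <= D ->
  (forall j, (0 < j < m)%N -> D <= `|h j.-1 - h j|) ->
  (jumps n U <= m.-1)%N -> cost n g U <= E ->
  (0 < r)%N -> (2 * r <= L)%N -> 2 * E < r%:R * D ^+ 2 ->
  (m.-1 <= jumps n U)%N /\
  exists s : nat -> nat, [/\ s 0%N = 0%N, s m = n,
    forall j, (j <= m)%N -> (s j < a j + r)%N && (a j < s j + r)%N,
    forall j, (j < m)%N -> (s j < s j.+1)%N /\ ((0 < j)%N -> jump U (s j)) &
    forall j, (j < m)%N -> (forall i, (s j <= i < s j.+1)%N -> U i = U (s j)) /\
      (L - 2 * r)%:R * (U (s j) - h j) ^+ 2 <= E].
Proof.
move=> m0 a0 am ha hg D0 hD hJ hE r0 rL hr.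
have an j : (j <= m)%N -> (a j <= n)%N.
  rewrite leq_eqVlt => /orP[/eqP->|jm]; first by rewrite am.
  have := @step_homo a m; rewrite -am => /(_ _ j m) h'; apply/ltnW/h'; last lia.
  by move=> i im; have := ha i im; lia.
have win j : (0 < j < m)%N ->
    exists p, [/\ (p < a j + r)%N, (a j < p + r)%N & jump U p].
  move=> /andP[j0 jm]; apply: contrapT => /forallNP hn.
  have hj1 := ha j.-1 ltac:(lia); rewrite prednK // in hj1.
  have hg' i : (a j.-1 <= i < a j)%N -> g i = h j.-1.
    by move=> hi; apply: hg; rewrite ?prednK //; lia.
  have hj2 := ha j jm; have hj3 := an j.+1 jm.
  have cU : forall i, (a j - r <= i < a j + r)%N -> U i = U (a j - r)%N.
    apply: const_no_jump => i hi; apply/negP => ji; apply: (hn i); split=> //; lia.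
  have := hD j; rewrite j0 jm => /(_ isT).
  set c := U (a j - r)%N in cU *.
  have b1 := @block_cost_le (a j - r) (a j + r) n g U ltac:(lia).
  have e1 : \sum_(a j - r <= i < a j) (U i - g i) ^+ 2 = (c - h j.-1) ^+ 2 * r%:R.
    rewrite (@sum_block _ _ _ _ ((c - h j.-1) ^+ 2)); [|lia|].
      by congr (_ * _%:R); lia.
    by move=> i hi; rewrite cU ?hg' //; lia.
  have e2 : \sum_(a j <= i < a j + r) (U i - g i) ^+ 2 = (c - h j) ^+ 2 * r%:R.
    rewrite (@sum_block _ _ _ _ ((c - h j) ^+ 2)); [|lia|].
      by congr (_ * _%:R); lia.
    by move=> i hi; rewrite cU ?(hg j) //; lia.
  rewrite (@big_cat_nat _ _ _ (a j)) /= in b1; [|lia|lia].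
  rewrite e1 e2 in b1 => hd.
  have hd2 : D ^+ 2 <= (h j.-1 - h j) ^+ 2.
    by rewrite -[leRHS]real_normK ?num_real// lerXn2r ?nnegrE.
  have rr : 0 <= r%:R :> R by rewrite ler0n.
  (* Twice the sum of the squared distances of [c] to the two heights is the squared jump plus this
     square. *)
  have := sqr_ge0 (2 * c - h j.-1 - h j); nra.
have [s hs] : {s : nat -> nat | forall j,
    ((0 < j < m)%N -> [/\ (s j < a j + r)%N, (a j < s j + r)%N & jump U (s j)]) /\
    (j = 0%N -> s j = 0%N) /\ (j = m -> s j = n)}.
  apply/cid; suff /choice[s hs] : forall j, exists p,
    ((0 < j < m)%N -> [/\ (p < a j + r)%N, (a j < p + r)%N & jump U p]) /\
    (j = 0%N -> p = 0%N) /\ (j = m -> p = n) by exists s.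
  move=> j; case: (posnP j) => [->|j0].
    by exists 0%N; split=> //; split=> // e; move: m0; rewrite -e.
  case: (eqVneq j m) => [->|jm].
    by exists n; split; [rewrite ltnn andbF|split=> // e; rewrite e in m0].
  case: (ltnP j m) => jm2; last by exists 0%N; split; [lia|split; lia].
  have [|p hp] := win j; first by rewrite j0.
  by exists p; split=> //; split=> e; lia.
have s0 : s 0%N = 0%N by have [_ [+ _]] := hs 0%N; exact.
have sm : s m = n by have [_ [_ +]] := hs m; exact.
have near j : (j <= m)%N -> (s j < a j + r)%N && (a j < s j + r)%N.
  rewrite leq_eqVlt => /orP[/eqP->|jm]; first by rewrite sm am; lia.
  case: (posnP j) => [->|j0]; first by rewrite s0 a0; lia.
  by have [+ _] := hs j; rewrite j0 jm => /(_ isT)[-> ->].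
have s_incr j : (j < m)%N -> (s j < s j.+1)%N.
  move=> jm; have := near j (ltnW jm); have := near j.+1 jm; have := ha j jm; lia.
have smono := step_homo s_incr.
have sj j : j \in iota 1 m.-1 -> (0 < s j < n)%N && jump U (s j).
  rewrite mem_iota => hj; have hj' : (0 < j < m)%N by lia.
  have [/(_ hj')[_ _ ->] _] := hs j; rewrite andbT -{1}s0 -sm.
  by rewrite !smono //; lia.
have su : uniq [seq s j | j <- iota 1 m.-1].
  rewrite map_inj_in_uniq ?iota_uniq// => i j; rewrite !mem_iota => hi hj e.
  case: (ltngtP i j) => // ij.
    by have := @smono i j; rewrite e ltnn; lia.
  by have := @smono j i; rewrite e ltnn; lia.
have ssub : {subset [seq s j | j <- iota 1 m.-1] <=
    [seq p <- index_iota 1 n | jump U p]}.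
  move=> _ /mapP[j /sj/andP[hj1 hj2] ->].
  by rewrite mem_filter hj2 mem_index_iota; lia.
split.
  have := uniq_leq_size su ssub; by rewrite size_map size_iota jumps_count.
exists s; split=> // j jm.
  split=> [|j0]; first exact: s_incr.
  by have /andP[] := sj j ltac:(by rewrite mem_iota; lia).
(* A further jump [p] here would be distinct from all the [s i], giving [m] jumps in total. *)
have cU : forall i, (s j <= i < s j.+1)%N -> U i = U (s j).
  apply: const_no_jump => p hp; apply/negP => jp.
  have pn : (p < n)%N.
    have : (s j.+1 <= n)%N; last by lia.
    rewrite -sm; move: jm; rewrite leq_eqVlt => /orP[/eqP->//|jm].
    by apply/ltnW/smono; rewrite jm leqnn.
  have pmem : p \notin [seq s j | j <- iota 1 m.-1].
    apply/negP => /mapP[i]; rewrite mem_iota => hi e.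
    case: (ltngtP i j) => ij.
    - have := @smono i j; lia.
    - move: ij; rewrite leq_eqVlt => /orP[/eqP ij|ij]; first by subst i; lia.
      have := @smono j.+1 i; lia.
    - by subst i; lia.
  have u2 : uniq (p :: [seq s j | j <- iota 1 m.-1]) by rewrite /= pmem.
  have : {subset p :: [seq s j | j <- iota 1 m.-1] <=
      [seq p <- index_iota 1 n | jump U p]}.
    move=> x; rewrite inE => /orP[/eqP->|/ssub//].
    by rewrite mem_filter jp mem_index_iota; lia.
  move/(uniq_leq_size u2); rewrite -jumps_count /= size_map size_iota; lia.
split=> //.
have nj := near j (ltnW jm); have nj1 := near j.+1 jm; have hj := ha j jm.
have an1 := an j.+1 jm.
have snj : (s j.+1 <= n)%N.
  rewrite -sm; move: jm; rewrite leq_eqVlt => /orP[/eqP->//|jm].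
  by apply/ltnW/smono; rewrite jm leqnn.
pose lo := maxn (s j) (a j); pose hi := minn (s j.+1) (a j.+1).
have lohi : (lo <= hi)%N by rewrite /lo /hi; lia.
have := @block_cost_le lo hi n g U ltac:(rewrite /lo /hi; lia).
rewrite (@sum_block _ _ _ _ ((U (s j) - h j) ^+ 2)) //; last first.
  by move=> i; rewrite /lo /hi => ?; rewrite cU ?(hg j) //; lia.
move=> /le_trans/(_ hE); apply: le_trans; rewrite mulrC.
by rewrite ler_wpM2l ?sqr_ge0// ler_nat /lo /hi; lia.
Qed.

End step_recovery.

(** * Local optimality: resetting a minimizer on an interval *)

Section local_moves.
Context {R : realFieldType}.
Implicit Types (U V W Y g h z : nat -> R) (n a b p q : nat) (A G c e : R).

Definition reset U a b c : nat -> R := fun i => if (a <= i < b)%N then c else U i.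

Definition mean Y a b : R := (\sum_(a <= i < b) Y i) / (b - a)%:R.

Lemma sum_pick n a (x : nat -> nat) :
  (\sum_(1 <= p < n) (p == a) * x p = ((0 < a < n)%N : nat) * x a)%N.
Proof.
case: (boolP (0 < a < n)%N) => h.
  rewrite (bigD1_seq a) ?iota_uniq ?mem_index_iota//= eqxx mul1n.
  by rewrite big1 ?addn0// => i /negPf ->.
rewrite big_nat_cond big1// => i /andP[hi _]; case: eqP => // e.
by move: h; rewrite -e hi.
Qed.

(** Only the two ends of the interval can change status. The old end jumps are added on the left
    instead of being subtracted because the count lives in [nat]. *)
Lemma jumps_reset n U a b c e : (a < b <= n)%N ->
  (forall i, (a <= i < b)%N -> U i = e) ->
  (jumps n (reset U a b c) + ((0 < a)%N && jump U a) + ((b < n)%N && jump U b) =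
   jumps n U + ((0 < a)%N && (U a.-1 != c)) + ((b < n)%N && (c != U b)))%N.
Proof.
move=> /andP[ab bn] cU.
have pickE k (x : nat -> bool) : ((0 < k < n)%N && x k : nat) =
    (\sum_(1 <= p < n) (p == k) * x p)%N.
  by rewrite (@sum_pick _ _ x); case: (0 < k < n)%N; case: (x k).
have e1 (x : bool) : ((0 < a)%N && x) = ((0 < a < n)%N && x).
  by rewrite (leq_trans ab bn) andbT.
have e2 (x : bool) : ((b < n)%N && x) = ((0 < b < n)%N && x).
  by rewrite (leq_ltn_trans _ ab).
rewrite (e1 (jump U a)) (e2 (jump U b)) (e1 (U a.-1 != c)) (e2 (c != U b)).
rewrite (pickE a (jump U)) (pickE b (jump U)).
rewrite (pickE a (fun p => U p.-1 != c)) (pickE b (fun p => c != U p)).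
rewrite /jumps -!big_split; apply: eq_big_nat => p /andP[p0 pn] /=.
rewrite /jump /reset.
have sm := (mul0n, mul1n, addn0, add0n).
case: (ltngtP p a) => [pa|ap|pa].
- have -> : (a <= p.-1)%N = false by lia.
  have -> : (p == b) = false by lia.
  by rewrite /= !sm.
- case: (ltngtP p b) => [pb|bp|pb] /=.
  + have -> : (a <= p.-1 < b)%N = true by lia.
    by rewrite (cU p.-1) ?(cU p) ?eqxx ?sm //; lia.
  + have -> : (p.-1 < b)%N = false by lia.
    by rewrite !andbF !sm.
  + have -> : (a <= p.-1 < b)%N = true by lia.
    by rewrite !sm addnC.
- subst p; have -> : (a <= a.-1 < b)%N = false by lia.
  have -> : (a == b) = false by lia.
  by rewrite ab /= !sm addnC.
Qed.

(** The quadratic cost of a constant [c] on [[a, b)] is the length times [(c - mean)^2] plus a term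
    free of [c]. All local moves below are instances of this one. *)
Lemma opt_reset n G Y U a b c e : (a < b <= n)%N -> nat_minimizer n G Y U ->
  (forall i, (a <= i < b)%N -> U i = e) ->
  0 <= (b - a)%:R * ((c - mean Y a b) ^+ 2 - (e - mean Y a b) ^+ 2) +
    G * (((0 < a)%N && (U a.-1 != c))%:R + ((b < n)%N && (c != U b))%:R -
         ((0 < a)%N && jump U a)%:R - ((b < n)%N && jump U b)%:R).
Proof.
move=> abn hU cU; have := hU (reset U a b c).
have /(congr1 (fun k => k%:R : R)) := jumps_reset c abn cU.
case/andP: abn => ab bn.
have L0 : (b - a)%:R != 0 :> R by rewrite pnatr_eq0; lia.
have -> : cost n Y (reset U a b c) = cost n Y U +
    (b - a)%:R * ((c - mean Y a b) ^+ 2 - (e - mean Y a b) ^+ 2).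
  rewrite /cost !(@big_cat_nat _ _ _ a 0 n) //=; [|lia|lia].
  rewrite !(@big_cat_nat _ _ _ b a n) //=; [|lia|lia].
  rewrite (@eq_big_nat _ _ _ 0 a _ (fun i => (U i - Y i) ^+ 2)); last first.
    by move=> i hi; rewrite /reset ifF //; lia.
  rewrite (@eq_big_nat _ _ _ b n _ (fun i => (U i - Y i) ^+ 2)); last first.
    by move=> i hi; rewrite /reset ifF //; lia.
  rewrite (@eq_big_nat _ _ _ a b (fun i => (reset U a b c i - Y i) ^+ 2)
     (fun i => (U i - Y i) ^+ 2 + ((c ^+ 2 - e ^+ 2) - 2 * (c - e) * Y i))); last first.
    by move=> i hi; rewrite (cU i hi) /reset hi; ring.
  rewrite big_split /= sumrB sumr_const_nat -mulr_sumr.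
  have -> : \sum_(a <= i < b) Y i = mean Y a b * (b - a)%:R by rewrite /mean divfK.
  rewrite -mulr_natr; ring.
rewrite !natrD => hj hc.
have -> : ((0 < a)%N && (U a.-1 != c))%:R + ((b < n)%N && (c != U b))%:R -
         ((0 < a)%N && jump U a)%:R - ((b < n)%N && jump U b)%:R =
   (jumps n (reset U a b c))%:R - (jumps n U)%:R :> R by lra.
lra.
Qed.

(** Giving [[a, b)] its own data mean creates at most two jumps. *)
Lemma opt_split n G Y U a b e : (a < b <= n)%N -> nat_minimizer n G Y U -> 0 <= G ->
  (forall i, (a <= i < b)%N -> U i = e) ->
  (b - a)%:R * (e - mean Y a b) ^+ 2 <= 2 * G.
Proof.
move=> abn hU G0 cU; have := @opt_reset n G Y U a b (mean Y a b) e abn hU cU.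
rewrite subrr expr0n /= sub0r.
move: (_ && _) (_ && _) (_ && _) (_ && _) => [] [] [] [] /=; lra.
Qed.

(** A maximal interval of constancy of [U]. *)
Definition segment n U p q : Prop :=
  [/\ (p < q <= n)%N, (forall i, (p <= i < q)%N -> U i = U p),
      p = 0%N \/ jump U p & q = n \/ jump U q].

(** Handing [[a, b)] to the left neighbour removes the jump at [a] and creates at most one at [b],
    so it cannot improve the fit. *)
Lemma opt_take_left n G Y U a b : (0 < a)%N -> (a < b <= n)%N ->
  nat_minimizer n G Y U -> 0 <= G ->
  (forall i, (a <= i < b)%N -> U i = U a) -> jump U a ->
  (U a - mean Y a b) ^+ 2 <= (U a.-1 - mean Y a b) ^+ 2.
Proof.
move=> a0 abn hU G0 cU ja; have := @opt_reset n G Y U a b (U a.-1) _ abn hU cU.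
have L0 : 0 < (b - a)%:R :> R by rewrite ltr0n; lia.
rewrite a0 ja eqxx /= => h0; rewrite -(ler_pM2l L0); move: h0.
move: (_ && _) (_ && _) => [] [] /=; lra.
Qed.

Lemma opt_take_right n G Y U a b : (a < b < n)%N ->
  nat_minimizer n G Y U -> 0 <= G ->
  (forall i, (a <= i < b)%N -> U i = U a) -> jump U b ->
  (U a - mean Y a b) ^+ 2 <= (U b - mean Y a b) ^+ 2.
Proof.
move=> /andP[ab bn] hU G0 cU ja.
have := @opt_reset n G Y U a b (U b) _ ltac:(lia) hU cU.
have L0 : 0 < (b - a)%:R :> R by rewrite ltr0n; lia.
rewrite bn ja eqxx /= => h0; rewrite -(ler_pM2l L0); move: h0.
move: (_ && _) (_ && _) => [] [] /=; lra.
Qed.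

(** The ends of a segment are jumps already, or ends of the range, so resetting it to its data mean
    adds no penalty. *)
Lemma opt_mean n G Y U p q : nat_minimizer n G Y U -> 0 <= G ->
  segment n U p q -> U p = mean Y p q.
Proof.
move=> hU G0 [pqn cU hp hq].
have := @opt_reset n G Y U p q (mean Y p q) _ pqn hU cU.
have L0 : 0 < (q - p)%:R :> R by rewrite ltr0n; lia.
rewrite subrr expr0n /= sub0r => h.
have {h} : (q - p)%:R * (U p - mean Y p q) ^+ 2 <= 0.
  case: hp h => [->|->]; case: hq => [->|->]; rewrite ?ltnn ?andbT /=;
  try case: (0 < p)%N; try case: (q < n)%N; try case: (_ != _);
  try case: (_ != _); rewrite /=; lra.
rewrite pmulr_rle0// => h; apply/eqP; rewrite -subr_eq0 -sqrf_eq0 eq_le h /=.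
exact: sqr_ge0.
Qed.

(** Merging with the left neighbour removes the jump at [p] and creates none, so the loss of fit is
    at least one penalty. *)
Lemma opt_merge_left n G Y U p q : nat_minimizer n G Y U -> 0 <= G ->
  segment n U p q -> (0 < p)%N ->
  G <= (q - p)%:R * (U p.-1 - mean Y p q) ^+ 2.
Proof.
move=> hU G0 sg p0; have mE := opt_mean hU G0 sg.
case: sg => [pqn cU hp hq].
have := @opt_reset n G Y U p q (U p.-1) _ pqn hU cU.
rewrite -mE subrr expr0n /= subr0 p0 eqxx.
case: hp => [e|->]; first by rewrite e in p0.
case: hq => [->|->]; rewrite ?ltnn ?andbT /=;
 try case: (q < n)%N; try case: (_ != _); rewrite /=; lra.
Qed.

Lemma opt_merge_right n G Y U p q : nat_minimizer n G Y U -> 0 <= G ->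
  segment n U p q -> (q < n)%N ->
  G <= (q - p)%:R * (U q - mean Y p q) ^+ 2.
Proof.
move=> hU G0 sg qn; have mE := opt_mean hU G0 sg.
case: sg => [pqn cU hp hq].
have := @opt_reset n G Y U p q (U q) _ pqn hU cU.
rewrite -mE subrr expr0n /= subr0 qn eqxx.
case: hq => [e|->]; first by rewrite e ltnn in qn.
case: hp => [->|->]; rewrite ?ltnn ?andbT /=;
 try case: (0 < p)%N; try case: (_ != _); rewrite /=; lra.
Qed.

Lemma segment_exists n U i : (i < n)%N ->
  exists p q, segment n U p q /\ (p <= i < q)%N.
Proof.
move=> i_n.
have [p [pi hp cp]] : exists p, [/\ (p <= i)%N, p = 0%N \/ jump U p &
    forall k, (p <= k <= i)%N -> U k = U p].
  elim: i i_n => [|i IH] i_n.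
    exists 0%N; split=> //; first by left.
    by move=> k /andP[_]; rewrite leqn0 => /eqP->.
  case: (boolP (jump U i.+1)) => ji.
    exists i.+1; split=> //; first by right.
    by move=> k; rewrite -eqn_leq => /eqP ->.
  have [p [pi hp cp]] := IH (ltnW i_n); exists p; split=> //; first lia.
  move=> k /andP[pk]; rewrite leq_eqVlt => /orP[/eqP->|ki]; last first.
    by apply: cp; rewrite pk.
  by move: ji; rewrite /jump negbK /= => /eqP <-; apply: cp; rewrite pi leqnn.
have [q [qi hq cq]] : exists q, [/\ (i < q <= n)%N, q = n \/ jump U q &
    forall k, (i <= k < q)%N -> U k = U i].
  elim: {p pi hp cp} (n - i)%N {-2}i (erefl (n - i)%N) i_n => [|d IH] j hd jn.
    lia.
  case: (eqVneq j.+1 n) => [e|jn1].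
    exists n; split=> //; [lia|by left|].
    by move=> k hk; congr (U _); lia.
  case: (boolP (jump U j.+1)) => ji.
    exists j.+1; split=> //; [lia|by right|].
    by move=> k hk; congr (U _); lia.
  have [||q [qi hq cq]] := IH j.+1; [lia|lia|].
  exists q; split=> //; first lia.
  move: ji; rewrite /jump negbK /= => /eqP ji.
  move=> k /andP[]; rewrite leq_eqVlt => /orP[/eqP->//|jk] kq.
  by rewrite ji; apply: cq; rewrite jk.
exists p, q; split; last lia.
split=> //; first lia.
move=> k hk; case: (leqP k i) => ki; first by rewrite cp//; lia.
by rewrite cq ?cp //; lia.
Qed.

Lemma segment_inner n U p q k : segment n U p q -> (p < k < q)%N -> ~~ jump U k.
Proof.
move=> [pq cU _ _] hk; rewrite /jump negbK (cU k) ?(cU k.-1) //; lia.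
Qed.

Lemma segment_prev n U p q : segment n U p q -> (0 < p)%N ->
  exists p', segment n U p' p.
Proof.
move=> sg p0; have [pq _ hp _] := sg.
have [p' [q' [sg' hi]]] := @segment_exists n U p.-1 ltac:(lia).
have e : q' = p.
  case: hp => [e|jp]; first by rewrite e in p0.
  have := @segment_inner _ _ _ _ p sg'; rewrite jp; lia.
by exists p'; rewrite -e.
Qed.

Lemma segment_next n U p q : segment n U p q -> (q < n)%N ->
  exists q', segment n U q q'.
Proof.
move=> sg qn; have [pq _ _ hq] := sg.
have [p' [q' [sg' hi]]] := @segment_exists n U q ltac:(lia).
have e : p' = q.
  case: hq => [e|jq]; first by rewrite e ltnn in qn.
  have := @segment_inner _ _ _ _ q sg'; rewrite jq; lia.
by exists q'; rewrite -e.
Qed.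

Lemma segment_uniq n U p q p' q' i : segment n U p q -> segment n U p' q' ->
  (p <= i < q)%N -> (p' <= i < q')%N -> p = p' /\ q = q'.
Proof.
move=> s1 s2 h1 h2; have i1 := segment_inner s1; have i2 := segment_inner s2.
have [b1 _ e1 f1] := s1; have [b2 _ e2 f2] := s2.
split.
  case: (ltngtP p p') => // l.
    by case: e2 => [|j2]; [lia|have := i1 p'; rewrite j2; lia].
  by case: e1 => [|j1]; [lia|have := i2 p; rewrite j1; lia].
case: (ltngtP q q') => // l.
  by case: f1 => [|j1]; [lia|have := i2 q; rewrite j1; lia].
by case: f2 => [|j2]; [lia|have := i1 q'; rewrite j2; lia].
Qed.

Lemma mean_bounds Y a b (M : R) : (a < b)%N -> (forall i, (a <= i < b)%N -> `|Y i| <= M) ->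
  `|mean Y a b| <= M.
Proof.
move=> ab h; have L0 : 0 < (b - a)%:R :> R by rewrite ltr0n; lia.
rewrite /mean normrM normfV (gtr0_norm L0) ler_pdivrMr//.
rewrite (le_trans (ler_norm_sum _ _ _))//.
have -> : M * (b - a)%:R = \sum_(a <= i < b) M by rewrite sumr_const_nat mulr_natr.
by rewrite big_nat [leRHS]big_nat; apply: ler_sum => i hi; exact: h.
Qed.

Lemma meanB Y g a b : mean (fun i => Y i - g i) a b = mean Y a b - mean g a b.
Proof. by rewrite /mean sumrB mulrBl. Qed.

(* A segment at least as short as a neighbour could be absorbed by it, saving
   one jump; induction on the length covers the other segments. *)
Lemma segment_length n G Y g U (A M : R) p q : nat_minimizer n G Y U -> 0 <= G ->
  0 <= A -> 0 <= M -> (forall i, (i < n)%N -> `|g i| <= M) ->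
  noise_bound A n (fun i => Y i - g i) -> segment n U p q ->
  (p = 0%N /\ q = n) \/ G <= 8 * M ^+ 2 * (q - p)%:R + 8 * A.
Proof.
move=> hU G0 A0 M0 hg hz.
(* The means of [g] differ by at most [2 * M]. A squared noise mean is at most [A] over its length,
   and the second interval is at least as long as the first, so both noise terms contribute at most
   a multiple of [A]. *)
have main a b a' b' : (a < b <= n)%N -> (a' < b' <= n)%N -> (b - a <= b' - a')%N ->
    (b - a)%:R * (mean Y a' b' - mean Y a b) ^+ 2 <= 8 * M ^+ 2 * (b - a)%:R + 8 * A.
  move=> hab hab' hl; have l0 : 0 < (b - a)%:R :> R by rewrite ltr0n; lia.
  have l0' : 0 < (b' - a')%:R :> R by rewrite ltr0n; lia.
  have ll : (b - a)%:R <= (b' - a')%:R :> R by rewrite ler_nat.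
  have nz (k l : nat) : (k < l <= n)%N ->
     (mean Y k l - mean g k l) ^+ 2 * (l - k)%:R <= A.
    move=> hcd; have cd0 : 0 < (l - k)%:R :> R by rewrite ltr0n; lia.
    have := hz k l hcd; rewrite -meanB /mean exprMn => h.
    rewrite -(ler_pM2r cd0) (le_trans _ h)// le_eqVlt; apply/orP; left; apply/eqP.
    by field; rewrite gt_eqF.
  have n1 := nz _ _ hab; have n2 := nz _ _ hab'.
  have g1 : `|mean g a b| <= M by apply: mean_bounds => [|i hi]; [lia|apply: hg; lia].
  have g2 : `|mean g a' b'| <= M by apply: mean_bounds => [|i hi]; [lia|apply: hg; lia].
  move: n1 n2 g1 g2; rewrite !ler_norml.
  move: (mean Y a b) (mean Y a' b') (mean g a b) (mean g a' b') => y y' x x' n1 n2 /andP[x1 x2] /andP[x3 x4].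
  have n2' : (y' - x') ^+ 2 * (b - a)%:R <= A.
    by apply: le_trans n2; rewrite ler_wpM2l ?sqr_ge0.
  have dx : (x' - x) ^+ 2 <= 4 * M ^+ 2 by nra.
  have : (y' - y) ^+ 2 <= 2 * (x' - x) ^+ 2 + 4 * (y' - x') ^+ 2 + 4 * (y - x) ^+ 2.
    have := sqr_ge0 (x' - x - (y' - x') + (y - x)).
    have := sqr_ge0 ((y' - x') + (y - x)); lra.
  move=> dd; apply: (@le_trans _ _ ((b - a)%:R * (2 * (4 * M ^+ 2) + 4 * (y' - x') ^+ 2 + 4 * (y - x) ^+ 2))).
    by rewrite ler_wpM2l ?(ltW l0)//; lra.
  lra.
have mono k l : (k <= l)%N -> 8 * M ^+ 2 * k%:R + 8 * A <= 8 * M ^+ 2 * l%:R + 8 * A.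
  by move=> kl; rewrite lerD2r ler_wpM2l ?mulr_ge0 ?sqr_ge0// ler_nat.
have [k] := ubnP (q - p)%N; elim: k p q => // k IH p q hk sg.
have [pqn cU _ _] := sg; have mE := opt_mean hU G0 sg.
case: (posnP p) => [p0|p0].
  case: (eqVneq q n) => [qn|qn]; first by left.
  right; have [q' sg'] := segment_next sg ltac:(lia).
  have [pqn' _ _ _] := sg'; have mE' := opt_mean hU G0 sg'.
  case: (leqP (q - p) (q' - q)) => hl.
    have := opt_merge_right hU G0 sg ltac:(lia) => /le_trans; apply.
    by rewrite mE'; apply: main.
  have [[]|] := IH q q' ltac:(lia) sg'; first lia.
  by move=> /le_trans; apply; apply: mono; exact: ltnW.
right; have [p' sg'] := segment_prev sg p0.
have [pqn' cU' _ _] := sg'; have mE' := opt_mean hU G0 sg'.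
case: (leqP (q - p) (p - p')) => hl.
  have := opt_merge_left hU G0 sg p0 => /le_trans; apply.
  by rewrite (cU' p.-1) ?mE'; [apply: main|lia].
have [[]|] := IH p' p ltac:(lia) sg'; first lia.
by move=> /le_trans; apply; apply: mono; exact: ltnW.
Qed.

Lemma sqr_close (x y z r : R) : (x - y) ^+ 2 <= (z - y) ^+ 2 -> `|z - y| <= r -> `|x - y| <= r.
Proof.
move=> h; apply: le_trans.
by rewrite -(@ler_pXn2r _ 2%N) ?nnegrE// !real_normK ?num_real.
Qed.

(** If the overlap with the cell has at least [L / 2] indices, [opt_split] applies,
    [4 * G <= eps^2 * L] making two jumps cheap. A segment inside the cell carries its data mean. A
    segment overhanging one end has, on the other side, a neighbour of one of these two kinds; by
    [opt_take_left] or [opt_take_right] its value fits the data on the overlap at least as well as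
    the value of that neighbour. *)
Lemma cell_close n m (a : nat -> nat) h (L B : nat) (G eps : R) Y U p q j :
  nat_minimizer n G Y U -> 0 <= G -> 0 <= eps -> (0 < B)%N -> (2 * B <= L)%N ->
  (forall j, (j < m)%N -> (a j + L <= a j.+1 <= n)%N) ->
  (forall j p q, (j < m)%N -> (a j <= p < q)%N -> (q <= a j.+1)%N -> (B <= q - p)%N ->
     `|mean Y p q - h j| <= eps) ->
  4 * G <= eps ^+ 2 * L%:R ->
  (forall p q, segment n U p q -> (2 * B <= q - p)%N) ->
  (j < m)%N -> segment n U p q -> (B <= minn q (a j.+1) - maxn p (a j))%N ->
  `|U p - h j| <= 4 * eps.
Proof.
move=> hU G0 e0 B0 BL ha hY hG hlen jm sg hB.
have [pqn cU hp hq] := sg; have /andP[aL an] := ha j jm.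
have tri (x y z : R) r s t : `|x - y| <= r -> `|y - z| <= s -> r + s <= t -> `|x - z| <= t.
  by move=> h1 h2 h3; rewrite (le_trans (ler_distD y _ _))// (le_trans _ h3)// lerD.
have macro p' q' : segment n U p' q' ->
    (L <= 2 * (minn q' (a j.+1) - maxn p' (a j)))%N -> `|U p' - h j| <= 2 * eps.
  move=> [pqn' cU' _ _]; set b := minn _ _; set a0 := maxn _ _ => hL.
  have hm := @opt_split n G Y U a0 b (U p') ltac:(lia) hU G0 ltac:(move=> i hi; apply: cU'; lia).
  have hm2 : `|U p' - mean Y a0 b| <= eps.
    rewrite -[leRHS]ger0_norm// -(@ler_pXn2r _ 2%N) ?nnegrE// !real_normK ?num_real//.
    have L0 : 0 < (b - a0)%:R :> R by rewrite ltr0n; lia.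
    rewrite -(ler_pM2l L0) (le_trans hm)//.
    have : L%:R <= 2 * (b - a0)%:R :> R by rewrite -natrM ler_nat.
    have := sqr_ge0 eps; nra.
  have hm3 : `|mean Y a0 b - h j| <= eps by apply: hY => //; lia.
  apply: tri hm2 hm3 _; lra.
case: (leqP L (2 * (minn q (a j.+1) - maxn p (a j)))) => hL.
  by apply: le_trans (macro _ _ sg hL) _; lra.
have inner p' q' : segment n U p' q' -> (a j <= p')%N -> (q' <= a j.+1)%N ->
    `|U p' - h j| <= 2 * eps.
  move=> sg' h1 h2; rewrite (opt_mean hU G0 sg').
  have [b1 _ _ _] := sg'; have := hlen _ _ sg' => h3.
  have : `|mean Y p' q' - h j| <= eps by apply: hY => //; lia.
  lra.
case: (leqP (a j) p) => h1; case: (leqP q (a j.+1)) => h2.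
- by apply: le_trans (inner _ _ sg h1 h2) _; lra.
- have [p' sg'] := segment_prev sg ltac:(lia).
  have [pqn' cU' _ _] := sg'.
  have close' : `|U p' - h j| <= 2 * eps.
    (* If [p' < a j], the neighbour contains [[a j, p)], that is more than [L / 2] indices, since
       the overlap of [[p, q)] with the cell has fewer than [L / 2]. *)
    case: (leqP (a j) p') => h3; first by apply: (inner _ _ sg' h3); lia.
    by apply: (macro _ _ sg'); lia.
  have mc : `|mean Y p (a j.+1) - h j| <= eps by apply: hY => //; lia.
  have jp : jump U p by case: hp => // e; lia.
  have := @opt_take_left n G Y U p (a j.+1) ltac:(lia) ltac:(lia) hU G0
    ltac:(move=> i hi; apply: cU; lia) jp.
  rewrite (cU' p.-1); last lia.
  move=> ht; have c2 : `|U p' - mean Y p (a j.+1)| <= 3 * eps.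
    by apply: tri close' _ (_ : 2 * eps + eps <= _); [rewrite distrC|lra].
  by apply: tri (sqr_close ht c2) mc _; lra.
- have [q' sg'] := segment_next sg ltac:(lia).
  have [pqn' cU' _ _] := sg'.
  have close' : `|U q - h j| <= 2 * eps.
    case: (leqP q' (a j.+1)) => h3; first by apply: (inner _ _ sg' _ h3); lia.
    by apply: (macro _ _ sg'); lia.
  have mc : `|mean Y (a j) q - h j| <= eps by apply: hY => //; lia.
  have jq : jump U q by case: hq => // e; lia.
  have cUa : U (a j) = U p by apply: cU; lia.
  have := @opt_take_right n G Y U (a j) q ltac:(lia) hU G0
    ltac:(move=> i hi; rewrite cUa; apply: cU; lia) jq.
  rewrite cUa => ht; have c2 : `|U q - mean Y (a j) q| <= 3 * eps.
    by apply: tri close' _ (_ : 2 * eps + eps <= _); [rewrite distrC|lra].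
  by apply: tri (sqr_close ht c2) mc _; lra.
- lia.
Qed.

(* A segment overhanging a cell boundary by less than [B] is assigned to the
   other cell by moving the boundary to its end. *)
Lemma break_choice n U (B a : nat) :
  (forall p q, segment n U p q -> (2 * B <= q - p)%N) -> (0 < B)%N -> (a <= n)%N ->
  exists s, [/\ (s <= a + B)%N, (a <= s + B)%N, (s <= n)%N,
    (a = 0%N -> s = 0%N) /\ (a = n -> s = n) &
    forall p q i, segment n U p q -> (p <= i < q)%N ->
      [/\ (s <= i < a)%N -> (a < q)%N, (a <= i < s)%N -> (p < a)%N,
          (p < a < q)%N -> (i < s)%N -> (B <= a - p)%N &
          (p < a < q)%N -> (s <= i)%N -> (B <= q - a)%N]].
Proof.
move=> hlen B0; case: (ltngtP a n) => // an _; last first.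
  by exists a; split; [lia|lia|lia|split; lia|move=> p q i [] *; split; lia].
case: (posnP a) => [->|a0].
  by exists 0%N; split; [lia|lia|lia|split; lia|move=> p q i [] *; split; lia].
have [p [q [sg hi]]] := segment_exists U an.
have hl := hlen _ _ sg; have [b1 _ _ _] := sg.
have key s : [\/ (s = p /\ B <= q - a)%N, [/\ s = q, (p < a)%N & (B <= a - p)%N] |
    s = a /\ (B <= q - a)%N && (B <= a - p)%N] ->
    forall p' q' i, segment n U p' q' -> (p' <= i < q')%N ->
      [/\ (s <= i < a)%N -> (a < q')%N, (a <= i < s)%N -> (p' < a)%N,
          (p' < a < q')%N -> (i < s)%N -> (B <= a - p')%N &
          (p' < a < q')%N -> (s <= i)%N -> (B <= q' - a)%N].
  move=> hs p' q' i sg' h2.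
  have same : (p <= i < q)%N \/ (p' < a < q')%N -> p = p' /\ q = q'.
    case=> h; first exact: (segment_uniq sg sg' h h2).
    by apply: (@segment_uniq n U p q p' q' a sg sg' hi); lia.
  by case: hs => [[-> ?]|[-> ? ?]|[-> /andP[? ?]]]; split=> h3 *;
    have [|? ?] := same; lia.
case: (ltnP (a - p) B) => h1.
  exists p; split; [lia|lia|lia|split; lia|]; apply: key; apply: Or31; split; lia.
case: (ltnP (q - a) B) => h2.
  exists q; split; [lia|lia|lia|split; lia|]; apply: key; apply: Or32; split; lia.
exists a; split; [lia|lia|lia|split; lia|]; apply: key; apply: Or33; split; lia.
Qed.

(** After [break_choice] moves the breaks, every index between two new breaks lies in a segment that
    shares at least [B] indices with the corresponding old cell, so [cell_close] applies to it. *)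
Lemma minimizer_close n m (a : nat -> nat) h (L B : nat) (G eps : R) Y U :
  (0 < m)%N -> a 0%N = 0%N -> a m = n ->
  nat_minimizer n G Y U -> 0 <= G -> 0 <= eps -> (0 < B)%N -> (2 * B <= L)%N ->
  (forall j, (j < m)%N -> (a j + L <= a j.+1 <= n)%N) ->
  (forall j p q, (j < m)%N -> (a j <= p < q)%N -> (q <= a j.+1)%N -> (B <= q - p)%N ->
     `|mean Y p q - h j| <= eps) ->
  4 * G <= eps ^+ 2 * L%:R ->
  (forall p q, segment n U p q -> (2 * B <= q - p)%N) ->
  exists s : nat -> nat, [/\ s 0%N = 0%N, s m = n,
    forall j, (j <= m)%N -> (s j <= a j + B)%N && (a j <= s j + B)%N &
    forall j i, (j < m)%N -> (s j <= i < s j.+1)%N -> `|U i - h j| <= 4 * eps].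
Proof.
move=> m0 a0 am hU G0 e0 B0 BL ha hY hG hlen.
have an j : (j <= m)%N -> (a j <= n)%N.
  case: j => [|j]; first by rewrite a0.
  by move=> jm; case/andP: (ha _ jm).
have /choice[s hs] : forall j, exists s, (j <= m)%N ->
   [/\ (s <= a j + B)%N, (a j <= s + B)%N, (s <= n)%N,
    (a j = 0%N -> s = 0%N) /\ (a j = n -> s = n) &
    forall p q i, segment n U p q -> (p <= i < q)%N ->
      [/\ (s <= i < a j)%N -> (a j < q)%N, (a j <= i < s)%N -> (p < a j)%N,
          (p < a j < q)%N -> (i < s)%N -> (B <= a j - p)%N &
          (p < a j < q)%N -> (s <= i)%N -> (B <= q - a j)%N]].
  move=> j; case: (leqP j m) => jm; last by exists 0%N.
  have [s ?] := break_choice hlen B0 (an _ jm); by exists s.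
exists s; split.
- by have [_ _ _ [h0 _] _] := hs 0%N isT; exact: h0.
- by have [_ _ _ [_ h0] _] := hs m (leqnn m); exact: h0.
- by move=> j jm; have [-> -> _ _ _] := hs j jm.
move=> j i jm hi; have [x1 x2 x3 _ x5] := hs j (ltnW jm).
have [y1 y2 y3 _ y5] := hs j.+1 jm; have haj := ha j jm.
have [p [q [sg hpq]]] := @segment_exists n U i ltac:(lia).
have [b1 cU _ _] := sg; have hl := hlen _ _ sg.
rewrite cU //; apply: (cell_close hU G0 e0 B0 BL ha hY hG hlen jm sg).
have {x5}[x51 x52 x53 x54] := x5 p q i sg hpq.
have {y5}[y51 y52 y53 y54] := y5 p q i sg hpq.
clear hY hG hlen ha an hs.
case: (ltnP p (a j)) => h1; case: (ltnP (a j) q) => h2;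
case: (ltnP p (a j.+1)) => h3; case: (ltnP (a j.+1) q) => h4; lia.
Qed.

End local_moves.

(** * Time changes and upper bounds for the Skorokhod metric *)

Section time_change.
Context {R : realType}.
Implicit Types (s t e : R).

Lemma find_cell (s : nat -> R) m t : s 0%N <= t < s m ->
  exists2 j, (j < m)%N & s j <= t < s j.+1.
Proof.
case/andP=> s0; elim: m => [|m IH] sm; first by move: (le_lt_trans s0 sm); rewrite ltxx.
case: (ltP t (s m)) => h; first by have [j jm hj] := IH h; exists j => //; rewrite ltnW.
by exists m => //; rewrite h.
Qed.

Lemma knots_gap (s : nat -> R) m (dl : R) : 0 <= dl ->
  (forall j, (j < m)%N -> s j + dl <= s j.+1) ->
  forall i j, (i < j <= m)%N -> s i + dl <= s j.
Proof.
move=> d0 h i; elim=> [|j IH]; first by rewrite ltn0.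
case/andP; rewrite ltnS leq_eqVlt => /orP[/eqP->|ij] jm; first exact: h.
have := IH ltac:(by rewrite ij ltnW); have := h j jm; lra.
Qed.

Definition tent (dl a t : R) : R := Num.max 0 (1 - `|t - a| / dl).

Lemma tent_lip dl a s t : 0 < dl -> `|tent dl a t - tent dl a s| <= `|t - s| / dl.
Proof.
move=> d0; have H : `|(1 - `|t - a| / dl) - (1 - `|s - a| / dl)| <= `|t - s| / dl.
  have -> : (1 - `|t - a| / dl) - (1 - `|s - a| / dl) = (`|s - a| - `|t - a|) / dl by lra.
  rewrite normrM (gtr0_norm (_ : 0 < dl^-1)) ?invr_gt0//.
  rewrite ler_pM2r ?invr_gt0// (le_trans (ler_dist_dist _ _))// distrC.
  by have -> : t - a - (s - a) = t - s by ring.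
have p0 : 0 <= `|t - s| / dl by rewrite divr_ge0 // ltW.
rewrite /tent; move: H; set x := 1 - _; set y := 1 - _; set c := _ / dl => H.
have {H} := ler_normlP _ _ H => -[h1 h2].
apply/ler_normlP; rewrite !maxEle.
case: (leP 0 x) => hx; case: (leP 0 y) => hy; split; lra.
Qed.

Lemma tent_far dl a t : 0 < dl -> dl <= `|t - a| -> tent dl a t = 0.
Proof.
move=> d0 h; rewrite /tent max_l// subr_le0 ler_pdivlMr// mul1r //.
Qed.

Lemma tent_at dl a : tent dl a a = 1.
Proof. by rewrite /tent subrr normr0 mul0r subr0 max_r. Qed.

Lemma ln_abs_le (x k : R) : 0 <= k <= 1 / 2 -> `|x - 1| <= k -> `|ln x| <= 2 * k.
Proof.
move=> hk /ler_normlP[h1 h2]; have x0 : 0 < x by lra.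
have xi0 : 0 < x^-1 by rewrite invr_gt0.
have l1 : ln x <= x - 1.
  have := @le_ln1Dx R (x - 1); rewrite [1 + _]addrC subrK; apply; lra.
have l2 : - ln x <= x^-1 - 1.
  by rewrite -lnV ?posrE//; have := @le_ln1Dx R (x^-1 - 1); rewrite [1 + _]addrC subrK; apply; lra.
have l3 : x^-1 - 1 <= 2 * k.
  have : x^-1 * x = 1 by rewrite mulVf // gt_eqF.
  nra.
apply/ler_normlP; split; lra.
Qed.

(** All difference quotients of [id + ph] lie within [k <= 1 / 2] of 1, so their logarithms are at
    most [2 * k] in absolute value. *)
Lemma near_id_time_change (ph : R -> R) (k : R) : 0 <= k <= 1 / 2 ->
  ph 0 = 0 -> ph 1 = 0 ->
  (forall s t, `|ph t - ph s| <= k * `|t - s|) ->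
  time_changes (fun t => t + ph t) /\
  (log_slope_sup (fun t => (t + ph t)%R) <= (2 * k)%:E)%E.
Proof.
move=> hk p0 p1 lip.
have mono s t : s < t -> s + ph s < t + ph t.
  move=> st; have := lip s t; rewrite (gtr0_norm (_ : 0 < t - s)) ?subr_gt0//.
  move=> /ler_normlP[]; nra.
have cont : continuous (fun t => t + ph t).
  move=> x; apply/cvgrPdist_lt => e e0; near=> y.
  have -> : x + ph x - (y + ph y) = (x - y) + (ph x - ph y) by ring.
  rewrite (le_lt_trans (ler_normD _ _))//.
  have := lip y x; have : `|x - y| < e / 2.
    by near: y; apply: cvgr_dist_lt => //; rewrite divr_gt0.
  have := normr_ge0 (x - y); nra.
have cw : {within `[0, 1], continuous (fun t => t + ph t)}.
  exact: continuous_subspaceT.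
split.
  split=> //; first by move=> s t _ _; exact: mono.
  apply/seteqP; split=> [_ [t + <-]|v]; rewrite /= !in_itv /=.
    move=> /andP[t0 t1]; apply/andP; split.
      move: t0; rewrite (le_eqVlt 0 t) => /orP[/eqP<-|/mono]; first by rewrite p0 addr0.
      by rewrite p0; lra.
    move: t1; rewrite (le_eqVlt t 1) => /orP[/eqP->|/mono]; first by rewrite p1 addr0.
    by rewrite p1; lra.
  move=> hv; have := @IVT R (fun t => t + ph t) 0 1 v ler01 cw.
  rewrite p0 p1 !addr0 min_l ?max_r ?ler01// => /(_ hv)[c hc <-].
  by exists c => //; rewrite /= in hc.
apply: ge_ereal_sup => _ [[s t] /= [_ _ st] <-]; rewrite lee_fin.
apply: ln_abs_le => //.
have st0 : s - t != 0 by rewrite subr_eq0; exact/eqP.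
have -> : (s + ph s - (t + ph t)) / (s - t) - 1 = (ph s - ph t) / (s - t) by field.
rewrite normrM normfV ler_pdivrMr ?normr_gt0//.
Unshelve. all: by end_near.
Qed.

Lemma skorokhod_le (F G : R -> R) m (s sg : nat -> R) (dl r e : R) :
  0 < dl -> 0 <= r -> 2 * m.+1%:R * r <= dl ->
  s 0%N = 0 -> s m = 1 -> sg 0%N = 0 -> sg m = 1 ->
  (forall j, (j < m)%N -> s j + dl <= s j.+1) ->
  (forall j, (j <= m)%N -> `|sg j - s j| <= r) ->
  (forall j t y, (j < m)%N -> s j <= t < s j.+1 -> sg j <= y < sg j.+1 ->
    `|F y - G t| <= e) ->
  `|F 1 - G 1| <= e ->
  (skorokhod F G <= (Num.max (2 * (m.+1%:R * r / dl)) e)%:E)%E.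
Proof.
move=> d0 r0 hr s0 sm sg0 sgm gap hs hFG h1.
pose k := m.+1%:R * r / dl.
have hk : 0 <= k <= 1 / 2.
  rewrite /k divr_ge0 ?mulr_ge0 ?(ltW d0)//= ler_pdivrMr//; lra.
have gap' := knots_gap (ltW d0) gap.
(* Hats of width [dl] at the knots; since the knots are [dl] apart, each hat vanishes at the other
   knots and [id + ph] maps [s j] to [sg j]. Adding the slopes of all hats gives the crude Lipschitz
   constant [k]. *)
pose ph t := \sum_(j < m.+1) (sg j - s j) * tent dl (s j) t.
have phs i : (i <= m)%N -> ph (s i) = sg i - s i.
  move=> im; rewrite /ph (bigD1 (Ordinal (im : (i < m.+1)%N)))//= tent_at mulr1.
  rewrite big1 ?addr0// => j hj; rewrite tent_far ?mulr0//.
  have : (nat_of_ord j != i) by apply: contra hj => /eqP e'; apply/eqP/val_inj.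
  rewrite neq_ltn => /orP[ji|ij].
    by have := gap' j i; rewrite ji im => /(_ isT) h; rewrite ger0_norm; lra.
  have := gap' i j; rewrite ij -ltnS ltn_ord => /(_ isT) h.
  by rewrite distrC ger0_norm; lra.
have ph0 : ph 0 = 0 by rewrite -{1}s0 phs// sg0 s0 subrr.
have ph1 : ph 1 = 0 by rewrite -{1}sm phs// sgm sm subrr.
have lip a b : `|ph b - ph a| <= k * `|b - a|.
  rewrite /ph -sumrB (le_trans (ler_norm_sum _ _ _))//.
  apply: (@le_trans _ _ (\sum_(j < m.+1) r * (`|b - a| / dl))).
    apply: ler_sum => j _; rewrite -mulrBr normrM ler_pM//.
      by apply: hs; rewrite -ltnS.
    exact: tent_lip.
  rewrite sumr_const card_ord -mulr_natl /k; lra.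
have [tc ls] := near_id_time_change hk ph0 ph1 lip.
have [mono _ _] := tc.
apply: (@le_trans _ _ (maxe (log_slope_sup (fun t => (t + ph t)%R))
   (ereal_sup [set (`|F (t + ph t) - G t|)%:E | t in `[0%R, 1%R]]))%E).
  apply: ereal_inf_lbound; exact: imageP.
rewrite EFin_max ge_max !le_max ls /=; apply/orP; right.
apply: ge_ereal_sup => _ [t /= + <-]; rewrite in_itv /= => /andP[t0 t1].
rewrite lee_fin; move: t1; rewrite le_eqVlt => /orP[/eqP->|t1].
  by rewrite ph1 addr0.
have [j jm hj] : exists2 j, (j < m)%N & s j <= t < s j.+1.
  by apply: find_cell; rewrite s0 sm t0.
apply: (hFG j) => //.
have inI i : (i <= m)%N -> s i \in `[0, 1]%R.
  move=> im; rewrite in_itv /=; case: (posnP i) => [->|i0]; first by rewrite s0 lexx ler01.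
  have := gap' 0%N i; rewrite i0 im s0 => /(_ isT) h.
  move: im; rewrite leq_eqVlt => /orP[/eqP->|im]; first by rewrite sm lexx ler01.
  have := gap' i m; rewrite im leqnn sm => /(_ isT) h'; apply/andP; split; lra.
have lamE i : (i <= m)%N -> s i + ph (s i) = sg i.
  by move=> im; rewrite phs // addrC subrK.
have tI : t \in `[0, 1]%R by rewrite in_itv /= t0 ltW.
case/andP: hj => hj1 hj2; apply/andP; split.
  rewrite -lamE ?(ltnW jm)//; move: hj1; rewrite le_eqVlt => /orP[/eqP->//|h].
  by apply/ltW/mono => //; apply/inI/ltnW.
by rewrite -lamE //; apply: mono => //; exact: inI.
Qed.

(** One cell and unmoved knots, that is, the identity time change. *)
Lemma skorokhod_le_dist (F G : R -> R) (M : R) :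
  (forall x y, 0 <= x < 1 -> 0 <= y < 1 -> `|F x - G y| <= M) -> `|F 1 - G 1| <= M ->
  0 <= M -> (skorokhod F G <= M%:E)%E.
Proof.
move=> h h1 M0; have := @skorokhod_le F G 1 (fun j => j%:R) (fun j => j%:R) 1 0 M.
rewrite !mulr0 mul0r mulr0 max_r//; apply=> //.
- by case=> // _; rewrite add0r.
- by move=> j _; rewrite subrr normr0.
- by case=> // t y _ ht hy; apply: h.
Qed.

(* A time change with small logarithmic slopes fixes 0 and is close to the
   identity, so it can be absorbed by the uniform continuity of the limit. *)
Lemma skorokhod_lt_dist (F f : R -> R) (eta : R) : 0 < eta <= 1 / 2 ->
  (skorokhod F f < eta%:E)%E -> forall x, 0 <= x <= 1 ->
  exists t, [/\ 0 <= t <= 1, `|x - t| <= 2 * eta & `|F x - f t| <= eta].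
Proof.
move=> he /ereal_inf_lt[_ [lam [mono cont onto] <-]].
rewrite gt_max => /andP[ls sup] x x01.
have lam01 t : 0 <= t <= 1 -> 0 <= lam t <= 1.
  move=> h; have : (lam @` `[0, 1]) (lam t) by exists t => //=; rewrite in_itv.
  by rewrite onto /= in_itv.
have inv y : 0 <= y <= 1 -> exists2 t, 0 <= t <= 1 & lam t = y.
  move=> h; have : `[0, 1]%classic y by rewrite /= in_itv.
  by rewrite -onto => -[t /=]; rewrite in_itv /= => ? <-; exists t.
have lam0 : lam 0 = 0.
  have [c c01 hc] := inv 0 ltac:(by rewrite lexx ler01).
  case: (eqVneq c 0) => [ce|cn0]; first by rewrite -{1}ce.
  have c0 : 0 < c by rewrite lt_neqAle eq_sym cn0; case/andP: c01.
  have := mono 0 c; rewrite !in_itv /= lexx ler01 c01 c0 hc => /(_ isT isT isT).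
  by have /andP[+ _] := lam01 0 ltac:(by rewrite lexx ler01); rewrite leNgt => /negPf ->.
have [t t01 ht] := inv x x01; exists t; split=> //; last first.
  rewrite -lee_fin -ht; apply/ltW; apply: le_lt_trans sup.
  by apply: ereal_sup_ubound; exists t => //=; rewrite in_itv.
case: (eqVneq t 0) => [t0|tn0].
  by rewrite -ht t0 lam0 subrr normr0; lra.
have t0 : 0 < t by rewrite lt_neqAle eq_sym tn0; case/andP: t01.
have x0 : 0 < x.
  rewrite -ht -{1}lam0; apply: mono => //; rewrite !in_itv /= ?lexx ?ler01//.
have lsx : `|ln (x / t)| <= eta.
  rewrite -lee_fin; apply/ltW; apply: le_lt_trans ls; apply: ereal_sup_ubound.
  exists (t, 0) => /=; last by rewrite ht lam0 !subr0.
  by split=> //; [rewrite lexx ler01|exact/eqP].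
have q0 : 0 < x / t by rewrite divr_gt0.
have /ler_normlP[l1 l2] := lsx.
have e1 : x / t <= 1 + 2 * eta.
  have : (x / t)^-1 >= 1 - eta.
    rewrite -[X in _ <= X]lnK ?posrE ?invr_gt0// lnV ?posrE//.
    apply: le_trans (expR_ge1Dx _); lra.
  have : (x / t)^-1 * (x / t) = 1 by rewrite mulVf // gt_eqF.
  nra.
have e2 : 1 - eta <= x / t.
  rewrite -[X in _ <= X]lnK ?posrE//; apply: le_trans (expR_ge1Dx _); lra.
have xE : x = (x / t) * t by rewrite divfK.
case/andP: t01 => t0' t1; move: e1 e2 xE; move: (x / t) => k k1 k2 ->.
apply/ler_normlP; split; nra.
Qed.

End time_change.

(** * Finite partitions with small oscillation *)

Section cadlag.
Context {R : realType}.
Implicit Types (f : R -> R).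

Definition cells (m : nat) (s : nat -> R) : Prop :=
  [/\ s 0%N = 0, s m = 1 & forall j, (j < m)%N -> s j < s j.+1].

(** Consider the [c] such that [[0, c)] has a partition with oscillation at most [e]. Their supremum
    is attained because of the left limit there, and if it were below 1, right continuity would
    extend the partition past it. *)
Lemma cadlag_cells f (e : R) : in_D f -> 0 < e -> exists m s, cells m s /\
  forall j x, (j < m)%N -> s j <= x < s j.+1 -> `|f x - f (s j)| <= e.
Proof.
move=> [rc ll l1] e0.
pose good c := exists m (s : nat -> R), [/\ s 0%N = 0, s m = c,
  forall j, (j < m)%N -> s j < s j.+1 &
  forall j x, (j < m)%N -> s j <= x < s j.+1 -> `|f x - f (s j)| <= e].
have extend c c' : good c -> c < c' -> (forall x, c <= x < c' -> `|f x - f c| <= e) -> good c'.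
  move=> [m [s [s0 sm inc hs]]] cc' h.
  exists m.+1, (fun j => if (j <= m)%N then s j else c'); split=> //=.
  - by rewrite ltnn.
  - move=> j; rewrite ltnS => jm; rewrite jm; case: (ltnP j m) => h'; first exact: inc.
    have e' : j = m by lia.
    by rewrite e' sm.
  - move=> j x; rewrite ltnS => jm; rewrite jm; case: (ltnP j m) => h'; first exact: hs.
    have e' : j = m by lia.
    by rewrite e' sm; exact: h.
pose S := [set c | 0 <= c <= 1 /\ good c].
have S0 : S 0.
  split; first by rewrite lexx ler01.
  by exists 0%N, (fun=> 0); split=> // j; rewrite ltn0.
have Sub : has_sup S.
  by split; [exists 0|exists 1 => c [/andP[]]].
have c01 : 0 <= sup S <= 1.
  by rewrite (ub_le_sup (proj2 Sub) S0)//= (ge_sup (proj1 Sub))// => c [/andP[]].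
have goodsup : good (sup S).
  case: (eqVneq (sup S) 0) => [->|n0]; first by case: S0.
  have c0 : 0 < sup S by rewrite lt_neqAle eq_sym n0; case/andP: c01.
  have [l hl] : exists l : R, f x @[x --> (sup S)^'-] --> l.
    case: (eqVneq (sup S) 1) => [->|n1]; first by exists (f 1).
    have : sup S < 1 by rewrite lt_neqAle n1; case/andP: c01.
    by move=> c1; exists (lim (f x @[x --> (sup S)^'-])); apply: ll; rewrite c0.
  have e2 : 0 < e / 2 by rewrite divr_gt0.
  have [d /= d0 hd] : exists2 d : R, 0 < d & forall x, sup S - d < x < sup S -> `|l - f x| < e / 2.
    move/cvgrPdist_lt: hl => /(_ _ e2)[d /= d0 hd]; exists d => // x /andP[x1 x2].
    apply: hd => //=; rewrite gtr0_norm; lra.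
  have [c [/andP[c0' c1'] gc] hc] := sup_adherent d0 Sub.
  have : c <= sup S by apply: (ub_le_sup (proj2 Sub)); split=> //; rewrite c0'.
  rewrite le_eqVlt => /orP[/eqP <-//|cs].
  apply: extend gc cs _ => x /andP[x1 x2].
  have h1 := hd x; have h2 := hd c.
  have -> : f x - f c = (l - f c) - (l - f x) by ring.
  rewrite (le_trans (ler_normB _ _))//.
  have := h1 ltac:(by apply/andP; split; lra); have := h2 ltac:(by apply/andP; split; lra); lra.
case/andP: c01 => c0; rewrite le_eqVlt => /orP[/eqP e1|c1].
  by move: goodsup; rewrite e1 => -[m [s [h1 h2 h3 h4]]]; exists m, s.
exfalso; have := rc (sup S); rewrite c0 c1 => /(_ isT)/cvgrPdist_lt/(_ _ e0)[d /= d0 hd].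
pose c' := Num.min 1 (sup S + d / 2).
have cc' : sup S < c' by rewrite /c' lt_min c1; lra.
have c'd : c' <= sup S + d / 2 by rewrite /c' ge_min lexx orbT.
have : S c'.
  split; first by rewrite (le_trans c0 (ltW cc'))/= /c' ge_min lexx.
  apply: extend goodsup cc' _ => x /andP[]; rewrite le_eqVlt => /orP[/eqP<-|h1 h2].
    by rewrite subrr normr0 ltW.
  rewrite distrC; apply/ltW/hd => //=; rewrite distrC gtr0_norm; lra.
by move/(ub_le_sup (proj2 Sub)); rewrite leNgt cc'.
Qed.

Lemma cell_of m (s : nat -> R) x : cells m s -> 0 <= x < 1 ->
  exists2 j, (j < m)%N & s j <= x < s j.+1.
Proof. by move=> [s0 sm _] h; apply: find_cell; rewrite s0 sm. Qed.

Lemma cells_gap m (s : nat -> R) : cells m s -> exists2 dl, 0 < dl &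
  forall j, (j < m)%N -> s j + dl <= s j.+1.
Proof.
move=> [_ _]; elim: m => [|m IH] h; first by exists 1.
have [|dl d0 hd] := IH; first by move=> j jm; apply: h; rewrite ltnW.
exists (Num.min dl (s m.+1 - s m)); first by rewrite lt_min d0 subr_gt0 h.
move=> j; rewrite ltnS leq_eqVlt => /orP[/eqP->|jm].
  have : Num.min dl (s m.+1 - s m) <= s m.+1 - s m by rewrite ge_min lexx orbT.
  lra.
have : Num.min dl (s m.+1 - s m) <= dl by rewrite ge_min lexx.
have := hd j jm; lra.
Qed.

End cadlag.

(** * Primitives and squared distances to constants *)

Section primitives.
Context {R : realType}.
Local Notation mu := (@lebesgue_measure R).
Implicit Types (f g : R -> R) (a b c x : R).

Local Notation I01 := (`[0%R, 1%R[%classic : set R).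

Let mI : measurable I01. Proof. by []. Qed.

Lemma sub_unit a b : 0 <= a -> b <= 1 -> `[a, b[ `<=` (I01 : set R).
Proof.
move=> a0 b1 x; rewrite /= !in_itv /= => /andP[ax xb]; apply/andP; split; lra.
Qed.

Lemma in_L2_sqr f : in_L2 f <->
  measurable_fun I01 f /\ mu.-integrable I01 (EFin \o (fun x => f x ^+ 2)).
Proof.
have e2 : (fun x => (f \_ I01) x ^+ 2) = (fun x => f x ^+ 2) \_ I01.
  apply/funext => x; rewrite !patchE; case: ifP => // _; by rewrite expr0n.
have e3 : (EFin \o (fun x => (f \_ I01) x ^+ 2)) =
    (EFin \o (fun x => f x ^+ 2)) \_ I01.
  by rewrite e2 -restrict_EFin.
have mr : measurable_fun I01 f <-> measurable_fun [set: R] (f \_ I01).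
  rewrite -(@measurable_restrict _ _ _ _ I01 setT)// setTI //.
split.
  move=> hf; split.
    apply/mr; move: hf; rewrite /in_L2 inE => /andP[]; by rewrite inE.
  have := Lfun2_integrable_sqr hf; rewrite e3.
  by move/(integrable_mkcond (mu := mu) (EFin \o (fun x => f x ^+ 2)) mI).
move=> [mf fi]; rewrite /in_L2 inE; apply/andP; split; rewrite inE/=; first exact/mr.
rewrite /finite_norm unlock /Lnorm.
have /integrableP[_] : mu.-integrable setT (EFin \o (fun x => (f \_ I01) x ^+ 2)).
  by rewrite e3; apply: (proj1 (integrable_mkcond (mu := mu) _ mI)).
set x := (\int[mu]_x _)%E; set y := (\int[mu]_x _)%E => hx.
have -> : y = x.
  by apply: eq_integral => t _; rewrite /= powR_mulrn// normrX.
by apply: poweR_lty; exact: hx.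
Qed.

Lemma in_L2_integrable f : in_L2 f -> mu.-integrable I01 (EFin \o f).
Proof.
move=> /in_L2_sqr[mf f2]; apply: (@le_integrable _ _ _ mu _ _ _
    (EFin \o (fun x => 1 + f x ^+ 2))) => //.
- exact/measurable_EFinP.
- move=> x _ /=; rewrite lee_fin.
  rewrite [leRHS]ger0_norm ?addr_ge0 ?sqr_ge0//.
  by apply/ler_normlP; split; have := sqr_ge0 (f x - 1); have := sqr_ge0 (f x + 1); nra.
have -> : (EFin \o (fun x => 1 + f x ^+ 2)) =
    ((EFin \o cst 1%R) \+ (EFin \o (fun x => (f x ^+ 2)%R)))%E by apply/funext.
apply: integrableD => //.
apply: measurable_bounded_integrable => //.
  by rewrite [X in (X < _)%E]lebesgue_measure_itv /= lte01 oppr0 adde0 ltry.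
exact: bounded_cst.
Qed.

Lemma L2norm_sqr f (r : R) : (\int[mu]_(x in I01) ((f x) ^+ 2)%:E = r%:E)%E ->
  (L2norm f ^+ 2 = r%:E)%E.
Proof.
move=> h; rewrite /L2norm unlock /Lnorm.
have -> : (\int[mu]_x (`|(EFin \o f \_ I01) x| `^ 2) = r%:E)%E.
  rewrite -h [RHS]integral_mkcond; apply: eq_integral => x _.
  rewrite /= !patchE; case: ifP => _.
    by rewrite powR_mulrn// real_normK// num_real.
  by rewrite normr0 powR_mulrn// expr0n.
have r0 : 0 <= r by rewrite -lee_fin -h; apply: integral_ge0 => x _; rewrite lee_fin sqr_ge0.
by rewrite poweR_EFin powR12_sqrt// expe2 -EFinM -expr2 sqr_sqrtr.
Qed.

(** Integrals over subintervals become differences of this primitive, so its continuity makes them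
    continuous in the end points. *)
Definition prim f x : R := \int[mu]_(y in `[0, x[) f y.

Lemma split_itv a b c : a <= b <= c -> `[a, c[%classic = `[a, b[ `|` `[b, c[ :> set R.
Proof.
move=> /andP[ab bc]; rewrite -itv_bndbnd_setU // bnd_simp //.
Qed.

Lemma disj_itv a b c : [disjoint (`[a, b[ : set R) & (`[b, c[ : set R)].
Proof.
apply/disj_setPS => x [/=]; rewrite !in_itv /= => /andP[_ h1] /andP[h2 _].
by move: (lt_le_trans h1 h2); rewrite ltxx.
Qed.

Lemma prim_diff f a b : mu.-integrable I01 (EFin \o f) -> 0 <= a <= b -> b <= 1 ->
  \int[mu]_(y in `[a, b[) f y = prim f b - prim f a.
Proof.
move=> fi /andP[a0 ab] b1; rewrite /prim.
rewrite (@split_itv 0 a b) ?a0// Rintegral_setU//; first by rewrite addrAC subrr add0r.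
  by rewrite -split_itv ?a0//; apply: integrableS fi => //; exact: sub_unit.
exact: disj_itv.
Qed.

Lemma prim0 f : prim f 0 = 0.
Proof. by rewrite /prim set_itvco0 Rintegral_set0. Qed.

Lemma prim_continuous f : mu.-integrable I01 (EFin \o f) ->
  {within `[0, 1], continuous (prim f)}.
Proof.
move=> fi.
pose h := f \_ I01.
have hi : mu.-integrable `[0, 1] (EFin \o h).
  rewrite /h -restrict_EFin; apply: integrableS (subsetT _) _ => //.
  by apply: (proj1 (integrable_mkcond (mu := mu) _ mI)).
have := @parameterized_integral_continuous R 0 1 h ler01 hi.
apply: subspace_eq_continuous => x; rewrite inE /= in_itv /= => /andP[x0 x1].
change (parameterized_integral mu 0 x h = prim f x).
rewrite /parameterized_integral -Rintegral_itv_bndo_bndc; last first.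
  by apply: integrableS hi => // y; rewrite /= !in_itv /= => /andP[-> y1]; rewrite ltW// (lt_le_trans y1).
apply: eq_Rintegral => y; rewrite inE /= in_itv /= => /andP[y0 y1].
by rewrite /h patchE mem_set//= in_itv /= y0 (lt_le_trans y1).
Qed.

Lemma in_L2_sqr_integrable f : in_L2 f -> mu.-integrable I01 (EFin \o (fun x => f x ^+ 2)).
Proof. by move/in_L2_sqr => -[]. Qed.

(** The integral of [(f - c)^2] over [[a, b)] (see [integral_sqr_sub]), written with primitives so
    that continuity in the end points and additivity over adjacent intervals are algebraic. *)
Definition quad f a b c : R :=
  (prim (fun x => f x ^+ 2) b - prim (fun x => f x ^+ 2) a)
  - 2 * c * (prim f b - prim f a) + c ^+ 2 * (b - a).

Lemma Rintegral_cst_itv a b c : a <= b -> \int[mu]_(x in `[a, b[) c = c * (b - a).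
Proof.
move=> ab; rewrite Rintegral_cst// [X in fine X]lebesgue_measure_itv /= lte_fin.
case: ltP => [_|ba] /=; first by [].
by have -> : b = a by [apply/le_anti/andP]; rewrite subrr.
Qed.

Lemma integral_sqr_sub f a b c : in_L2 f -> 0 <= a <= b -> b <= 1 ->
  (\int[mu]_(x in `[a, b[) ((f x - c) ^+ 2)%:E = (quad f a b c)%:E)%E.
Proof.
move=> hf /andP[a0 ab] b1.
have fi := in_L2_integrable hf; have f2i := in_L2_sqr_integrable hf.
have sub := sub_unit a0 b1.
have mab : measurable (`[a, b[%classic : set R) by [].
have fi' : mu.-integrable `[a, b[ (EFin \o f) by apply: integrableS fi.
have f2i' : mu.-integrable `[a, b[ (EFin \o (fun x => f x ^+ 2)) by apply: integrableS f2i.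
have ci : mu.-integrable `[a, b[ (EFin \o cst (c ^+ 2)).
  apply: measurable_bounded_integrable => //; last exact: bounded_cst.
  by rewrite [X in (X < _)%E]lebesgue_measure_itv /=; case: ifP => _; rewrite -?EFinD ltry.
have fzi : mu.-integrable `[a, b[ (EFin \o (fun x => (- 2 * c) * f x)).
  have -> : EFin \o (fun x => (- 2 * c) * f x) = (fun x => ((- 2 * c)%:E * (EFin \o f) x)%E).
    by apply/funext => x; rewrite /= EFinM.
  exact: integrableZl.
have i2 : mu.-integrable `[a, b[ (EFin \o (fun x => (- 2 * c) * f x + c ^+ 2)).
  have -> : EFin \o (fun x => (- 2 * c) * f x + c ^+ 2) =
    ((EFin \o (fun x => ((- 2 * c) * f x)%R)) \+ (EFin \o cst (c ^+ 2)%R))%E by apply/funext.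
  exact: integrableD.
have i3 : mu.-integrable `[a, b[ (EFin \o (fun x => (f x - c) ^+ 2)).
  have -> : EFin \o (fun x => (f x - c) ^+ 2) =
    ((EFin \o (fun x => (f x ^+ 2)%R)) \+ (EFin \o (fun x => (- 2 * c * f x + c ^+ 2)%R)))%E.
    apply/funext => x /=; rewrite -EFinD; congr EFin; ring.
  exact: integrableD.
rewrite -[LHS]fineK; last exact: integrable_fin_num i3.
congr EFin; rewrite -[LHS]/(Rintegral mu `[a, b[ (fun x => (f x - c) ^+ 2)).
transitivity (\int[mu]_(x in `[a, b[) (f x ^+ 2 + (- 2 * c * f x + c ^+ 2))).
  by apply: eq_Rintegral => x _; ring.
rewrite RintegralD// RintegralD// RintegralZl// Rintegral_cst_itv//.
rewrite !prim_diff ?a0// /quad; ring.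
Qed.

Lemma quad_ge0 f a b c : in_L2 f -> 0 <= a <= b -> b <= 1 -> 0 <= quad f a b c.
Proof.
move=> hf ab b1; rewrite -lee_fin -integral_sqr_sub//.
by apply: integral_ge0 => x _; rewrite lee_fin sqr_ge0.
Qed.

(** Empty cells are allowed, so that limits of partitions are still representations; [reduced_rep]
    excludes them together with equal neighbouring values. *)
Definition step_rep m (t alpha : nat -> R) g : Prop :=
  [/\ t 0%N = 0, t m = 1, forall j, (j < m)%N -> t j <= t j.+1 &
      forall j x, (j < m)%N -> t j <= x < t j.+1 -> g x = alpha j].

Lemma wk_mono m (t : nat -> R) : (forall j, (j < m)%N -> t j <= t j.+1) ->
  forall i j, (i <= j <= m)%N -> t i <= t j.
Proof.
move=> h i; elim=> [|j IH]; first by rewrite leqn0 => /andP[/eqP->].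
case/andP; rewrite leq_eqVlt => /orP[/eqP->//|ij] jm.
by apply: le_trans (h _ jm); apply: IH; rewrite -ltnS ij ltnW.
Qed.

Lemma step_measurable m t alpha g : step_rep m t alpha g -> measurable_fun I01 g.
Proof.
move=> [t0 tm inc hg]; rewrite -tm.
suff : forall k, (k <= m)%N -> measurable_fun `[0, t k[ g by apply.
elim=> [|k IH] km; first by rewrite t0 set_itvco0; exact: measurable_fun_set0.
rewrite (@split_itv 0 (t k)); last first.
  by rewrite inc// andbT -t0; apply: (wk_mono inc); lia.
apply/measurable_funU => //; split; first exact: IH (ltnW km).
apply: (eq_measurable_fun (cst (alpha k))) => // x; rewrite inE /= in_itv => hx.
by rewrite (hg k).
Qed.

Lemma integral_sqr_step f m t alpha g : in_L2 f -> step_rep m t alpha g ->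
  (\int[mu]_(x in I01) ((f x - g x) ^+ 2)%:E =
   (\sum_(j < m) quad f (t j) (t j.+1) (alpha j))%:E)%E.
Proof.
move=> hf hg; have mg := step_measurable hg; case: hg => [t0 tm inc hg].
have mono := wk_mono inc.
have mh : measurable_fun I01 (fun x => ((f x - g x) ^+ 2)%:E).
  apply/measurable_EFinP; apply: measurable_funX; apply: measurable_funB => //.
  by case/in_L2_sqr: hf.
suff H : forall k, (k <= m)%N -> (\int[mu]_(x in `[0%R, t k[) ((f x - g x) ^+ 2)%:E =
   (\sum_(j < k) quad f (t j) (t j.+1) (alpha j))%:E)%E by rewrite -{1}tm H.
elim=> [|k IH] km; first by rewrite t0 set_itvco0 integral_set0 big_ord0.
have tk0 : 0 <= t k by rewrite -t0; apply: mono; lia.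
have tk1 : t k.+1 <= 1 by rewrite -tm; apply: mono; rewrite km leqnn.
rewrite (@split_itv 0 (t k)); last by rewrite inc// tk0.
rewrite ge0_integral_setU//=.
- rewrite big_ord_recr/= EFinD; congr (_ + _)%E; first exact: IH (ltnW km).
  rewrite -integral_sqr_sub ?tk0 ?inc//; apply: eq_integral => x.
  by rewrite inE /= in_itv => hx; rewrite (hg k).
- rewrite -split_itv; last by rewrite inc// tk0.
  by apply: measurable_funS mh => //; exact: sub_unit.
- by move=> x _; rewrite lee_fin sqr_ge0.
- exact: disj_itv.
Qed.

Lemma L2norm_step f m t alpha g : in_L2 f -> step_rep m t alpha g ->
  (L2norm (f \- g)%R ^+ 2 = (\sum_(j < m) quad f (t j) (t j.+1) (alpha j))%:E)%E.
Proof. by move=> hf hg; apply: L2norm_sqr; rewrite -(integral_sqr_step hf hg). Qed.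

Lemma in_L2_zero : in_L2 (fun _ : R => 0).
Proof.
apply/in_L2_sqr; split; first exact: measurable_cst.
have -> : EFin \o (fun _ : R => (0 : R) ^+ 2) = cst 0%E.
  by apply/funext => x /=; rewrite expr0n.
exact: integrable0.
Qed.

Lemma in_L2_step m t alpha g : step_rep m t alpha g -> in_L2 g.
Proof.
move=> hg; apply/in_L2_sqr; split; first exact: step_measurable hg.
apply/integrableP; split.
  by apply/measurable_EFinP; apply: measurable_funX; exact: step_measurable hg.
have := integral_sqr_step in_L2_zero hg.
set r := \sum_(_ < _) _ => h.
rewrite (_ : (\int[mu]_(x in _) _)%E = r%:E) ?ltry// -h.
by apply: eq_integral => x _ /=; rewrite sub0r sqrrN ger0_norm// sqr_ge0.
Qed.

End primitives.

(** * Representations of step functions and the continuous Potts functional *)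

Section step_functions.
Context {R : realType}.
Local Notation mu := (@lebesgue_measure R).
Implicit Types (f g s : R -> R) (t alpha : nat -> R) (m : nat).

Definition reduced_rep m t alpha g : Prop :=
  [/\ step_rep m t alpha g, forall j, (j < m)%N -> t j < t j.+1 &
      forall j, (0 < j < m)%N -> alpha j.-1 <> alpha j].

Lemma step_rep_gt0 m t alpha g : step_rep m t alpha g -> (0 < m)%N.
Proof.
by move=> [t0 tm _ _]; case: m tm => // t1; have := @ltr01 R; rewrite -t0 -t1 ltxx.
Qed.

Lemma step_rep_drop m t alpha g l : step_rep m t alpha g -> (0 < l < m)%N ->
  [\/ t l.-1 = t l, t l = t l.+1 | alpha l.-1 = alpha l] ->
  exists t' alpha', step_rep m.-1 t' alpha' g.
Proof.
move=> [t0 tm inc hg] hl hr.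
pose t' j := if (j < l)%N then t j else t j.+1.
pose v := if t l.-1 == t l then alpha l else alpha l.-1.
pose al' j := if (j.+1 < l)%N then alpha j else if (j.+1 == l)%N then v else alpha j.+1.
exists t', al'; split.
- by rewrite /t'; case: ltnP => //; lia.
- by rewrite /t' ifF ?prednK //; lia.
- move=> j jm; rewrite /t'; case: (ltngtP j.+1 l) => h.
  + by apply: inc; lia.
  + by apply: inc; lia.
  + by rewrite (le_trans (inc j _))// ?inc //; lia.
move=> j x jm; rewrite /t' /al'; case: (ltngtP j.+1 l) => h.
- by apply: hg; lia.
- by apply: hg; lia.
have -> : j = l.-1 by lia.
rewrite prednK; last lia.
move=> /andP[x1 x2]; rewrite /v.
have h1 : t l.-1 <= x < t l -> g x = alpha l.-1.
  by move=> hx; apply: hg; [lia|rewrite prednK //; lia].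
have h2 : t l <= x < t l.+1 -> g x = alpha l by apply: hg; lia.
case: eqP => [e|ne]; first by apply: h2; rewrite -e x1.
case: (ltP x (t l)) => hx; first by apply: h1; rewrite x1.
rewrite h2 ?hx//; case: hr => // e; by move: x2; rewrite -e ltNge hx.
Qed.

Lemma step_reduce m t alpha g : step_rep m t alpha g ->
  exists m' t' alpha', (m' <= m)%N /\ reduced_rep m' t' alpha' g.
Proof.
elim/ltn_ind: m t alpha => m IH t alpha hg.
have m0 := step_rep_gt0 hg; have [t0 tm inc _] := hg.
have drop l : (0 < l < m)%N ->
    [\/ t l.-1 = t l, t l = t l.+1 | alpha l.-1 = alpha l] ->
    exists m' t' alpha', (m' <= m)%N /\ reduced_rep m' t' alpha' g.
  move=> hl /(step_rep_drop hg hl)[t' [al' hg']].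
  have [m' [t'' [al'' [mm hr]]]] := IH m.-1 ltac:(lia) _ _ hg'.
  by exists m', t'', al''; split=> //; lia.
case: (pselect (exists l, (0 < l < m)%N /\
    [\/ t l.-1 = t l, t l = t l.+1 | alpha l.-1 = alpha l])) => [[l [hl hr]]|hn].
  exact: drop hl hr.
exists m, t, alpha; split=> //; split=> // [j jm|j jm e]; last first.
  by apply: hn; exists j; split=> //; apply: Or33.
rewrite lt_neqAle inc// andbT; apply/eqP => e; apply: hn.
(* An empty cell [j] is removed through its left knot, or through its right knot when [j = 0]; a
   single empty cell would give [0 = 1]. *)
case: (posnP j) => [j0|j0]; last by exists j; split; [lia|apply: Or32].
subst j; case: (ltngtP m 1) => m1; [lia| |].
  by exists 1%N; split; [lia|apply: Or31].
by move: e; rewrite t0 -m1 tm => /esym/eqP; rewrite oner_eq0.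
Qed.

Lemma in_S_step g : in_S g -> exists m t alpha, step_rep m t alpha g.
Proof.
move=> [m [alpha [t [t0 tm inc hg]]]].
exists m, t, (fun j => if insub j is Some i then alpha i else 0).
have inc' j : (j < m)%N -> t j <= t j.+1 by move=> jm; exact/ltW/inc.
have mono := wk_mono inc'.
split=> // j x jm /andP[x1 x2]; rewrite hg; last first.
  rewrite (le_trans _ x1)/=; last by rewrite -t0; apply: mono; lia.
  by rewrite (lt_le_trans x2)// -tm; apply: mono; lia.
rewrite insubT (bigD1 (Ordinal jm))//= indicE mem_set ?mulr1; last first.
  by rewrite /= in_itv /= x1.
rewrite big1 ?addr0 // => i hi; rewrite indicE memNset ?mulr0 //= in_itv /=.
move=> /andP[y1 y2]; have : (i != j :> nat) by [].
rewrite neq_ltn => /orP[ij|ji].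
  have := mono i.+1 j; rewrite ij (ltnW jm) => /(_ isT); lra.
have := mono j.+1 i; rewrite ji (ltnW (ltn_ord i)) => /(_ isT); lra.
Qed.

Lemma reduced_in_S m t alpha g : reduced_rep m t alpha g -> in_S g.
Proof.
move=> [[t0 tm inc' hg] inc _].
have mono := wk_mono inc'.
exists m, (fun i => alpha i), t; split=> // x x01.
have [j jm hj] := @find_cell R t m x ltac:(by rewrite t0 tm).
have [x1 x2] := andP hj.
rewrite (hg j x jm hj) (bigD1 (Ordinal jm))//= indicE mem_set ?mulr1; last first.
  by rewrite /= in_itv /= x1.
rewrite big1 ?addr0 // => i hi; rewrite indicE memNset ?mulr0 //= in_itv /=.
move=> /andP[y1 y2]; have : (i != j :> nat) by [].
rewrite neq_ltn => /orP[ij|ji].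
  have := mono i.+1 j; rewrite ij (ltnW jm) => /(_ isT); lra.
have := mono j.+1 i; rewrite ji (ltnW (ltn_ord i)) => /(_ isT); lra.
Qed.

Lemma step_in_S m t alpha g : step_rep m t alpha g -> in_S g.
Proof. by move/step_reduce => [? [? [? [_ /reduced_in_S]]]]. Qed.

Lemma step_left_cvg m t alpha g j x : step_rep m t alpha g -> (j < m)%N ->
  t j < x <= t j.+1 -> g y @[y --> x^'-] --> alpha j.
Proof.
move=> [_ _ _ hg] jm /andP[x1 x2]; apply: cvg_near_cst; near=> y.
apply: (hg j) => //; apply/andP; split.
  by apply/ltW; near: y; exact: nbhs_left_gt.
by apply: (lt_le_trans _ x2); near: y; exact: nbhs_left_lt.
Unshelve. all: by end_near. Qed.

Lemma step_right_cvg m t alpha g j x : step_rep m t alpha g -> (j < m)%N ->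
  t j <= x < t j.+1 -> g y @[y --> x^'+] --> alpha j.
Proof.
move=> [_ _ _ hg] jm /andP[x1 x2]; apply: cvg_near_cst; near=> y.
apply: (hg j) => //; apply/andP; split.
  by apply: (le_trans x1); apply/ltW; near: y; exact: nbhs_right_gt.
by near: y; exact: nbhs_right_lt.
Unshelve. all: by end_near. Qed.

Lemma reduced_jumps m t alpha g : reduced_rep m t alpha g ->
  jump_set g = (fun j => t j.+1) @` `I_m.-1.
Proof.
move=> [hg inc ne]; have m0 := step_rep_gt0 hg; have [t0 tm inc' _] := hg.
have smono i j : (i < j <= m)%N -> t i < t j.
  elim: j => // j IH /andP[]; rewrite ltnS leq_eqVlt => /orP[/eqP-> jm|ij jm]; first exact: inc.
  by apply: lt_trans (inc _ jm); apply: IH; rewrite ij ltnW.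
apply/seteqP; split=> [x [/andP[x0 x1] hj]|x [j /= jm <-]].
  have [j jm hx] := @find_cell R t m x ltac:(by rewrite t0 tm (ltW x0)).
  have [a1 a2] := andP hx; case: (eqVneq (t j) x) => [e|n].
    exists j.-1 => /=; first by case: j jm hx a1 a2 e => [|j] *; [|lia]; lra.
    by case: j jm hx a1 a2 e => [|j] //=; rewrite t0 => *; lra.
  exfalso; apply: hj; rewrite (cvg_lim _ (step_right_cvg hg jm hx))//.
  apply: cvg_lim => //; apply: (step_left_cvg hg jm).
  by rewrite lt_neqAle n a1 ltW.
split.
  by rewrite -t0 -tm !smono //; lia.
have c1 := @step_left_cvg _ _ _ _ j (t j.+1) hg ltac:(lia) ltac:(by rewrite inc ?lexx//; lia).
have c2 := @step_right_cvg _ _ _ _ j.+1 (t j.+1) hg ltac:(lia) ltac:(by rewrite inc ?lexx//; lia).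
rewrite (cvg_lim _ c1)// (cvg_lim _ c2)//; apply: (ne j.+1); lia.
Qed.

Lemma reduced_counting m t alpha g : reduced_rep m t alpha g ->
  counting (jump_set g) = (m.-1)%:R%:E :> \bar R.
Proof.
move=> hr; rewrite (reduced_jumps hr).
have [hg inc _] := hr.
have smono i j : (i < j <= m)%N -> t i < t j.
  elim: j => // j IH /andP[]; rewrite ltnS leq_eqVlt => /orP[/eqP-> jm|ij jm]; first exact: inc.
  by apply: lt_trans (inc _ jm); apply: IH; rewrite ij ltnW.
have inj : {in `I_m.-1 &, injective (fun j => t j.+1)}.
  move=> i j; rewrite !inE /= => im jm e; case: (ltngtP i j) => // h.
    by have := smono i.+1 j.+1 ltac:(lia); rewrite e ltxx.
  by have := smono j.+1 i.+1 ltac:(lia); rewrite e ltxx.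
have ce := inj_card_eq inj.
rewrite /counting ifT; last by apply/asboolP; exact: finite_image.
by rewrite (card_fset_set ce).
Qed.

Lemma step_rep_unit m t alpha g s : (forall x, 0 <= x < 1 -> s x = g x) ->
  step_rep m t alpha g -> step_rep m t alpha s.
Proof.
move=> h [t0 tm inc hg]; split=> // j x jm hx; rewrite h; first exact: hg.
have mono := wk_mono inc; have /andP[x1 x2] := hx.
have := mono 0%N j ltac:(lia); have := mono j.+1 m ltac:(lia).
by rewrite t0 tm => *; apply/andP; split; lra.
Qed.

(** If they differed at [x], both would be constant on some [[x, c)] of positive length, which would
    lie in the exceptional null set. *)
Lemma eq_L2_step m t alpha g m' t' alpha' s : step_rep m t alpha g ->
  step_rep m' t' alpha' s -> eq_L2 s g -> forall x, 0 <= x < 1 -> s x = g x.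
Proof.
move=> hg hs [N [mN N0 hN]] x x01; apply: contrapT => ne.
have [t0 tm inc hg'] := hg; have [t0' tm' inc' hs'] := hs.
have [j jm hj] := @find_cell R t m x ltac:(by rewrite t0 tm).
have [i im hi] := @find_cell R t' m' x ltac:(by rewrite t0' tm').
pose c := Num.min (t j.+1) (Num.min (t' i.+1) 1).
have xc : x < c by rewrite /c !lt_min; case/andP: hj => _ ->; case/andP: hi => _ ->; case/andP: x01.
have c1 : c <= t j.+1 by rewrite /c ge_min lexx.
have c2 : c <= t' i.+1 by rewrite /c !ge_min lexx orbT.
have c3 : c <= 1 by rewrite /c !ge_min lexx !orbT.
have sub : `[x, c[%classic `<=` N.
  move=> y /=; rewrite in_itv /= => /andP[y1 y2]; apply: hN => /= /(_ _)h.
  have {h} : s y = g y.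
    apply: h; rewrite /= in_itv /=; apply/andP; split; case/andP: x01 => *; lra.
  rewrite (hg' j y jm) ?(hs' i y im); [|case/andP: hi|case/andP: hj] => *; try (apply/andP; split; lra).
  by apply: ne; rewrite (hg' j x jm hj) (hs' i x im hi).
have : (mu `[x, c[ <= mu N)%E by apply: le_measure => //; rewrite inE.
rewrite N0 [X in (X <= _)%E]lebesgue_measure_itv /= lte_fin xc -EFinB lee_fin; lra.
Qed.

(** The representative picked by [S_version] equals [g] almost everywhere, hence on all of [[0, 1)]
    by [eq_L2_step]. *)
Lemma S_version_step m t alpha g : step_rep m t alpha g -> step_rep m t alpha (S_version g).
Proof.
move=> hg; have : [set s | in_S s /\ eq_L2 s g] (S_version g).
  rewrite /S_version; case: xgetP => [y _ //|/(_ g)[]].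
  split; first exact: step_in_S hg.
  exact: ae_eq_refl.
move=> [/in_S_step[m' [t' [al' hs]]] e].
exact: step_rep_unit (eq_L2_step hg hs e) hg.
Qed.

(** Only an inequality, since a representation that is not reduced overcounts the jumps. *)
Lemma potts_limit_step (gamma : R) m t alpha f g : 0 <= gamma -> in_L2 f ->
  step_rep m t alpha g -> (potts_limit gamma g f <=
    (gamma * m.-1%:R + \sum_(j < m) quad f (t j) (t j.+1) (alpha j))%:E)%E.
Proof.
move=> g0 hf hg; rewrite /potts_limit.
have hs := S_version_step hg.
rewrite ifT; last by apply/asboolP; exact: step_in_S hs.
rewrite (L2norm_step hf hg) EFinD leeD2r//.
have [m' [t' [al' [mm hr]]]] := step_reduce hs.
rewrite (reduced_counting hr) -EFinM lee_fin ler_wpM2l// ler_nat; lia.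
Qed.

(** A finite value forces a step version, and its reduced representation counts the jumps
    exactly. *)
Lemma potts_limit_rep (gamma : R) f g : in_L2 f -> in_L2 g ->
  (potts_limit gamma g f < +oo)%E -> exists m t alpha,
  [/\ reduced_rep m t alpha (S_version g), eq_L2 (S_version g) g &
   potts_limit gamma g f =
    (gamma * m.-1%:R + \sum_(j < m) quad f (t j) (t j.+1) (alpha j))%:E].
Proof.
move=> hf hg; rewrite /potts_limit; case: ifP => // /asboolP hS _.
have [m0 [t0 [al0 /step_reduce[m [t [al [_ hr]]]]]]] := in_S_step hS.
have e : eq_L2 (S_version g) g.
  rewrite {1}/S_version; case: xgetP => [y _ []//|_].
  exact: ae_eq_refl.
exists m, t, al; split=> //.
rewrite (reduced_counting hr) -EFinM EFinD; congr (_ + _)%E.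
have [hs _ _] := hr.
apply: L2norm_sqr; rewrite -(integral_sqr_step hf hs).
have [mf _] := proj1 (in_L2_sqr f) hf; have [mg _] := proj1 (in_L2_sqr g) hg.
have ms := step_measurable hs.
apply: ae_eq_integral => //.
- by apply/measurable_EFinP; apply: measurable_funX; exact: measurable_funB.
- by apply/measurable_EFinP; apply: measurable_funX; exact: measurable_funB.
case: e => N [mN N0 sub]; exists N; split=> // x /= h; apply: sub => h'.
by apply: h => Dx; rewrite /= h'.
Qed.

End step_functions.

(** * From independent events to expectations of products *)

Section independence.
Import finmap HBNNSimple.
Context d (T : measurableType d) (R : realType) (P : probability T R).

Let transfer_simple (Z X : T -> R) (c : R) : measurable_fun setT Z -> (forall w, 0 <= Z w) ->
  measurable_fun setT X ->
  (forall A, measurable A ->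
    (\int[P]_w (Z w * \1_A (X w))%:E = c%:E * P (X @^-1` A))%E) ->
  forall h : {nnsfun measurableTypeR R >-> R},
    (\int[P]_w (Z w * h (X w))%:E = c%:E * \int[P]_w (h (X w))%:E)%E.
Proof.
move=> mZ Z0 mX hA h.
have mh (r : R) : measurable (h @^-1` [set r]) by exact: measurable_sfunP.
have mi (r : R) : measurable_fun setT (fun w => \1_(h @^-1` [set r]) (X w) : R).
  by apply: (measurableT_comp _ mX); apply: measurable_indic; exact: mh.
have nn (r : R) w : 0 <= r * \1_(h @^-1` [set r]) (X w).
  have [r0|r0] := leP 0 r; first by rewrite mulr_ge0.
  by rewrite preimage_nnfun0// indicE in_set0 mulr0.
pose r (i : nat) : R := (finmap.enum_fset (fset_set (range h)))`_i.
pose N := size (finmap.enum_fset (fset_set (range h))).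
have r0 (i : nat) : (i < N)%N -> 0 <= r i.
  move=> iN; have : r i \in fset_set (range h) by apply: mem_nth.
  by rewrite in_fset_set// => /set_mem[x _ <-].
have expand (Y : T -> R) : measurable_fun setT Y -> (forall w, 0 <= Y w) ->
  (\int[P]_w (Y w * h (X w))%:E =
    \sum_(i < N) (r i)%:E * (\int[P]_w (Y w * \1_(h @^-1` [set r i]) (X w))%:E))%E.
  move=> mY Y0; transitivity (\int[P]_w (\sum_(i < N)
     (Y w * (r i * \1_(h @^-1` [set r i]) (X w)))%:E))%E.
    by apply: eq_integral => w _; rewrite fimfunEord sumEFin mulr_sumr.
  rewrite ge0_integral_sum//=; last 2 first.
  - move=> k; apply/measurable_EFinP; apply: measurable_funM => //.
    exact: measurable_funM.
  - by move=> k w _; rewrite lee_fin mulr_ge0.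
  apply: eq_bigr => i _.
  have ri0 : 0 <= r i by exact: r0.
  rewrite -ge0_integralZl//.
  - by apply: eq_integral => w _; rewrite -EFinM; congr EFin; ring.
  - by apply/measurable_EFinP; exact: measurable_funM.
  - by move=> w _; rewrite lee_fin mulr_ge0.
rewrite expand// [in RHS](_ : (\int[P]_w (h (X w))%:E = \int[P]_w (1 * h (X w))%:E)%E); last first.
  by apply: eq_integral => w _; rewrite mul1r.
have c0 : 0 <= c.
  have := hA setT measurableT; rewrite preimage_setT probability_setT mule1 => h1.
  by rewrite -lee_fin -h1; apply: integral_ge0 => w _; rewrite lee_fin mulr_ge0.
rewrite (expand (fun=> 1))//.
rewrite ge0_sume_distrr; last first.
  move=> i _; apply: mule_ge0.
    by rewrite lee_fin r0.
  by apply: integral_ge0 => w _; rewrite mul1r lee_fin.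
apply: eq_bigr => i _; rewrite (hA _ (mh _)) muleCA; congr (_ * (_ * _))%E.
under eq_integral do rewrite mul1r.
rewrite -[LHS](_ : (\int[P]_w (\1_(X @^-1` (h @^-1` [set r i])) w)%:E = _)%E)//.
rewrite integral_indic ?setIT//.
by rewrite -(setTI (X @^-1` _)); apply: mX => //; exact: mh.
Qed.

(* If [X^-1(A)] is independent of a density [Z] for every [A], in the sense of
   the third hypothesis, the same holds for functions of [X]. *)
Lemma ge0_integral_indep (Z X : T -> R) (c : R) : measurable_fun setT Z -> (forall w, 0 <= Z w) ->
  measurable_fun setT X ->
  (forall A, measurable A ->
    (\int[P]_w (Z w * \1_A (X w))%:E = c%:E * P (X @^-1` A))%E) ->
  forall g : R -> R, measurable_fun setT g -> (forall x, 0 <= g x) ->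
    (\int[P]_w (Z w * g (X w))%:E = c%:E * \int[P]_w (g (X w))%:E)%E.
Proof.
move=> mZ Z0 mX hA g mg g0.
have mg' : measurable_fun (setT : set (measurableTypeR R)) (EFin \o g) by apply/measurable_EFinP.
pose f_ := nnsfun_approx measurableT mg'.
have cvgf x : (f_ n x)%:E @[n --> \oo] --> (g x)%:E.
  by apply: cvg_nnsfun_approx => // y _; rewrite lee_fin.
have mf n : measurable_fun (setT : set (measurableTypeR R)) (f_ n) by exact: measurable_funP.
have mfX n : measurable_fun setT (fun w => f_ n (X w)).
  by apply: (measurableT_comp _ mX); exact: mf.
have L (Y : T -> R) : measurable_fun setT Y -> (forall w, 0 <= Y w) ->
  (\int[P]_w (Y w * f_ n (X w))%:E @[n --> \oo] --> \int[P]_w (Y w * g (X w))%:E)%E.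
  move=> mY Y0.
  have -> : (\int[P]_w (Y w * g (X w))%:E = \int[P]_w limn (fun n => (Y w * f_ n (X w))%:E))%E.
    apply: eq_integral => w _; apply/esym/cvg_lim => //.
    under eq_fun do rewrite EFinM; rewrite EFinM; exact: cvgeZl.
  apply: cvg_monotone_convergence => //.
  - by move=> n; apply/measurable_EFinP; exact: measurable_funM.
  - by move=> n w _; rewrite lee_fin mulr_ge0.
  - move=> w _ m n mn; rewrite lee_fin ler_wpM2l//.
    by have /lefP := nd_nnsfun_approx measurableT mg' mn; apply.
have h1 : (c%:E * \int[P]_w (f_ n (X w))%:E @[n --> \oo] --> \int[P]_w (Z w * g (X w))%:E)%E.
  rewrite (_ : (fun n => _) = (fun n => \int[P]_w (Z w * f_ n (X w))%:E)%E); first exact: L.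
  by apply/funext => n; rewrite (transfer_simple mZ Z0 mX hA).
have h2 : (c%:E * \int[P]_w (f_ n (X w))%:E @[n --> \oo] --> c%:E * \int[P]_w (g (X w))%:E)%E.
  apply: cvgeZl => //.
  rewrite (_ : (\int[P]_w (g (X w))%:E)%E = (\int[P]_w (1 * g (X w))%:E)%E); last first.
    by apply: eq_integral => w _; rewrite mul1r.
  rewrite (_ : (fun n => _) = (fun n => \int[P]_w (1 * f_ n (X w))%:E)%E); last first.
    by apply/funext => n; apply: eq_integral => w _; rewrite mul1r.
  exact: (L (fun=> 1)).
exact: cvg_unique h1 h2.
Qed.

(** Factors are released from being indicators one at a time: the induction on [k] treats families
    in which only the first [k] factors are arbitrary. The base case is independence of events; the
    step applies [ge0_integral_indep] to factor [k], with the product of the others as density. *)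
Lemma integral_prod_indep n (X : 'I_n -> {RV P >-> R}) (g : 'I_n -> R -> R) (m : 'I_n -> R) :
  independent_family P (fun i => X i : T -> R) ->
  (forall i, measurable_fun setT (g i)) -> (forall i x, 0 <= g i x) ->
  (forall i, \int[P]_w (g i (X i w))%:E = (m i)%:E)%E ->
  (\int[P]_w (\prod_i g i (X i w))%:E = (\prod_i m i)%:E)%E.
Proof.
move=> ind.
suff H : forall k, (k <= n)%N -> forall (g : 'I_n -> R -> R) (m : 'I_n -> R),
  (forall i : 'I_n, (k <= i)%N -> exists2 A, measurable A & g i = \1_A) ->
  (forall i, measurable_fun setT (g i)) -> (forall i x, 0 <= g i x) ->
  (forall i, \int[P]_w (g i (X i w))%:E = (m i)%:E)%E ->
  (\int[P]_w (\prod_i g i (X i w))%:E = (\prod_i m i)%:E)%E.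
  by apply: (H n) => // i; rewrite leqNgt ltn_ord.
elim=> [_|k IH kn] {}g {}m hA mg g0 hm.
  have /choice[A hA'] : forall i, exists A, measurable A /\ g i = \1_A.
    by move=> i; have [A ? ?] := hA i isT; exists A.
  have mA i := (hA' i).1; have gE i := (hA' i).2.
  have mXA i : measurable (X i @^-1` A i) by rewrite -(setTI (_ @^-1` _)); exact: measurable_funP.
  have pE i : P (X i @^-1` A i) = (m i)%:E.
    by rewrite -hm gE -[X in P X]setIT -integral_indic.
  have := ind [set: 'I_n]%SET A mA.
  rewrite (eq_bigr (fun i => (m i)%:E)); last by move=> i _; exact: pE.
  rewrite (eq_bigl xpredT); last by move=> i; rewrite finset.in_setT.
  rewrite prodEFin => <-.
  rewrite -[X in P X]setIT -integral_indic//; last first.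
    apply: fin_bigcap_measurable => //.
  apply: eq_integral => w _; congr EFin.
  rewrite indicE; case: (boolP (w \in _)) => [/set_mem h|/negP h].
    rewrite big1// => i _; rewrite gE indicE mem_set//.
    by apply: h => /=; rewrite inE.
  have [i hi] : exists i, ~ A i (X i w).
    by apply: contrapT => /forallNP h'; apply: h; apply/mem_set => i _; exact: contrapT (h' i).
  by rewrite (bigD1 i)//= gE indicE memNset ?mul0r.
pose kk : 'I_n := Ordinal kn.
pose Z w := \prod_(i | i != kk) g i (X i w).
have mXi i : measurable_fun setT (X i) by exact: measurable_funP.
have mgX i : measurable_fun setT (fun w => g i (X i w)) by apply: (measurableT_comp (mg i) (mXi i)).
have mZ : measurable_fun setT Z.
  rewrite (_ : Z = fun w => \prod_(i <- [seq i <- index_enum 'I_n | i != kk]) g i (X i w)).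
    exact: measurable_prod.
  by apply/funext => w; rewrite big_filter.
have Z0 w : 0 <= Z w by apply: prodr_ge0.
have trans := @ge0_integral_indep Z (X kk) (\prod_(i | i != kk) m i) mZ Z0 (mXi kk).
transitivity (\int[P]_w (Z w * g kk (X kk w))%:E)%E.
  by apply: eq_integral => w _; rewrite (bigD1 kk)//= mulrC.
rewrite trans//; last first.
  move=> A mA.
  have mXA : measurable (X kk @^-1` A) by rewrite -(setTI (_ @^-1` _)); exact: mXi.
  have fP : P (X kk @^-1` A) \is a fin_num by exact: fin_num_measure.
  (* With an indicator in place of factor [k], the family is covered by the induction hypothesis. *)
  pose g' i := if i == kk then \1_A else g i.
  pose m' i := if i == kk then fine (P (X kk @^-1` A)) else m i.
  have pm : \prod_i m' i = \prod_(i | i != kk) m i * fine (P (X kk @^-1` A)).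
    rewrite (bigD1 kk)//= {1}/m' eqxx mulrC; congr (_ * _).
    by apply: eq_bigr => i /negPf h; rewrite /m' h.
  have := IH (ltnW kn) g' m'; rewrite pm EFinM fineK// => <-.
  - apply: eq_integral => w _; congr EFin; rewrite [RHS](bigD1 kk)//= {1}/g' eqxx [RHS]mulrC.
    congr (_ * _); apply: eq_bigr => i /negPf h; by rewrite /g' h.
  - move=> i ki; rewrite /g'; case: eqP => [_|ne]; first by exists A.
    apply: hA; rewrite ltn_neqAle ki andbT; apply/eqP => e.
    by apply: ne; apply: val_inj.
  - by move=> i; rewrite /g'; case: eqP => _ //; exact: measurable_indic.
  - by move=> i x; rewrite /g'; case: eqP => _ //.
  - move=> i; rewrite /g' /m'; case: eqP => [->|_] //.
    by rewrite fineK// -[X in P X]setIT -integral_indic.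
by rewrite hm -EFinM [in RHS](bigD1 kk)//= mulrC.
Qed.

End independence.

(** * Gaussian tails for interval sums of the noise *)

Section noise.
Context d (T : measurableType d) (R : realType) (P : probability T R).

Definition ext n (u : 'I_n -> R) (k : nat) : R := oapp u 0 (insub k).

Lemma extE n (u : 'I_n -> R) (i : 'I_n) : ext u i = u i.
Proof. by rewrite /ext insubT // => h /=; congr u; exact: val_inj. Qed.

Lemma ext_sum n (u : 'I_n -> R) a b : (b <= n)%N ->
  \sum_(a <= k < b) ext u k = \sum_(i < n | (a <= i < b)%N) u i.
Proof.
move=> bn; rewrite big_geq_mkord /=.
rewrite (big_ord_widen_cond n (fun k => (a <= k)%N) (fun k => ext u k))//.
by apply: eq_bigr => i _; rewrite extE.
Qed.

Lemma measure_bigsetU_le (I : Type) (s : seq I) (F : I -> set T) :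
  (forall i, measurable (F i)) ->
  (P (\big[setU/set0]_(i <- s) F i) <= \sum_(i <- s) P (F i))%E.
Proof.
move=> mF; elim: s => [|i s IH]; first by rewrite !big_nil measure0.
rewrite !big_cons; apply: (@le_trans _ _ (P (F i) + P (\big[setU/set0]_(j <- s) F j))%E).
  by apply: measureU2 => //; exact: bigsetU_measurable.
by rewrite leeD2l.
Qed.

(** The exponential Markov inequality. *)
Lemma prob_ge_exp (S : T -> R) (x : R) : measurable_fun setT S ->
  (P [set w | (x <= S w)%R] <=
    (expR (- x))%:E * \int[P]_w (expR (S w))%:E)%E.
Proof.
move=> mS; have mA : measurable [set w | x <= S w].
  rewrite -[X in measurable X]setTI; apply: measurable_fun_le => //.
rewrite expRN -[X in (P X <= _)%E]setIT -integral_indic// lee_pdivlMl ?expR_gt0//.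
rewrite -ge0_integralZl//; last by apply/measurable_EFinP; exact: measurable_indic.
apply: ge0_le_integral => //.
- by apply: emeasurable_funM => //; apply/measurable_EFinP; exact: measurable_indic.
- by apply/measurable_EFinP; apply: measurableT_comp.
move=> w _; rewrite -EFinM lee_fin indicE.
case: (boolP (w \in _)) => [/set_mem /= h|_]; first by rewrite mulr1 ler_expR.
by rewrite mulr0 expR_ge0.
Qed.

Context n (xi : 'I_n -> {RV P >-> R}) (beta : R).
Hypothesis ind : independent_family P (fun i => xi i : T -> R).
Hypothesis mgf : forall (nu : R) (i : 'I_n),
  ('M_P (xi i : T -> R) nu <= (expR (beta * nu ^+ 2))%:E)%E.

Definition partial_sum a b (w : T) : R := \sum_(a <= k < b) ext (fun i => xi i w) k.

Lemma measurable_partial_sum a b : (b <= n)%N -> measurable_fun setT (partial_sum a b).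
Proof.
move=> bn; rewrite (_ : partial_sum a b = fun w =>
    \sum_(i <- [seq i : 'I_n <- index_enum 'I_n | (a <= i < b)%N]) xi i w).
  by apply: measurable_sum => i; exact: measurable_funP.
by apply/funext => w; rewrite /partial_sum ext_sum// big_filter.
Qed.

(** By independence the expectation factorizes; each index of [[a, b)] contributes at most
    [expR (beta * nu^2)] and every other index contributes 1. *)
Lemma mgf_partial_sum a b (nu : R) : (a <= b <= n)%N ->
  (\int[P]_w (expR (nu * partial_sum a b w))%:E <=
     (expR (beta * nu ^+ 2 * (b - a)%:R))%:E)%E.
Proof.
move=> /andP[ab bn].
pose inI (i : 'I_n) := (a <= i < b)%N.
pose g i (x : R) : R := if inI i then expR (nu * x) else 1.
have mg i : measurable_fun setT (g i).
  rewrite /g; case: (inI i); last exact: measurable_cst.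
  by apply: measurableT_comp => //; exact: measurable_funM.
have g0 i x : 0 <= g i x by rewrite /g; case: (inI i); rewrite ?expR_ge0.
have bnd i : (\int[P]_w (g i (xi i w))%:E <=
    (if inI i then expR (beta * nu ^+ 2) else 1)%:E)%E.
  rewrite /g; case: (inI i); last first.
    by rewrite integral_cst// [X in (_ * X <= _)%E]probability_setT mul1e.
  apply: le_trans (mgf nu i); rewrite /mmt_gen_fun unlock le_eqVlt; apply/orP; left.
  by apply/eqP; apply: eq_integral => w _ /=; rewrite mulrC.
pose m i := fine (\int[P]_w (g i (xi i w))%:E)%E.
have hm i : (\int[P]_w (g i (xi i w))%:E = (m i)%:E)%E.
  rewrite fineK// ge0_fin_numE; first exact: le_lt_trans (bnd i) (ltry _).
  by apply: integral_ge0 => w _; rewrite lee_fin.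
have m0 i : 0 <= m i <= if inI i then expR (beta * nu ^+ 2) else 1.
  by rewrite -!lee_fin -hm bnd andbT; apply: integral_ge0 => w _; rewrite lee_fin.
have -> : (\int[P]_w (expR (nu * partial_sum a b w))%:E =
    \int[P]_w (\prod_i g i (xi i w))%:E)%E.
  apply: eq_integral => w _; congr EFin.
  rewrite /partial_sum ext_sum// mulr_sumr expR_sum big_mkcond /=.
  by apply: eq_bigr => i _; rewrite /g /inI.
rewrite (integral_prod_indep ind mg g0 hm) lee_fin.
apply: (@le_trans _ _ (\prod_(i < n) (if inI i then expR (beta * nu ^+ 2) else 1))).
  by apply: ler_prod => i _; exact: m0.
rewrite -big_mkcond /= -expR_sum -(@ext_sum n (fun=> beta * nu ^+ 2))//.
rewrite (eq_big_nat _ _ (F2 := fun=> beta * nu ^+ 2)); last first.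
  by move=> i hi; rewrite /ext insubT//=; lia.
by rewrite sumr_const_nat mulr_natr.
Qed.

Lemma tail_partial_sum a b (B x : R) : (a < b <= n)%N -> beta <= B -> 0 < B -> 0 <= x ->
  (P [set w | (x <= `|partial_sum a b w|)%R] <=
     (2 * expR (- (x ^+ 2 / (4 * B * (b - a)%:R))))%:E)%E.
Proof.
move=> /andP[ab bn] bB B0 x0.
have L0 : 0 < (b - a)%:R :> R by rewrite ltr0n subn_gt0.
(* This [nu] minimizes [- nu * x + B * nu^2 * (b - a)]; below, [s = 1] and [s = -1] treat the two
   tails. [B] stands for a positive upper bound of [beta], whose sign is unknown. *)
pose nu := x / (2 * B * (b - a)%:R).
have nu0 : 0 <= nu by rewrite divr_ge0// !mulr_ge0// ltW.
have mS := measurable_partial_sum a bn.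
have key (s : R) : s ^+ 2 = 1 ->
   (P [set w | (nu * x <= s * nu * partial_sum a b w)%R] <=
    (expR (- (x ^+ 2 / (4 * B * (b - a)%:R))))%:E)%E.
  move=> s2; apply: le_trans (prob_ge_exp _ _) _ => //; first exact: measurable_funM.
  have := @mgf_partial_sum a b (s * nu) ltac:(lia) => h.
  apply: le_trans (lee_wpmul2l _ h) _; first by rewrite lee_fin expR_ge0.
  rewrite -EFinM lee_fin -expRD ler_expR exprMn s2 mul1r.
  have : beta * nu ^+ 2 * (b - a)%:R <= B * nu ^+ 2 * (b - a)%:R.
    by rewrite ler_wpM2r ?(ltW L0)// ler_wpM2r// sqr_ge0.
  suff : - (nu * x) + B * nu ^+ 2 * (b - a)%:R = - (x ^+ 2 / (4 * B * (b - a)%:R)) by lra.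
  rewrite /nu; field; rewrite !gt_eqF //.
have mA s : measurable [set w | nu * x <= s * nu * partial_sum a b w].
  rewrite -[X in measurable X]setTI; apply: measurable_fun_le => //.
  exact: measurable_funM.
apply: (@le_trans _ _ (P ([set w | nu * x <= 1 * nu * partial_sum a b w] `|`
   [set w | nu * x <= -1 * nu * partial_sum a b w]))).
  apply: le_measure; rewrite ?inE.
  - rewrite -[X in measurable X]setTI; apply: measurable_fun_le => //.
    exact: measurableT_comp.
  - exact: measurableU.
  move=> w /=; rewrite ler_normr => /orP[h|h]; [left|right].
    by rewrite mul1r ler_wpM2l.
  by rewrite mulN1r mulNr -mulrN ler_wpM2l.
apply: (le_trans (measureU2 P (mA _) (mA _))).
rewrite (_ : 2 * _ = expR (- (x ^+ 2 / (4 * B * (b - a)%:R))) + expR (- (x ^+ 2 / (4 * B * (b - a)%:R)))); last by ring.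
by rewrite EFinD leeD// key// ?sqrrN ?expr1n.
Qed.

End noise.

(** * Almost sure multiscale noise bound *)

Section noise_as.
Context d (T : measurableType d) (R : realType) (P : probability T R).

(** The first Borel-Cantelli lemma. *)
Lemma ae_eventually (F : nat -> set T) : (forall n, measurable (F n)) ->
  (\sum_(n <oo) P (F n) < +oo)%E ->
  {ae P, forall w, exists N, forall n, (N <= n)%N -> ~ F n w}.
Proof.
move=> mF hF; exists (lim_sup_set F); split.
- apply: bigcap_measurable => // k _; exact: bigcup_measurable.
- exact: lim_sup_set_cvg0.
move=> w /= h N _; apply: contrapT => hn; apply: h; exists N => n Nn Fw.
by apply: hn; exists n.
Qed.

(* Almost sure eventual validity holds, up to small probability, from a
   deterministic index on. *)
Lemma eventually_uniform (E : nat -> set T) : (forall n, measurable (E n)) ->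
  {ae P, forall w, exists N, forall n, (N <= n)%N -> E n w} ->
  forall eps : R, 0 < eps -> exists N A, [/\ measurable A, (P A <= eps%:E)%E &
    forall w, ~ A w -> forall n, (N <= n)%N -> E n w].
Proof.
move=> mE [N0 [mN0 N00 hN0]] eps e0.
pose F n := ~` (E n).
have mF n : measurable (F n) by exact: measurableC.
have c := lim_sup_set_cvg P F mF.
have z : P (lim_sup_set F) = 0%E.
  apply/eqP; rewrite eq_le measure_ge0 andbT -N00; apply: le_measure; rewrite ?inE//.
    apply: bigcap_measurable => // k _; exact: bigcup_measurable.
  move=> w hw; apply: hN0 => /= -[N h].
  by have [n Nn] := hw N I; apply; exact: h.
have mU n : measurable (\bigcup_(k in [set k | (n <= k)%N]) F k) by exact: bigcup_measurable.
have {c} : (P (\bigcup_(k in [set k | (n <= k)%N]) F k) @[n --> \oo] --> 0%E).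
  rewrite -z; apply: c; apply: le_lt_trans (ltry 1).
  by apply: probability_le1; exact: mU.
move/fine_cvgP => [_ /cvgrPdist_lt/(_ _ e0)[N _ hN]].
exists N, (\bigcup_(k in [set k | (N <= k)%N]) F k); split=> //.
  have /= := hN N (leqnn N); rewrite sub0r normrN => h.
  rewrite -[X in (X <= _)%E]fineK; last exact: fin_num_measure.
  by rewrite lee_fin (le_trans _ (ltW h))// ler_norm.
by move=> w hw n Nn; apply: contrapT => nE; apply: hw; exists n.
Qed.

Context (xi : forall n : nat, 'I_n -> {RV P >-> R}).
Arguments xi : clear implicits.

Let S n := partial_sum (xi n).

(** The pair [(i, j)] with [i <= j] encodes the nonempty interval [[i, j.+1)]. *)
Definition big_noise (C : R) n : set T :=
  \big[setU/set0]_(p <- [seq p : 'I_n * 'I_n <- enum {: 'I_n * 'I_n} | (p.1 <= p.2)%N])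
    [set w | Num.sqrt (C * ln n%:R * (p.2.+1 - p.1)%:R) <= `|S n p.1 p.2.+1 w|].

Lemma measurable_big_noise C n : measurable (big_noise C n).
Proof.
apply: bigsetU_measurable => -[i j] _ /=.
rewrite -[X in measurable X]setTI; apply: measurable_fun_le => //.
by apply: measurableT_comp => //; exact: measurable_partial_sum.
Qed.

Lemma big_noiseN C n w : 0 <= C -> ~ big_noise C n w ->
  noise_bound (C * ln n%:R) n (ext (fun i => xi n i w)).
Proof.
move=> C0 h a b /andP[ab bn].
have n0 : (0 < n)%N by lia.
have A0 : 0 <= C * ln n%:R by rewrite mulr_ge0// ln_ge0// ler1n.
have bn' : (b.-1 < n)%N by lia.
rewrite leNgt; apply/negP => hs; apply: h.
rewrite /big_noise -bigcup_seq; exists (Ordinal (leq_trans ab bn), Ordinal bn') => /=.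
  by rewrite /= mem_filter mem_enum andbT /=; lia.
rewrite prednK; last lia.
rewrite -[leRHS]ger0_norm// -(@ler_pXn2r _ 2%N) ?nnegrE ?sqrtr_ge0//.
rewrite sqr_sqrtr; last by rewrite mulr_ge0.
by rewrite normr_id real_normK ?num_real// ltW.
Qed.

(** With the factor 16 the tail exponent is [4 * ln n]: each of at most [n^2] intervals has
    probability at most [2 * n^-4], which leaves a summable [2 * n^-2]. *)
Lemma prob_big_noise (beta C : R) n : independent_family P (fun i => xi n i : T -> R) ->
  (forall (nu : R) (i : 'I_n), ('M_P (xi n i : T -> R) nu <= (expR (beta * nu ^+ 2))%:E)%E) ->
  0 < C -> beta <= C -> (1 < n)%N ->
  (P (big_noise (16 * C) n) <= (2 * (n%:R ^- 2))%:E)%E.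
Proof.
move=> ind mgf C0 bC n1.
have ln0 : 0 <= ln n%:R :> R by rewrite ln_ge0// ler1n ltnW.
have n0 : 0 < n%:R :> R by rewrite ltr0n ltnW.
apply: (le_trans (measure_bigsetU_le _ _ _)).
  move=> [i j]; rewrite -[X in measurable X]setTI; apply: measurable_fun_le => //.
  by apply: measurableT_comp => //; exact: measurable_partial_sum.
apply: (@le_trans _ _ (\sum_(p <- [seq p : 'I_n * 'I_n <- enum {: 'I_n * 'I_n} | (p.1 <= p.2)%N]) (2 * n%:R ^- 4)%:E)%E).
  rewrite !big_seq; apply: lee_sum => -[i j]; rewrite mem_filter /= => /andP[ij _].
  have L0 : 0 < (j.+1 - i)%:R :> R by rewrite ltr0n; lia.
  have ijn : (i < j.+1 <= n)%N by rewrite ltnS ij ltn_ord.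
  apply: le_trans (tail_partial_sum ind mgf ijn bC C0 (sqrtr_ge0 _)) _.
  rewrite lee_fin ler_wpM2l// sqr_sqrtr; last by rewrite !mulr_ge0// ltW.
  have -> : 16 * C * ln n%:R * (j.+1 - i)%:R / (4 * C * (j.+1 - i)%:R) = 4%:R * ln n%:R :> R.
    by field; rewrite !gt_eqF.
  by rewrite expRN expRM_natl lnK.
rewrite sumEFin lee_fin big_const_seq count_predT iter_addr_0.
apply: (@le_trans _ _ ((2 * n%:R ^- 4) *+ (n * n))).
  rewrite ler_wpMn2l// ?mulr_ge0 ?invr_ge0 ?exprn_ge0 ?(ltW n0)//.
  by rewrite size_filter (leq_trans (count_size _ _))// -cardE card_prod card_ord.
rewrite -mulr_natr natrM le_eqVlt; apply/orP; left; apply/eqP.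
by field; rewrite gt_eqF.
Qed.

Lemma noise_as : conditionA P (fun n i => xi n i : T -> R) ->
  exists (beta C : R) (F : nat -> set T), [/\ 0 < C /\ 0 < beta,
    forall n, measurable (F n),
    {ae P, forall w, exists N, forall n, (N <= n)%N -> ~ F n w},
    forall n w, ~ F n w -> noise_bound (C * ln n%:R) n (ext (fun i => xi n i w)) &
    forall n a b x, (a < b <= n)%N -> 0 <= x ->
      (P [set w | (x <= `|S n a b w|)%R] <=
      (2 * expR (- (x ^+ 2 / (4 * beta * (b - a)%:R))))%:E)%E].
Proof.
move=> [_ ind [beta mgf]]; pose C := Num.max 1 beta.
have C0 : 0 < C by rewrite lt_max ltr01.
have bC : beta <= C by rewrite le_max lexx orbT.
exists C, (16 * C), (big_noise (16 * C)); split.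
- by rewrite mulr_gt0.
- exact: measurable_big_noise.
- apply: ae_eventually; first exact: measurable_big_noise.
  apply: (@le_lt_trans _ _ 10%:E); last exact: ltry.
  apply: lime_le; first exact: is_cvg_nneseries.
  (* For [k > 1], [2 / k^2 <= 5 * (1 / k - 1 / (k + 1))], which telescopes. As [0^-1 = 0], the
     bracket is -1 at [k = 0], and the correction 2 there lifts the bound above the probability. *)
  apply: nearW => n; apply: (@le_trans _ _ (\sum_(0 <= k < n) (5 * (k%:R^-1 - k.+1%:R^-1 + (k == 0%N)%:R * 2))%:E)%E).
    apply: lee_sum => k _; case: (ltnP 1 k) => k1.
      apply: le_trans (prob_big_noise (ind k) (fun nu => mgf nu k) C0 bC k1) _.
      rewrite lee_fin; have -> : (k == 0%N) = false by lia.
      rewrite mul0r addr0.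
      have k0 : 0 < k%:R :> R by rewrite ltr0n ltnW.
      have k2 : 1 <= k%:R :> R by rewrite ler1n ltnW.
      have -> : 2 * k%:R ^- 2 = (2 * (k%:R + 1)) / (k%:R ^+ 2 * (k%:R + 1)) :> R.
        by field; rewrite !gt_eqF ?addr_gt0.
      have -> : 5 * (k%:R^-1 - k.+1%:R^-1) = 5 * k%:R / (k%:R ^+ 2 * (k%:R + 1)) :> R.
        by rewrite -natr1; field; rewrite !gt_eqF ?addr_gt0.
      rewrite ler_pM2r ?invr_gt0 ?mulr_gt0 ?exprn_gt0 ?addr_gt0//; lra.
    apply: (@le_trans _ _ 1%E).
      by apply: probability_le1; exact: measurable_big_noise.
    case: k k1 => [|[|k]]// _; rewrite lee_fin ?invr0 ?invr1 /=; lra.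
  rewrite sumEFin lee_fin -mulr_sumr big_split /= -mulr_suml.
  have -> : \sum_(0 <= k < n) (k%:R^-1 - k.+1%:R^-1) = - n%:R^-1 :> R.
    by rewrite -[LHS]opprK -sumrN; under eq_bigr do rewrite opprB; rewrite telescope_sumr// invr0 subr0.
  have : \sum_(0 <= k < n) (k == 0%N)%:R <= 1 :> R.
    case: n => [|n]; first by rewrite big_geq.
    by rewrite big_nat_recl// big1 ?addr0.
  have : 0 <= n%:R^-1 :> R by rewrite invr_ge0.
  lra.
- move=> n w; apply: big_noiseN; exact: mulr_ge0 (ltW C0).
- move=> n a b x abn x0.
  exact: (tail_partial_sum (ind n) (fun nu => mgf nu n) abn bC C0 x0).
Qed.

Lemma prob_tight (X : T -> R) : measurable_fun setT X -> forall eps : R, 0 < eps ->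
  exists (M : R) (A : set T), [/\ measurable A, (P A <= eps%:E)%E & forall w, ~ A w -> `|X w| <= M].
Proof.
move=> mX eps e0.
have [||N [A [mA PA hA]]] := @eventually_uniform (fun n => [set w | `|X w| <= n%:R]) _ _ eps e0.
- move=> n; rewrite -[X in measurable X]setTI; apply: measurable_fun_le => //.
  exact: measurableT_comp.
- apply: aeW => w /=; exists (Num.truncn `|X w|).+1 => n hn.
  apply: (le_trans (ltW (truncnS_gt _))); by rewrite ler_nat.
by exists N%:R, A; split=> // w /hA/(_ N (leqnn N)).
Qed.

End noise_as.

(** * From row vectors and step embeddings to sequences on the grid *)

Section grid_approximation.
Context {R : realType}.
Local Notation mu := (@lebesgue_measure R).
Local Notation I01 := (`[0%R, 1%R[%classic : set R).
Implicit Types (f F G : R -> R) (U V Y : nat -> R) (n m : nat).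

Lemma jump_countE n (u : 'rV[R]_n) U : (forall i : 'I_n, u 0 i = U i) ->
  jump_count u = jumps n U.
Proof.
move=> uU; rewrite /jump_count -sum1_card big_mkcond /=.
transitivity (\sum_(i < n) ((i.+1 < n)%N && (U i != U i.+1)) : nat)%N.
  apply: eq_bigr => i _.
  rewrite (_ : (i \in _) = [exists j : 'I_n, (j == i.+1 :> nat) && (u 0 i != u 0 j)]); last exact: asboolb.
  case: (boolP (i.+1 < n)%N) => h /=.
    case: (boolP (U i != U i.+1)) => hU.
      rewrite ifT//; apply/existsP; exists (Ordinal h).
      by rewrite eqxx /= !uU.
    rewrite ifF//; apply/negbTE/negP => /existsP[j /andP[/eqP ji]].
    by rewrite !uU ji (negbTE hU).
  rewrite ifF//; apply/negbTE/negP => /existsP[j /andP[/eqP ji _]].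
  by move: h; rewrite -ji ltn_ord.
rewrite -(big_mkord xpredT (fun i => ((i.+1 < n)%N && (U i != U i.+1)) : nat)).
case: n u uU => [|n] u uU; first by rewrite /jumps !big_geq.
rewrite big_nat_recr //= ltnn addn0 /jumps big_add1 /=.
by apply: eq_big_nat => i hi; rewrite ltnS (_ : (i < n)%N).
Qed.

Lemma minimizer_nat n (gamma : R) (u Y : 'rV[R]_n) : (0 < n)%N ->
  potts_minimizers gamma Y u ->
  nat_minimizer n (gamma * n%:R) (ext (fun i => Y 0 i)) (ext (fun i => u 0 i)).
Proof.
move=> n0 hu V; have n0' : 0 < n%:R :> R by rewrite ltr0n.
have pottsE (v : 'rV[R]_n) (W : nat -> R) : (forall i : 'I_n, v 0 i = W i) ->
    n%:R * potts gamma v Y = cost n (ext (fun i => Y 0 i)) W + gamma * n%:R * (jumps n W)%:R.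
  move=> vW; rewrite /potts (jump_countE vW) mulrDr mulVKf ?gt_eqF//.
  rewrite /cost big_mkord; congr (_ + _); last by ring.
  by apply: eq_bigr => i _; rewrite extE vW.
rewrite -(pottsE u); last by move=> i; rewrite extE.
rewrite -(pottsE (\row_i V i)); last by move=> i; rewrite mxE.
by rewrite ler_pM2l//; exact: hu.
Qed.

Definition fbar f n (i : nat) : R :=
  n%:R * (prim f (i.+1%:R / n%:R) - prim f (i%:R / n%:R)).

Lemma local_meanE f n (i : 'I_n) : mu.-integrable I01 (EFin \o f) ->
  local_mean f i = fbar f n i.
Proof.
move=> fi; have n0 : 0 < n%:R :> R by rewrite ltr0n (leq_ltn_trans _ (ltn_ord i)).
rewrite /local_mean /fbar prim_diff//.
- congr (_ * _); rewrite /design -mulrBl -natr1 addrAC subrr add0r invf_div divr1 //.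
- by rewrite /design divr_ge0//= ler_pM2r ?invr_gt0// ler_nat.
- by rewrite /design ler_pdivrMr// mul1r ler_nat.
Qed.

Definition grid_fun n F U : Prop :=
  forall i x, (i < n)%N -> i%:R <= n%:R * x < i.+1%:R -> F x = U i.

Lemma iota_stepE n (u : 'rV[R]_n) : grid_fun n (iota_step u) (ext (fun i => u 0 i)).
Proof.
move=> i x i_n /andP[x1 x2]; have n0 : 0 < n%:R :> R by rewrite ltr0n; lia.
rewrite /iota_step (bigD1 (Ordinal i_n))//= big1 ?addr0.
  rewrite indicE mem_set ?mulr1; first by rewrite -(extE (fun i => u 0 i) (Ordinal i_n)).
  by rewrite /= in_itv /= /design ler_pdivrMr// ltr_pdivlMr// mulrC x1.
move=> j ji; rewrite indicE memNset ?mulr0//= in_itv /= /design.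
rewrite ler_pdivrMr// ltr_pdivlMr// mulrC => /andP[y1 y2].
have l1 := le_lt_trans y1 x2; have l2 := le_lt_trans x1 y2.
move: l1 l2; rewrite !ltr_nat => l1 l2.
by move: ji; rewrite -val_eqE /=; lia.
Qed.

Lemma grid_index n (x : R) : (0 < n)%N -> 0 <= x < 1 ->
  exists2 i, (i < n)%N & i%:R <= n%:R * x < i.+1%:R.
Proof.
move=> n0 /andP[x0 x1]; have n0' : 0 < n%:R :> R by rewrite ltr0n.
have nx0 : 0 <= n%:R * x by rewrite mulr_ge0// ltW.
exists (Num.truncn (n%:R * x)); last exact: truncn_itv.
have /andP[h1 _] := truncn_itv nx0.
by rewrite -(ltr_nat R) (le_lt_trans h1)// gtr_pMr.
Qed.

Lemma S_to_D_grid n F U : (0 < n)%N -> grid_fun n F U -> S_to_D F 1 = U n.-1.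
Proof.
move=> n0 hF; have n0' : 0 < n%:R :> R by rewrite ltr0n.
have hlt : n.-1%:R / n%:R < 1 :> R by rewrite ltr_pdivrMr// mul1r ltr_nat; lia.
have h1 : \forall x \near (1:R)^'-, x < 1 by exact: nbhs_left_lt.
have h2 : \forall x \near (1:R)^'-, n.-1%:R / n%:R < x by exact: nbhs_left_gt.
rewrite /S_to_D eqxx; apply: lim_near_cst => //.
apply: filterS2 h1 h2 => x x1 x2; apply: hF; first lia.
rewrite prednK//; apply/andP; split; last by rewrite gtr_pMr.
by rewrite mulrC -ler_pdivrMr// ltW.
Qed.

Definition ceiln (x : R) : nat := `|Num.ceil x|%N.

Lemma ceiln_le (x : R) i : 0 <= x -> (ceiln x <= i)%N = (x <= i%:R).
Proof.
move=> x0; have c0 : 0 <= Num.ceil x by rewrite ceil_ge0// (lt_le_trans _ x0)// ltrN10.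
by rewrite -lez_nat /ceiln gez0_abs// ceil_le_int.
Qed.

Lemma ceiln_itv (x : R) : 0 <= x -> x <= (ceiln x)%:R < x + 1.
Proof.
move=> x0; rewrite -ceiln_le// leqnn /=.
case: (posnP (ceiln x)) => [->|c0]; first by lra.
have : ~~ (ceiln x <= (ceiln x).-1)%N by rewrite -ltnNge ltn_predL.
rewrite ceiln_le// -ltNge -{2}(prednK c0) -natr1; lra.
Qed.

Lemma ceiln_nat k : ceiln k%:R = k.
Proof. by apply/eqP; rewrite eqn_leq ceiln_le// lexx /= -(ler_nat R); have /andP[] := ceiln_itv (ler0n R k). Qed.

(** [skorokhod_le] in index units, with knots [sg j / n]. At time 1 both functions are limits from
    the left, so the comparison there follows from that on the last cell. *)
Lemma skorokhod_grid n F U G m (s : nat -> R) (sg : nat -> nat) (dl r e : R) :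
  (0 < n)%N -> grid_fun n F U -> cells m s -> 0 < dl ->
  (forall j, (j < m)%N -> s j + dl <= s j.+1) ->
  0 <= r -> 2 * m.+1%:R * r <= n%:R * dl ->
  sg 0%N = 0%N -> sg m = n ->
  (forall j, (j <= m)%N -> `|(sg j)%:R - n%:R * s j| <= r) ->
  (forall j i t, (j < m)%N -> (sg j <= i < sg j.+1)%N -> s j <= t < s j.+1 ->
    `|U i - G t| <= e) ->
  G x @[x --> 1^'-] --> G 1 ->
  (skorokhod (S_to_D F) G <= (Num.max (2 * (m.+1%:R * r / (n%:R * dl))) e)%:E)%E.
Proof.
move=> n0 hF hs d0 gap r0 hr sg0 sgm near hUG G1.
have n0' : 0 < n%:R :> R by rewrite ltr0n.
have [s0 sm inc] := hs.
have m0 : (0 < m)%N by case: (m) sm => // h; move: h; rewrite s0 => /esym/eqP; rewrite oner_eq0.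
have -> : m.+1%:R * r / (n%:R * dl) = m.+1%:R * (r / n%:R) / dl by field; rewrite !gt_eqF.
apply: (@skorokhod_le _ _ _ m s (fun j => (sg j)%:R / n%:R) dl (r / n%:R) e) => //.
- by rewrite divr_ge0// ltW.
- by rewrite mulrA ler_pdivrMr// (mulrC dl).
- by rewrite sg0 mul0r.
- by rewrite sgm mulfV// gt_eqF.
- move=> j jm; have -> : (sg j)%:R / n%:R - s j = ((sg j)%:R - n%:R * s j) / n%:R by field; rewrite gt_eqF.
  by rewrite normrM normfV (gtr0_norm n0') ler_pM2r ?invr_gt0// near.
- move=> j t y jm ht; rewrite ler_pdivrMr// ltr_pdivlMr// => /andP[y1 y2].
  have y0 : 0 <= y.
    by rewrite -(pmulr_lge0 y n0') (le_trans _ y1).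
  have [i hi] : exists i : nat, i%:R <= n%:R * y < i.+1%:R.
    by exists (Num.truncn (n%:R * y)); apply: truncn_itv; rewrite mulr_ge0// ltW.
  have [i1 i2] := andP hi.
  have ij : (sg j <= i < sg j.+1)%N.
    have l1 : (sg j < i.+1)%N by rewrite -(ltr_nat R); lra.
    have l2 : (i < sg j.+1)%N by rewrite -(ltr_nat R); lra.
    by rewrite -ltnS l1.
  have sgn : (sg j.+1 <= n)%N.
    move: (jm); rewrite leq_eqVlt => /orP[/eqP->|j1m]; first by rewrite sgm.
    have := near j.+1 jm; rewrite ler_norml => /andP[_].
    have := knots_gap (ltW d0) gap (i := j.+1) (j := m); rewrite j1m leqnn sm => /(_ isT) h1 h2.
    rewrite -(ler_nat R); have : n%:R * s j.+1 <= n%:R * (1 - dl) by rewrite ler_pM2l//; lra.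
    have : r <= 2 * m.+1%:R * r.
      by rewrite ler_peMl// -natrM ler1n.
    lra.
  have i_n : (i < n)%N by case/andP: ij => _ /leq_trans; apply.
  have y1' : y < 1.
    by rewrite -(ltr_pM2l n0') mulr1 (lt_le_trans i2)// ler_nat.
  rewrite /S_to_D lt_eqF// (hF i)//.
  exact: (hUG j).
rewrite (S_to_D_grid n0 hF).
have last t : s m.-1 <= t < 1 -> `|U n.-1 - G t| <= e.
  move=> ht; apply: (hUG m.-1); [lia| |by rewrite prednK// sm].
  rewrite (prednK m0) sgm; apply/andP; split; last lia.
  have := near m.-1 (leq_pred m); rewrite ler_norml => /andP[_].
  have := gap m.-1; rewrite prednK// leqnn sm => /(_ isT) h1 h2.
  have : n%:R * s m.-1 <= n%:R * (1 - dl) by rewrite ler_pM2l//; lra.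
  have nd0 : 0 < n%:R * dl by rewrite mulr_gt0.
  have : 2 * r <= 2 * m.+1%:R * r by rewrite -mulrA ler_pM2l// ler_peMl// ler1n.
  move=> h3 h4; suff : (sg m.-1 < n)%N by rewrite -{1}(prednK n0) ltnS.
  rewrite -(ltr_nat R); lra.
have c2 : `|U n.-1 - G x| @[x --> 1^'-] --> `|U n.-1 - G 1|.
  by apply: cvg_norm; apply: cvgB => //; exact: cvg_cst.
apply: (cvgr_to_le c2).
near=> x; apply: last; apply/andP; split; last by near: x; exact: nbhs_left_lt.
apply/ltW; near: x; apply: nbhs_left_gt.
by have := inc m.-1; rewrite prednK// sm; apply.
Unshelve. all: by end_near. Qed.

End grid_approximation.

(** * Data means over the cells of a partition *)

Section cell_means.
Context {R : realType}.
Local Notation mu := (@lebesgue_measure R).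
Local Notation I01 := (`[0%R, 1%R[%classic : set R).
Implicit Types (f F G : R -> R) (U V Y h : nat -> R) (n m : nat).

Lemma cost_ext n Y Y' U : (forall i, (i < n)%N -> Y i = Y' i) -> cost n Y U = cost n Y' U.
Proof. by move=> h; apply: eq_big_nat => i hi; rewrite h. Qed.

Lemma fhat_grid d (T : measurableType d) (P : probability T R)
  (xi : forall n : nat, 'I_n -> {RV P >-> R}) f n (w : T) (gamma : R) F :
  (0 < n)%N -> in_L2 f ->
  (@iota_step R n @` potts_minimizers gamma
    (observations f (fun n i => xi n i : T -> R) n w)) F ->
  exists U, nat_minimizer n (gamma * n%:R)
      (fun i => fbar f n i + ext (fun i => xi n i w) i) U /\ grid_fun n F U.
Proof.
move=> n0 hf [u hu <-]; exists (ext (fun i => u 0 i)); split; last exact: iota_stepE.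
have hm := minimizer_nat n0 hu => V; have := hm V.
have e i : (i < n)%N -> ext (fun i => observations f (fun n i => xi n i : T -> R) n w 0 i) i
   = fbar f n i + ext (fun i => xi n i w) i.
  move=> i_n; rewrite -[i in LHS]/(nat_of_ord (Ordinal i_n)) extE mxE.
  rewrite local_meanE; last exact: in_L2_integrable.
  by congr (_ + _); rewrite -(extE (fun i => xi n i w) (Ordinal i_n)).
by rewrite !(cost_ext _ e).
Qed.

Lemma prim_mean f (a b c e : R) : mu.-integrable I01 (EFin \o f) -> 0 <= a <= b -> b <= 1 ->
  (forall x, a <= x < b -> `|f x - c| <= e) ->
  `|prim f b - prim f a - c * (b - a)| <= e * (b - a).
Proof.
move=> fi /andP[a0 ab] b1 h; rewrite -prim_diff ?a0//.
have fi' : mu.-integrable `[a, b[ (EFin \o f).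
  by apply: integrableS fi => //; exact: sub_unit.
have ci (k : R) : mu.-integrable `[a, b[ (EFin \o (fun=> k)).
  apply: measurable_bounded_integrable => //; last exact: bounded_cst.
  by rewrite [X in (X < _)%E]lebesgue_measure_itv /=; case: ifP => _; rewrite -?EFinD ltry.
have h1 : \int[mu]_(y in `[a, b[) f y <= (c + e) * (b - a).
  rewrite -Rintegral_cst_itv//; apply: le_Rintegral => // y; rewrite /= in_itv => /h/ler_normlP[]; lra.
have h2 : (c - e) * (b - a) <= \int[mu]_(y in `[a, b[) f y.
  rewrite -Rintegral_cst_itv//; apply: le_Rintegral => // y; rewrite /= in_itv => /h/ler_normlP[]; lra.
apply/ler_normlP; split; lra.
Qed.

Lemma fbar_close f n i (c e : R) : (i < n)%N -> mu.-integrable I01 (EFin \o f) ->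
  (forall x, i%:R <= n%:R * x < i.+1%:R -> `|f x - c| <= e) -> `|fbar f n i - c| <= e.
Proof.
move=> i_n fi h; have n0 : 0 < n%:R :> R by rewrite ltr0n; lia.
have ab : i.+1%:R / n%:R - i%:R / n%:R = n%:R^-1 :> R.
  by rewrite -mulrBl -natr1 addrAC subrr add0r div1r.
have c1 : 0 <= (i%:R / n%:R : R) <= i.+1%:R / n%:R.
  apply/andP; split; first by rewrite divr_ge0.
  by rewrite ler_pM2r ?invr_gt0// ler_nat.
have c2 : i.+1%:R / n%:R <= 1 :> R by rewrite ler_pdivrMr// mul1r ler_nat.
have := @prim_mean f (i%:R / n%:R) (i.+1%:R / n%:R) c e fi c1 c2; rewrite ab => H.
have {H} : `|prim f (i.+1%:R / n%:R) - prim f (i%:R / n%:R) - c * n%:R^-1| <= e * n%:R^-1.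
  by apply: H => y; rewrite ler_pdivrMr// ltr_pdivlMr// mulrC => /h.
rewrite -(ler_pM2l n0) -{1}(gtr0_norm n0) -normrM.
rewrite /fbar (_ : n%:R * (e / n%:R) = e); last by field; rewrite gt_eqF.
by rewrite mulrBr (_ : n%:R * (c / n%:R) = c); last by field; rewrite gt_eqF.
Qed.

(** Rounding up makes [i] lie between two grid breaks exactly when [i / n] lies in the half-open
    cell. *)
Definition grid n (s : nat -> R) (j : nat) : nat := ceiln (n%:R * s j).

Section grid.
Context n m (s : nat -> R).
Hypotheses (n0 : (0 < n)%N) (hs : cells m s).

Let n0' : 0 < n%:R :> R. Proof. by rewrite ltr0n. Qed.

Lemma cells_ge0 j : (j <= m)%N -> 0 <= s j <= 1.
Proof.
move=> jm; have [s0 sm inc] := hs.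
have h := @wk_mono _ m s (fun j jm => ltW (inc j jm)).
by rewrite -s0 -sm !h // leqnn ?andbT.
Qed.

Let ns0 j : (j <= m)%N -> 0 <= n%:R * s j.
Proof. by move=> jm; rewrite mulr_ge0 ?(ltW n0')//; case/andP: (cells_ge0 jm). Qed.

Lemma grid0 : grid n s 0 = 0%N.
Proof. by case: hs => s0 _ _; rewrite /grid s0 mulr0; exact: (ceiln_nat 0). Qed.

Lemma gridn : grid n s m = n.
Proof. by case: hs => _ sm _; rewrite /grid sm mulr1 ceiln_nat. Qed.

Lemma grid_itv j : (j <= m)%N -> n%:R * s j <= (grid n s j)%:R < n%:R * s j + 1.
Proof. by move=> jm; exact/ceiln_itv/ns0. Qed.

Lemma grid_mem j i : (j < m)%N -> (grid n s j <= i < grid n s j.+1)%N ->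
  n%:R * s j <= i%:R < n%:R * s j.+1.
Proof.
move=> jm; rewrite [(i < _)%N]ltnNge /grid (ceiln_le _ (ns0 (ltnW jm))) (ceiln_le _ (ns0 jm)).
by rewrite -ltNge.
Qed.

Lemma grid_len j (L : nat) (dl : R) : (j < m)%N -> s j + dl <= s j.+1 ->
  L%:R + 1 <= n%:R * dl -> (grid n s j + L <= grid n s j.+1 <= n)%N.
Proof.
move=> jm gap hL; have /andP[_ h1] := grid_itv (ltnW jm); have /andP[h2 _] := grid_itv jm.
have : n%:R * (s j + dl) <= n%:R * s j.+1 by rewrite ler_pM2l.
rewrite mulrDr => h3; apply/andP; split.
  suff : (grid n s j + L < (grid n s j.+1).+1)%N by rewrite ltnS.
  by rewrite -(ltr_nat R) natrD -natr1; lra.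
rewrite /grid ceiln_le ?ns0// ger_pMr//; by case/andP: (cells_ge0 jm).
Qed.

(** Only the last index of a cell can have an averaging interval crossing the next knot; there the
    error is bounded by [2 * M]. *)
Lemma fbar_cell f h (e M : R) j i : mu.-integrable I01 (EFin \o f) -> 0 <= e -> 0 <= M ->
  (forall j y, (j < m)%N -> s j <= y < s j.+1 -> `|f y - h j| <= e) ->
  (forall y, 0 <= y < 1 -> `|f y| <= M) -> (forall j, (j < m)%N -> `|h j| <= M) ->
  (j < m)%N -> (grid n s j <= i < grid n s j.+1)%N ->
  `|fbar f n i - h j| <= e + 2 * M * (i.+1 == grid n s j.+1)%:R.
Proof.
move=> fi e0 M0 hfh hM hhM jm hi; have /andP[i1 i2] := grid_mem jm hi.
have gn : (grid n s j.+1 <= n)%N.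
  by rewrite /grid ceiln_le ?ns0// ger_pMr//; case/andP: (cells_ge0 jm).
have i_n : (i < n)%N by case/andP: hi => _ /leq_trans; apply.
apply: fbar_close => // y /andP[y1 y2].
have sy : s j <= y by rewrite -(ler_pM2l n0'); lra.
case: (eqVneq i.+1 (grid n s j.+1)) => [_|ne].
  apply: (le_trans (ler_normB _ _)).
  have : `|f y| <= M.
    apply: hM; rewrite (le_trans _ sy)/=; last by case/andP: (cells_ge0 (ltnW jm)).
    rewrite -(ltr_pM2l n0') mulr1 (lt_le_trans y2)// ler_nat //.
  by have := hhM j jm; rewrite mulr1; lra.
rewrite mulr0 addr0; apply: (hfh j) => //; rewrite sy /= -(ltr_pM2l n0').
apply: (lt_le_trans y2); case/andP: hi => hi1 hi2.
have /(grid_mem jm)/andP[_ /ltW //] : (grid n s j <= i.+1 < grid n s j.+1)%N.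
by rewrite (leq_trans hi1) //= ltn_neqAle ne.
Qed.

Lemma fbar_bound f (M : R) i : mu.-integrable I01 (EFin \o f) ->
  (forall y, 0 <= y < 1 -> `|f y| <= M) -> (i < n)%N -> `|fbar f n i| <= M.
Proof.
move=> fi hM i_n; rewrite -[fbar f n i]subr0; apply: fbar_close => // y /andP[y1 y2].
rewrite subr0; apply: hM; apply/andP; split.
  by rewrite -(pmulr_rge0 y n0') (le_trans _ y1).
by rewrite -(ltr_pM2l n0') mulr1 (lt_le_trans y2)// ler_nat.
Qed.

(** The bound [(k <= q)], sharper than 1, is what the induction on [q] preserves. *)
Lemma sum_eq_le1 p q k : (\sum_(p <= i < q) (i.+1 == k) <= (k <= q))%N.
Proof.
elim: q => [|q IH]; first by rewrite big_geq.
case: (leqP p q) => pq; last by rewrite big_geq.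
rewrite big_nat_recr//= (leq_trans (leq_add IH (leqnn _)))//.
by case: (leqP k q); case: (eqVneq q.+1 k); case: (leqP k q.+1); lia.
Qed.

(** There is at most one crossing index per cell, so the boundary error [2 * M * m] does not grow
    with the length of the interval. *)
Lemma sum_fbar f h g (e M : R) p q : mu.-integrable I01 (EFin \o f) -> 0 <= e -> 0 <= M ->
  (forall j y, (j < m)%N -> s j <= y < s j.+1 -> `|f y - h j| <= e) ->
  (forall y, 0 <= y < 1 -> `|f y| <= M) -> (forall j, (j < m)%N -> `|h j| <= M) ->
  (forall j i, (j < m)%N -> (grid n s j <= i < grid n s j.+1)%N -> g i = h j) ->
  (p <= q <= n)%N ->
  `|\sum_(p <= i < q) (fbar f n i - g i)| <= e * (q - p)%:R + 2 * M * m%:R.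
Proof.
move=> fi e0 M0 hfh hM hhM hg /andP[pq qn].
apply: (le_trans (ler_norm_sum _ _ _)).
apply: (@le_trans _ _ (\sum_(p <= i < q) (e + 2 * M * \sum_(j < m) (i.+1 == grid n s j.+1)%:R))).
  rewrite big_nat [leRHS]big_nat; apply: ler_sum => i /andP[pi iq].
  have i_n : (i < n)%N by exact: leq_trans iq qn.
  have [j jm hj] : exists2 j, (j < m)%N & s j <= i%:R / n%:R < s j.+1.
    apply: cell_of hs _; rewrite divr_ge0//= ltr_pdivrMr// mul1r ltr_nat //.
  have hij : (grid n s j <= i < grid n s j.+1)%N.
    rewrite [(i < _)%N]ltnNge /grid (ceiln_le _ (ns0 (ltnW jm))) (ceiln_le _ (ns0 jm)) -ltNge.
    by move: hj; rewrite ler_pdivlMr// ltr_pdivrMr// mulrC [X in _ < X]mulrC.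
  rewrite (hg j)//; apply: le_trans (fbar_cell fi e0 M0 hfh hM hhM jm hij) _.
  rewrite lerD2l ler_wpM2l ?mulr_ge0// (bigD1 (Ordinal jm))//= lerDl.
  exact: sumr_ge0.
rewrite big_split /= sumr_const_nat -[e *+ _]mulr_natr lerD2l -mulr_sumr ler_wpM2l ?mulr_ge0//.
rewrite exchange_big /= -[m in leRHS]card_ord -sumr_const; apply: ler_sum => j _.
rewrite -natr_sum -[1]/(1%:R) ler_nat (leq_trans (sum_eq_le1 _ _ _))//.
exact: leq_b1.
Qed.

End grid.
End cell_means.

(** * Deterministic consistency for cadlag functions *)

Section cadlag_case.
Context {R : realType}.
Local Notation mu := (@lebesgue_measure R).
Local Notation I01 := (`[0%R, 1%R[%classic : set R).
Implicit Types (f F G : R -> R) (U V Y h : nat -> R) (n m : nat).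

Lemma cadlag_bound f : in_D f -> exists2 M, 1 <= M & forall y, 0 <= y < 1 -> `|f y| <= M.
Proof.
move=> fD; have [m [s [hs h]]] := cadlag_cells fD (@ltr01 R).
exists (1 + \sum_(j < m) `|f (s j)|); first by rewrite lerDl sumr_ge0.
move=> y hy; have [j jm hj] := cell_of hs hy.
have := h j y jm hj; have := lerB_dist (f y) (f (s j)).
suff : `|f (s j)| <= \sum_(j < m) `|f (s j)| by lra.
by rewrite (bigD1 (Ordinal jm))//= lerDl sumr_ge0.
Qed.

Lemma mean_noise A n (x : nat -> R) (e : R) p q : 0 < e -> (p < q <= n)%N ->
  noise_bound A n x -> A <= e ^+ 2 * (q - p)%:R -> `|\sum_(p <= i < q) x i| <= e * (q - p)%:R.
Proof.
move=> e0 pqn hx hA; have L0 : 0 < (q - p)%:R :> R by rewrite ltr0n; lia.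
have eL : 0 <= e * (q - p)%:R by rewrite mulr_ge0// ltW.
rewrite -(@ler_pXn2r _ 2%N) ?nnegrE// real_normK ?num_real//.
apply: (le_trans (hx p q pqn)).
rewrite exprMn [X in _ <= _ * X]expr2 mulrA ler_wpM2r//; exact: ltW.
Qed.

Lemma cell_values (a : nat -> nat) m h : (forall j, (j < m)%N -> (a j <= a j.+1)%N) ->
  exists g : nat -> R, forall j i, (j < m)%N -> (a j <= i < a j.+1)%N -> g i = h j.
Proof.
move=> ha; have mono i1 i2 : (i1 <= i2 <= m)%N -> (a i1 <= a i2)%N.
  elim: i2 => [|i2 IH]; first by rewrite leqn0 => /andP[/eqP->].
  case/andP; rewrite leq_eqVlt => /orP[/eqP->//|h1] h2.
  by apply: leq_trans (ha i2 h2); apply: IH; lia.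
exists (fun i => h (xget 0%N [set j | (j < m)%N /\ (a j <= i < a j.+1)%N])).
move=> j i jm hj; case: xgetP => [j' _ [j'm hj']|/(_ j)[]//].
congr h; case: (ltngtP j' j) => // l.
  by have := mono j'.+1 j; lia.
by have := mono j.+1 j'; lia.
Qed.

(** Oscillation, averaging across knots and noise contribute at most [e] each, the last two because
    the interval is long. *)
Lemma cell_mean f m (s : nat -> R) h n x (e M A : R) j p q : (0 < n)%N -> cells m s ->
  mu.-integrable I01 (EFin \o f) -> 0 < e -> 0 <= M -> 0 <= A ->
  (forall j y, (j < m)%N -> s j <= y < s j.+1 -> `|f y - h j| <= e) ->
  (forall y, 0 <= y < 1 -> `|f y| <= M) -> (forall j, (j < m)%N -> `|h j| <= M) ->
  noise_bound A n x -> (j < m)%N -> (grid n s j <= p < q)%N ->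
  (q <= grid n s j.+1 <= n)%N -> A / e ^+ 2 + 2 * M * m%:R / e <= (q - p)%:R ->
  `|mean (fun i => fbar f n i + x i) p q - h j| <= 3 * e.
Proof.
move=> n0 hs fi e0 M0 A0 hosc hM hhM hx jm hp hq Bq.
have [/andP[g1 pq] /andP[g2 gn]] := (hp, hq).
have pqn : (p < q <= n)%N by rewrite pq (leq_trans g2).
have hcell i : (p <= i < q)%N -> (grid n s j <= i < grid n s j.+1)%N.
  by move=> /andP[i1 i2]; rewrite (leq_trans g1 i1) (leq_trans i2 g2).
have e20 : 0 < e ^+ 2 by rewrite exprn_gt0.
have L0 : 0 < (q - p)%:R :> R by rewrite ltr0n subn_gt0.
have [g hg] : exists g : nat -> R, forall j i, (j < m)%N ->
    (grid n s j <= i < grid n s j.+1)%N -> g i = h j.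
  apply: cell_values => i im; have [_ _ inc] := hs.
  rewrite /grid ceiln_le; last by rewrite mulr_ge0//; case/andP: (cells_ge0 hs (ltnW im)).
  have /andP[h' _] := grid_itv n0 hs im; apply: le_trans h'.
  by rewrite ler_wpM2l// ltW// inc.
have e1 : `|\sum_(p <= i < q) (fbar f n i - g i)| <= e * (q - p)%:R + 2 * M * m%:R.
  by apply: (sum_fbar n0 hs fi (ltW e0) M0 hosc hM hhM hg); rewrite (ltnW pq) (leq_trans g2).
have e2 : `|\sum_(p <= i < q) x i| <= e * (q - p)%:R.
  apply: (mean_noise e0 pqn hx).
  rewrite [leRHS]mulrC -ler_pdivrMr//; apply: le_trans Bq.
  by rewrite lerDl divr_ge0 ?mulr_ge0// ltW.
have e3 : 2 * M * m%:R <= e * (q - p)%:R.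
  rewrite [leRHS]mulrC -ler_pdivrMr//; apply: le_trans Bq.
  by rewrite lerDr divr_ge0// ltW.
have -> : mean (fun i => fbar f n i + x i) p q - h j =
  (\sum_(p <= i < q) (fbar f n i - g i) + \sum_(p <= i < q) x i) / (q - p)%:R.
  rewrite /mean !big_split /= sumrN (sum_block (U := g) (ltnW pq) (c := h j)).
    by field; rewrite gt_eqF.
  by move=> i hi; apply: hg => //; exact: hcell.
rewrite normrM normfV (gtr0_norm L0) ler_pdivrMr//.
apply: (le_trans (ler_normD _ _)); lra.
Qed.

(** A segment shorter than [2 * B] would contradict [segment_length], as the penalty is at least
    [8 * M^2 * (2 * B) + 8 * A]. *)
Lemma long_segments f m (s : nat -> R) n x U (M A G : R) (B : nat) : (0 < n)%N ->
  mu.-integrable I01 (EFin \o f) -> 0 < M -> 0 <= A -> 0 <= G ->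
  (forall y, 0 <= y < 1 -> `|f y| <= M) -> noise_bound A n x ->
  nat_minimizer n G (fun i => fbar f n i + x i) U ->
  (2 * B <= n)%N -> 8 * M ^+ 2 * (2 * B)%:R + 8 * A <= G ->
  forall p q, segment n U p q -> (2 * B <= q - p)%N.
Proof.
move=> n0 fi M0 A0 G0 hM hx hU Bn hG p q sg.
have hz : noise_bound A n (fun i => fbar f n i + x i - fbar f n i).
  move=> c d hcd; rewrite (eq_bigr x); first exact: hx.
  by move=> i _; rewrite addrAC subrr add0r.
case: (segment_length hU G0 A0 (ltW M0) (fun i => fbar_bound n0 fi hM (i := i)) hz sg).
  by move=> [-> ->]; rewrite subn0.
move=> h7; rewrite leqNgt; apply/negP => h8.
have : 8 * M ^+ 2 * (q - p)%:R < 8 * M ^+ 2 * (2 * B)%:R.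
  by rewrite ltr_pM2l ?ltr_nat// mulr_gt0// exprn_gt0.
lra.
Qed.

(** Long data means inside a cell are within [3 * e] of [f (s j)], so [minimizer_close] gives
    [12 * e]; the oscillation of [f] adds one more [e]. *)
Lemma cadlag_core f m (s : nat -> R) n x F U (e dl M A G : R) (B L : nat) :
  in_D f -> mu.-integrable I01 (EFin \o f) -> (0 < n)%N -> cells m s ->
  (forall j, (j < m)%N -> s j + dl <= s j.+1) -> 0 < dl -> 0 < e -> 0 < M -> 0 <= A -> 0 <= G ->
  (forall j y, (j < m)%N -> s j <= y < s j.+1 -> `|f y - f (s j)| <= e) ->
  (forall y, 0 <= y < 1 -> `|f y| <= M) -> noise_bound A n x ->
  nat_minimizer n G (fun i => fbar f n i + x i) U -> grid_fun n F U ->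
  (0 < B)%N -> (2 * B <= L)%N -> L%:R + 1 <= n%:R * dl ->
  A / e ^+ 2 + 2 * M * m%:R / e <= B%:R -> 4 * G <= (3 * e) ^+ 2 * L%:R ->
  8 * M ^+ 2 * (2 * B)%:R + 8 * A <= G ->
  2 * m.+1%:R * (B%:R + 1) <= n%:R * dl ->
  2 * m.+1%:R * (B%:R + 1) <= 13 * e * (n%:R * dl) ->
  (skorokhod (S_to_D F) f <= (13 * e)%:E)%E.
Proof.
move=> fD fi n0 hs gap d0 e0 M0 A0 G0 hosc hM hx hU hF B0 BL Ln hB hG1 hG2 hB1 hB2.
have [s0 sm inc] := hs.
have m0 : (0 < m)%N by case: (m) sm => // h; move: h; rewrite s0 => /esym/eqP; rewrite oner_eq0.
have ha j : (j < m)%N -> (grid n s j + L <= grid n s j.+1 <= n)%N.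
  by move=> jm; exact: (grid_len n0 hs jm (gap j jm)).
have hhM j : (j < m)%N -> `|f (s j)| <= M.
  move=> jm; apply: hM; have := cells_ge0 hs (ltnW jm); have := cells_ge0 hs jm.
  by have := inc j jm; move=> h1 /andP[h2 h3] /andP[h4 h5]; rewrite h4 (lt_le_trans h1).
have Ln' : (2 * B <= n)%N.
  by apply: (leq_trans BL); have := ha 0%N m0; move/andP => [h1]; apply: leq_trans; exact: leq_trans (leq_addl _ _) h1.
have hlen := @long_segments f m s n x U M A G B n0 fi M0 A0 G0 hM hx hU Ln' hG2.
have hmean j p q : (j < m)%N -> (grid n s j <= p < q)%N -> (q <= grid n s j.+1)%N ->
    (B <= q - p)%N -> `|mean (fun i => fbar f n i + x i) p q - f (s j)| <= 3 * e.
  move=> jm hp hq Bl; have /andP[_ an] := ha j jm.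
  apply: (@cell_mean f m s (fun j => f (s j)) n x e M A) => //; first exact: ltW.
    by rewrite hq.
  by apply: (le_trans hB); rewrite ler_nat.
have gr0 : grid n s 0 = 0%N by exact: grid0 hs.
have grn : grid n s m = n by exact: gridn hs.
have e30 : 0 <= 3 * e by rewrite mulr_ge0// ltW.
have [sg [sg0 sgm sgn hsg]] := @minimizer_close _ n m (grid n s) (fun j => f (s j)) L B G (3 * e)
  _ U m0 gr0 grn hU G0 e30 B0 BL ha hmean hG1 hlen.
have nd0 : 0 < n%:R * dl by rewrite mulr_gt0// ltr0n.
have H := @skorokhod_grid _ n F U f m s sg dl (B%:R + 1) (13 * e) n0 hF hs d0 gap _ hB1 sg0 sgm.
apply: le_trans (H _ _ _ _) _.
- by rewrite addr_ge0.
- move=> j jm; have /andP[g1 g2] := sgn j jm; have /andP[g3 g4] := grid_itv n0 hs jm.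
  have {}g1 : (sg j)%:R <= (grid n s j)%:R + B%:R :> R by rewrite -natrD ler_nat.
  have {}g2 : (grid n s j)%:R <= (sg j)%:R + B%:R :> R by rewrite -natrD ler_nat.
  by apply/ler_normlP; split; lra.
- move=> j i t jm hi ht; have h1 := hsg j i jm hi; have h2 := hosc j t jm ht.
  have -> : U i - f t = (U i - f (s j)) - (f t - f (s j)) by ring.
  by apply: (le_trans (ler_normB _ _)); lra.
- by case: fD.
rewrite lee_fin ge_max lexx andbT mulrA ler_pdivrMr//.
by rewrite mulrA.
Qed.

(** The scales are [B], of order [A], and [L], about [n * dl / 2]. All that [cadlag_core] requires
    of them follows from three comparisons with one large [K]: penalty against noise, smallness of
    [gamma], and [n] against noise. *)
Lemma cadlag_deterministic f (e : R) : in_D f -> in_L2 f -> 0 < e ->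
  exists2 K, 0 < K & forall n (A gamma : R) x F U, (0 < n)%N -> 1 <= A ->
    K * A <= gamma * n%:R -> gamma * K <= 1 -> K * A <= n%:R ->
    noise_bound A n x ->
    nat_minimizer n (gamma * n%:R) (fun i => fbar f n i + x i) U -> grid_fun n F U ->
    (skorokhod (S_to_D F) f <= (13 * e)%:E)%E.
Proof.
move=> fD f2 e0; have fi := in_L2_integrable f2.
have [m [s [hs hosc]]] := cadlag_cells fD e0.
have [M M1 hM] := cadlag_bound fD.
have [dl d0 gap] := cells_gap hs.
have M0 : 0 <= M by lra.
have M0' : 0 < M by lra.
pose K1 := (e ^+ 2)^-1 + 2 * M * m%:R / e + 2.
have e20 : 0 < e ^+ 2 by rewrite exprn_gt0.
have p1 : 0 < (e ^+ 2)^-1 by rewrite invr_gt0.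
have p2 : 0 <= 2 * M * m%:R / e by rewrite divr_ge0 ?mulr_ge0// ltW.
have K10 : 0 < K1 by rewrite /K1; lra.
(* [k1] gives [2 * B <= L], [k2] absorbs rounding, [k3] bounds [gamma] by [e^2 * dl], [k4] makes
   segments long, [k5] and [k6] keep the time change admissible and within [13 * e]. *)
pose k1 := 4 * K1 / dl; pose k2 := 4 / dl; pose k3 := (e ^+ 2 * dl)^-1.
pose k4 := 16 * M ^+ 2 * K1 + 8; pose k5 := 2 * m.+1%:R * (K1 + 1) / dl.
pose k6 := k5 / (13 * e).
have k10 : 0 < k1 by rewrite /k1 divr_gt0 ?mulr_gt0 ?invr_gt0//.
have k20 : 0 < k2 by rewrite /k2 divr_gt0//.
have k30 : 0 < k3 by rewrite /k3 invr_gt0 mulr_gt0//.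
have k40 : 0 < k4 by have := mulr_ge0 (sqr_ge0 M) (ltW K10); rewrite /k4; lra.
have k50 : 0 < k5 by rewrite /k5 divr_gt0// !mulr_gt0// addr_gt0.
have k60 : 0 < k6 by rewrite divr_gt0// mulr_gt0.
exists (k1 + k2 + k3 + k4 + k5 + k6); first by lra.
set K := k1 + k2 + k3 + k4 + k5 + k6.
move=> n A gamma x F U n0 A1 hKG hgK hKn hx hU hF.
have n0' : 0 < n%:R :> R by rewrite ltr0n.
have A0 : 0 < A by lra.
have le k : k <= K -> k * A <= n%:R.
  by move=> kK; apply: le_trans hKn; rewrite ler_wpM2r// ltW.
have h1 : 4 * K1 * A <= n%:R * dl.
  have : k1 * A * dl <= n%:R * dl by rewrite ler_wpM2r ?(ltW d0)// le// /K; lra.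
  by rewrite /k1 (_ : _ / dl * A * dl = 4 * K1 * A)//; field; rewrite gt_eqF.
have h2 : 4 <= n%:R * dl.
  have : k2 * A * dl <= n%:R * dl by rewrite ler_wpM2r ?(ltW d0)// le// /K; lra.
  by rewrite /k2 (_ : _ / dl * A * dl = 4 * A); [lra|field; rewrite gt_eqF].
have h5 : 2 * m.+1%:R * ((K1 + 1) * A) <= n%:R * dl.
  have : k5 * A * dl <= n%:R * dl by rewrite ler_wpM2r ?(ltW d0)// le// /K; lra.
  by rewrite /k5 (_ : _ / dl * A * dl = 2 * m.+1%:R * ((K1 + 1) * A))//; field; rewrite gt_eqF.
have h6 : 2 * m.+1%:R * ((K1 + 1) * A) <= 13 * e * (n%:R * dl).
  have : k6 * A * (13 * e * dl) <= n%:R * (13 * e * dl).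
    by rewrite ler_wpM2r ?mulr_ge0 ?(ltW d0) ?(ltW e0)// le// /K; lra.
  rewrite /k6 /k5 (_ : _ * A * (13 * e * dl) = 2 * m.+1%:R * ((K1 + 1) * A)); last first.
    by field; rewrite !gt_eqF// mulr_gt0.
  by rewrite [X in _ <= X -> _]mulrCA.
have G0 : 0 < gamma * n%:R.
  by apply: lt_le_trans hKG; rewrite mulr_gt0// /K; lra.
have g0 : 0 < gamma by move: G0; rewrite pmulr_lgt0.
have h3 : gamma <= e ^+ 2 * dl.
  have : gamma * k3 <= 1 by apply: le_trans hgK; rewrite ler_pM2l// /K; lra.
  by rewrite /k3 -ler_pdivlMr ?invr_gt0 ?mulr_gt0// invrK mul1r.
have h4 : k4 * A <= gamma * n%:R.
  by apply: le_trans hKG; rewrite ler_wpM2r ?(ltW A0)// /K; lra.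
pose b := A / e ^+ 2 + 2 * M * m%:R / e.
have b0 : 0 <= b by rewrite addr_ge0// divr_ge0 ?mulr_ge0// ltW.
have bK : b + 2 <= K1 * A.
  have A10 : 0 <= A - 1 by lra.
  have := mulr_ge0 p2 A10; rewrite /b /K1; lra.
have /andP[B1 B2] := ceiln_itv b0; pose B := (ceiln b).+1.
have BR : b <= B%:R <= b + 2 by rewrite /B -natr1; apply/andP; split; lra.
have nd0 : 0 <= n%:R * dl / 2 by rewrite divr_ge0// mulr_ge0// ltW.
have /andP[L1 L2] := ceiln_itv nd0; pose L := ceiln (n%:R * dl / 2).
have BL : (2 * B <= L)%N.
  rewrite -(ler_nat R) natrM (le_trans _ L1)//; lra.
apply: (@cadlag_core f m s n x F U e dl M A (gamma * n%:R) B L) => //.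
- exact: ltW.
- exact: ltW.
- rewrite /L; lra.
- by case/andP: BR.
- have : gamma * n%:R <= e ^+ 2 * dl * n%:R by rewrite ler_wpM2r// ltW.
  have : e ^+ 2 * (n%:R * dl / 2) <= e ^+ 2 * L%:R by rewrite ler_wpM2l// ltW.
  rewrite exprMn; lra.
- have : 8 * M ^+ 2 * (2 * B)%:R <= 8 * M ^+ 2 * (2 * (K1 * A)).
    by rewrite ler_wpM2l ?mulr_ge0 ?sqr_ge0// natrM; case/andP: BR => _ ?; lra.
  move: h4; rewrite /k4; lra.
- apply: le_trans h5; rewrite ler_wpM2l ?mulr_ge0//; case/andP: BR => _ ?; lra.
- apply: le_trans h6; rewrite ler_wpM2l ?mulr_ge0//; case/andP: BR => _ ?; lra.
Qed.

End cadlag_case.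

(** * Exact jump count and structure when f is a step function *)

Section step_case.
Context {R : realType}.
Local Notation mu := (@lebesgue_measure R).
Local Notation I01 := (`[0%R, 1%R[%classic : set R).
Implicit Types (f F G : R -> R) (U V Y h g : nat -> R) (n m : nat).

Ltac nat_lia := repeat match goal with
  | H : ?B |- _ => match B with context [R] => clear H end end; lia.

Lemma jumps_cells n m (a : nat -> nat) h g : a 0%N = 0%N ->
  (forall i, (i < n)%N -> exists2 j, (j < m)%N & (a j <= i < a j.+1)%N) ->
  (forall j i, (j < m)%N -> (a j <= i < a j.+1)%N -> g i = h j) ->
  (jumps n g <= m.-1)%N.
Proof.
move=> a0 hc hg; have em : m.-1 = size [seq a j | j <- iota 1 m.-1] by rewrite size_map size_iota.
rewrite jumps_count [leqRHS]em.
apply: uniq_leq_size; first by rewrite filter_uniq ?iota_uniq.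
move=> p; rewrite mem_filter mem_index_iota => /andP[jp hp].
have [j jm hj] := hc p ltac:(lia).
have [e|ne] := eqVneq p (a j).
  rewrite e; apply: map_f; rewrite mem_iota.
  by have : (0 < j)%N; [case: (j) e => // e; lia|lia].
move: jp; rewrite /jump (hg j p jm hj) (hg j p.-1 jm) ?eqxx//; lia.
Qed.

Lemma grid_cell n m (s : nat -> R) i : (0 < n)%N -> cells m s -> (i < n)%N ->
  exists2 j, (j < m)%N & (grid n s j <= i < grid n s j.+1)%N.
Proof.
move=> n0 hs i_n; have n0' : 0 < n%:R :> R by rewrite ltr0n.
have [j jm hj] : exists2 j, (j < m)%N & s j <= i%:R / n%:R < s j.+1.
  by apply: cell_of hs _; rewrite divr_ge0//= ltr_pdivrMr// mul1r ltr_nat.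
exists j => //; have h k : (k <= m)%N -> 0 <= n%:R * s k.
  by move=> km; rewrite mulr_ge0//; case/andP: (cells_ge0 hs km).
rewrite [(i < _)%N]ltnNge /grid (ceiln_le _ (h _ (ltnW jm))) (ceiln_le _ (h _ jm)) -ltNge.
by move: hj; rewrite ler_pdivlMr// ltr_pdivrMr// mulrC [X in _ < X]mulrC.
Qed.

Lemma min_gap m (u : nat -> R) : (forall j, (0 < j < m)%N -> 0 < u j) ->
  exists2 D, 0 < D & forall j, (0 < j < m)%N -> D <= u j.
Proof.
elim: m => [|m IH] h; first by exists 1 => // j; rewrite ltn0 andbF.
have [|D D0 hD] := IH; first by move=> j hj; apply: h; lia.
case: (posnP m) => [->|m0].
  by exists 1 => // j; case: j.
exists (Num.min D (u m)); first by rewrite lt_min D0 h// m0 ltnSn.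
move=> j /andP[j0]; rewrite ltnS (leq_eqVlt j m) => /orP[/eqP->|jm].
  by rewrite ge_min lexx orbT.
by rewrite ge_min hD ?orTb// j0.
Qed.

(* Setup shared by the step function results. *)
Definition step_data f m (s h : nat -> R) (dl D M : R) : Prop :=
  [/\ [/\ cells m s, (0 < m)%N, 0 < dl, 0 < D & 1 <= M],
    forall j, (j < m)%N -> s j + dl <= s j.+1,
    forall j, (0 < j < m)%N -> D <= `|h j.-1 - h j|,
    (forall j, (j < m)%N -> `|h j| <= M) /\ (forall y, 0 <= y < 1 -> `|f y| <= M) &
    forall j y, (j < m)%N -> s j <= y < s j.+1 -> f y = h j].

Lemma reduced_step_data f m s h : reduced_rep m s h f ->
  exists dl D M, step_data f m s h dl D M.
Proof.
move=> [hr inc ne]; have m0 := step_rep_gt0 hr; have [s0 sm _ hf] := hr.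
have hs : cells m s by split.
have [dl d0 gap] := cells_gap hs.
have [D D0 hD] : exists2 D, 0 < D & forall j, (0 < j < m)%N -> D <= `|h j.-1 - h j|.
  by apply: min_gap => j hj; rewrite normr_gt0 subr_eq0; apply/eqP/ne.
have hM j : (j < m)%N -> `|h j| <= 1 + \sum_(j < m) `|h j|.
  move=> jm; rewrite (bigD1 (Ordinal jm))//=.
  by have : 0 <= \sum_(i < m | i != Ordinal jm) `|h i| by [rewrite sumr_ge0]; lra.
exists dl, D, (1 + \sum_(j < m) `|h j|); split=> //.
  by split=> //; rewrite lerDl sumr_ge0.
split=> // y hy; have [j jm hj] := cell_of hs hy.
by rewrite (hf j)//; exact: hM.
Qed.

(** For a step function the averaging bias sums to at most [2 * M * m] over any interval. As [A] and
    the length are at least 1, it can be counted as noise with a larger constant. *)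
Lemma step_noise f m s h dl D M n (A : R) x g : step_data f m s h dl D M ->
  mu.-integrable I01 (EFin \o f) -> (0 < n)%N -> 1 <= A ->
  (forall j i, (j < m)%N -> (grid n s j <= i < grid n s j.+1)%N -> g i = h j) ->
  noise_bound A n x ->
  noise_bound ((2 + 8 * M ^+ 2 * m%:R ^+ 2) * A) n (fun i => fbar f n i + x i - g i).
Proof.
move=> [[hs m0 d0 D0 M1] gap hD [hM hfM] hf] fi n0 A1 hg hx p q pqn.
have M0 : 0 <= M by lra.
have l1 : 1 <= (q - p)%:R :> R by rewrite ler1n subn_gt0; case/andP: pqn.
have e1 : `|\sum_(p <= i < q) (fbar f n i - g i)| <= 2 * M * m%:R.
  have /(_ p q) := @sum_fbar _ n m s n0 hs f h g 0 M _ _ fi (lexx 0) M0 _ hfM hM hg.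
  rewrite mul0r add0r; apply; last by case/andP: pqn => /ltnW -> ->.
  by move=> j y jm hy; rewrite (hf j)// subrr normr0.
have e2 := hx p q pqn.
have -> : \sum_(p <= i < q) (fbar f n i + x i - g i) =
   \sum_(p <= i < q) (fbar f n i - g i) + \sum_(p <= i < q) x i.
  by rewrite -big_split; apply: eq_bigr => i _ /=; ring.
move: e1 e2; set u := \sum_(_ <= _ < _) _; set v := \sum_(_ <= _ < _) _ => e1 e2.
have e3 : u ^+ 2 <= 4 * M ^+ 2 * m%:R ^+ 2.
  rewrite -[u ^+ 2]real_normK ?num_real// (_ : 4 * _ * _ = (2 * M * m%:R) ^+ 2); last by ring.
  by rewrite ler_pXn2r ?nnegrE// !mulr_ge0.
have e4 : 4 * M ^+ 2 * m%:R ^+ 2 <= 4 * M ^+ 2 * m%:R ^+ 2 * (A * (q - p)%:R).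
  rewrite ler_peMr// ?mulr_ge0 ?sqr_ge0//; apply: (le_trans A1); rewrite ler_peMr//; lra.
have := sqr_ge0 (u - v); lra.
Qed.

(** A bootstrap with two passes of [step_recovery]. A penalty above [4 * m * A] excludes surplus
    jumps; the crude cost [2 * m * G] then shows that none is missing; with equal jump counts the
    penalties cancel, and the cost falls to noise order, which localizes the jumps within the small
    window [r2]. *)
Lemma step_core n m (a : nat -> nat) h g Y U (A G D : R) (L r1 r2 : nat) : (0 < n)%N -> (0 < m)%N ->
  a 0%N = 0%N -> a m = n -> (forall j, (j < m)%N -> (a j + L <= a j.+1)%N) ->
  (forall i, (i < n)%N -> exists2 j, (j < m)%N & (a j <= i < a j.+1)%N) ->
  (forall j i, (j < m)%N -> (a j <= i < a j.+1)%N -> g i = h j) ->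
  (forall j, (0 < j < m)%N -> D <= `|h j.-1 - h j|) -> 0 <= D -> 0 <= A ->
  noise_bound A n (fun i => Y i - g i) -> nat_minimizer n G Y U ->
  4 * m%:R * A < G -> (0 < r1)%N -> (2 * r1 <= L)%N -> 4 * m%:R * G < r1%:R * D ^+ 2 ->
  (0 < r2)%N -> (2 * r2 <= L)%N -> 16 * m%:R * A < r2%:R * D ^+ 2 ->
  exists sg : nat -> nat, [/\ sg 0%N = 0%N, sg m = n,
    forall j, (j <= m)%N -> (sg j <= a j + r2)%N && (a j <= sg j + r2)%N,
    forall j, (j < m)%N -> segment n U (sg j) (sg j.+1) &
    forall j, (j < m)%N -> (L - 2 * r2)%:R * (U (sg j) - h j) ^+ 2 <= 8 * m%:R * A].
Proof.
move=> n0 m0 a0 am ha hc hg hD D0 A0 hz hU hG r10 r1L hr1 r20 r2L hr2.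
have half0 : 0 < 2^-1 :> R by rewrite invr_gt0.
have hb := potts_basic g A0 half0 hz hU.
have jg := jumps_cells a0 hc hg.
have c0 : cost n g g = 0 by rewrite /cost big1// => i _; rewrite subrr expr0n.
have mE : m%:R = (m.-1)%:R + 1 :> R by rewrite natr1 prednK.
have jgR : (jumps n g)%:R <= m%:R - 1 :> R by rewrite mE addrK ler_nat.
have E0 : 0 <= cost n g U by apply: sumr_ge0 => i _; exact: sqr_ge0.
move: hb; rewrite c0 -[(jumps n U + jumps n g).+1%:R]natr1 natrD invrK; set E := cost n g U in E0 *.
move=> hb; have G0 : 0 < G by apply: le_lt_trans hG; rewrite !mulr_ge0.
have m1 : 1 <= m%:R :> R by rewrite ler1n.
have GJ : G * (jumps n g)%:R <= G * (m%:R - 1) by rewrite ler_wpM2l// ltW.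
have AJ : A * (jumps n g)%:R <= A * (m%:R - 1) by rewrite ler_wpM2l.
have ju0 : 0 <= (jumps n U)%:R :> R by [].
have AU0 := mulr_ge0 A0 ju0.
have jU : (jumps n U <= m.-1)%N.
  rewrite leqNgt; apply/negP => hj.
  have jUR : m%:R <= (jumps n U)%:R :> R by rewrite ler_nat -(prednK m0).
  have GA : 0 <= G - 2 * A by have := ler_wpM2l A0 m1; lra.
  have := ler_wpM2l GA jUR; lra.
have jUR : (jumps n U)%:R <= m%:R - 1 :> R by rewrite mE addrK ler_nat.
have AJU : A * (jumps n U)%:R <= A * (m%:R - 1) by rewrite ler_wpM2l.
have GU0 := mulr_ge0 (ltW G0) ju0.
(* First pass: the cost may be of penalty size, so the window [r1] is large and only the lower bound
   on the number of jumps is kept. *)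
have E1 : E <= 2 * m%:R * G by lra.
have [jU' _] := step_recovery m0 a0 am ha hg D0 hD jU E1 r10 r1L ltac:(by rewrite mulrA mulrA -natrM).
have jUE : (jumps n U)%:R = m%:R - 1 :> R.
  by rewrite mE addrK; congr _%:R; apply/eqP; rewrite eqn_leq jU.
(* Second pass: [U] has [m.-1] jumps, at least as many as [g], so no penalty is left on the right of
   the basic inequality. *)
have E2 : E <= 8 * m%:R * A by rewrite jUE in hb; lra.
have [_ [sg [sg0 sgm sgn sgi hsg]]] := step_recovery m0 a0 am ha hg D0 hD jU E2 r20 r2L
  ltac:(by rewrite mulrA mulrA -natrM).
exists sg; split=> //.
- by move=> j jm; have /andP[h1 h2] := sgn j jm; rewrite (ltnW h1) (ltnW h2).
- move=> j jm; have [h1 h2] := sgi j jm; have [h3 _] := hsg j jm; split=> //.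
  + rewrite h1 /= -sgm; have [->//|ne] := eqVneq j.+1 m.
    apply/ltnW; apply: (step_homo (m := m)) => [i im|]; first by have [] := sgi i im.
    by rewrite leqnn andbT ltn_neqAle ne.
  + by case: (posnP j) => [->|/h2]; [left|right].
  + have [->|ne] := eqVneq j.+1 m; first by left.
    by right; have [|_ ->] := sgi j.+1 _ => //; rewrite ltn_neqAle ne.
- by move=> j /hsg[].
Qed.

(** [step_core] with [L] about half the minimal cell length, [r1 = L./2] for the first pass and [r2]
    of order [A] for the second. *)
Lemma step_structure f m s h dl D M : step_data f m s h dl D M ->
  mu.-integrable I01 (EFin \o f) ->
  exists2 K, 1 <= K & forall n (A gamma : R) x U, (0 < n)%N -> 1 <= A ->
    K * A <= gamma * n%:R -> gamma * K <= 1 -> K * A <= n%:R -> noise_bound A n x ->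
    nat_minimizer n (gamma * n%:R) (fun i => fbar f n i + x i) U ->
    exists sg : nat -> nat, [/\ sg 0%N = 0%N, sg m = n,
      forall j, (j <= m)%N -> `|(sg j)%:R - n%:R * s j| <= K * A,
      forall j, (j < m)%N -> segment n U (sg j) (sg j.+1) &
      forall j, (j < m)%N -> (U (sg j) - h j) ^+ 2 * n%:R <= K * A].
Proof.
move=> sd fi; have [[hs m0 d0 D0 M1] gap hD [hM hfM] hf] := sd.
pose c1 := 2 + 8 * M ^+ 2 * m%:R ^+ 2.
have c10 : 0 < c1 by have := mulr_ge0 (sqr_ge0 M) (sqr_ge0 m%:R); rewrite /c1; lra.
have m1 : 1 <= m%:R :> R by rewrite ler1n.
have D20 : 0 < D ^+ 2 by rewrite exprn_gt0.
have mR0 : 0 < m%:R :> R by lra.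
pose K2 := 16 * m%:R * c1 / D ^+ 2 + 2.
have K20 : 0 < K2 by rewrite ltr_wpDl// divr_ge0 ?(ltW D20)// !mulr_ge0// ltW.
pose k1 := 8 * K2 / dl; pose k2 := 4 / dl; pose k3 := 64 * m%:R / (dl * D ^+ 2).
pose k4 := 4 * m%:R * c1 + 1; pose k5 := 32 * m%:R * c1 / dl; pose k6 := K2 + 1.
have k10 : 0 < k1 by rewrite divr_gt0// mulr_gt0.
have k20 : 0 < k2 by rewrite divr_gt0.
have k30 : 0 < k3 by rewrite divr_gt0// mulr_gt0.
have k40 : 1 <= k4 by rewrite lerDr !mulr_ge0// ltW.
have k50 : 0 < k5 by rewrite divr_gt0// !mulr_gt0.
have k60 : 0 < k6 by rewrite /k6; lra.
exists (k1 + k2 + k3 + k4 + k5 + k6); first by lra.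
set K := k1 + k2 + k3 + k4 + k5 + k6.
move=> n A gamma x U n0 A1 hKG hgK hKn hx hU.
have n0' : 0 < n%:R :> R by rewrite ltr0n.
have A0 : 0 < A by lra.
have leK k : k <= K -> k * A <= K * A by move=> kK; rewrite ler_wpM2r// ltW.
have h1 : 8 * K2 * A <= n%:R * dl.
  have : k1 * A * dl <= n%:R * dl.
    by rewrite ler_wpM2r ?(ltW d0)// (le_trans _ hKn)// leK// /K; lra.
  by rewrite /k1 (_ : _ / dl * A * dl = 8 * K2 * A)//; field; rewrite gt_eqF.
have h2 : 4 <= n%:R * dl.
  have : k2 * A * dl <= n%:R * dl.
    by rewrite ler_wpM2r ?(ltW d0)// (le_trans _ hKn)// leK// /K; lra.
  by rewrite /k2 (_ : _ / dl * A * dl = 4 * A); [lra|field; rewrite gt_eqF].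
have G0 : 0 < gamma * n%:R.
  by apply: lt_le_trans hKG; rewrite mulr_gt0// /K; lra.
have g0 : 0 < gamma by move: G0; rewrite pmulr_lgt0.
have h3 : 64 * m%:R * gamma <= dl * D ^+ 2.
  have : gamma * k3 <= 1 by apply: le_trans hgK; rewrite ler_pM2l// /K; lra.
  by rewrite /k3 mulrA ler_pdivrMr ?mulr_gt0// mul1r mulrC.
have h4 : 4 * m%:R * (c1 * A) < gamma * n%:R.
  apply: lt_le_trans hKG; apply: (@lt_le_trans _ _ (k4 * A)).
    by rewrite /k4; lra.
  by rewrite leK// /K; lra.
have nd0 : 0 <= n%:R * dl / 2 by lra.
have /andP[L1 L2] := ceiln_itv nd0; pose L := ceiln (n%:R * dl / 2).
rewrite -/L in L1 L2.
have ha j : (j < m)%N -> (grid n s j + L <= grid n s j.+1 <= n)%N.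
  by move=> jm; apply: (grid_len n0 hs jm (gap j jm)); lra.
have b0 : 0 <= 16 * m%:R * (c1 * A) / D ^+ 2.
  by rewrite divr_ge0 ?(ltW D20)// !mulr_ge0// ltW.
have /andP[B1 B2] := ceiln_itv b0; pose r2 := (ceiln (16 * m%:R * (c1 * A) / D ^+ 2)).+1.
have r2R : 16 * m%:R * (c1 * A) / D ^+ 2 + 1 <= r2%:R <= K2 * A.
  rewrite /r2 -[(ceiln _).+1%:R]natr1; apply/andP; split; first by lra.
  have : 16 * m%:R * (c1 * A) / D ^+ 2 = (16 * m%:R * c1 / D ^+ 2) * A by ring.
  by rewrite /K2; lra.
have /andP[r21 r22] := r2R.
have r2L : (4 * r2 <= L)%N by rewrite -(ler_nat R) natrM; lra.
pose r1 := L./2.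
have r1R : n%:R * dl / 8 <= r1%:R.
  have : L%:R <= 2 * r1%:R + 1 :> R.
    rewrite -natrM natr1 ler_nat /r1 mul2n.
    by have := odd_double_half L; case: (odd L) => /=; nat_lia.
  lra.
have [g hg] : exists g : nat -> R, forall j i, (j < m)%N ->
    (grid n s j <= i < grid n s j.+1)%N -> g i = h j.
  by apply: cell_values => j jm; have := ha j jm; nat_lia.
have hz := step_noise sd fi n0 A1 hg hx.
have r10 : (0 < r1)%N by rewrite -(ltr_nat R); lra.
have r1L : (2 * r1 <= L)%N by rewrite /r1 mul2n; have := odd_double_half L; nat_lia.
have [sg [sg0 sgm sgn sgs hsg]] := @step_core n m (grid n s) h g _ U (c1 * A) (gamma * n%:R) D L r1 r2
  n0 m0 (grid0 n hs) (gridn n hs) ltac:(move=> j jm; by case/andP: (ha j jm)) (fun i => grid_cell n0 hs (i := i))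
  hg hD (ltW D0) ltac:(by rewrite mulr_ge0// ltW) hz hU h4 r10 r1L
  ltac:(
    apply: (@lt_le_trans _ _ (n%:R * dl / 8 * D ^+ 2)); last (by rewrite ler_wpM2r// ltW);
    have hh := ler_wpM2r (ltW n0') h3; have := mulr_gt0 (mulr_gt0 n0' d0) D20; lra)
  isT ltac:(nat_lia)
  ltac:(rewrite -ltr_pdivrMr//; lra).
exists sg; split=> //.
- move=> j jm; have /andP[g1 g2] := sgn j jm; have /andP[g3 g4] := grid_itv n0 hs jm.
  have {}g1 : (sg j)%:R <= (grid n s j)%:R + r2%:R :> R by rewrite -natrD ler_nat.
  have {}g2 : (grid n s j)%:R <= (sg j)%:R + r2%:R :> R by rewrite -natrD ler_nat.
  have : k6 * A <= K * A by apply: leK; rewrite /K; lra.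
  by rewrite /k6 => *; apply/ler_normlP; split; lra.
- move=> j jm; have := hsg j jm; set y := (U (sg j) - h j) ^+ 2 => hy.
  have y0 : 0 <= y by exact: sqr_ge0.
  have l1 : n%:R * dl / 4 <= (L - 2 * r2)%:R.
    rewrite natrB; last nat_lia.
    have : (4 * r2)%:R <= L%:R :> R by rewrite ler_nat.
    rewrite !natrM; lra.
  have l2 : n%:R * dl / 4 * y <= 8 * m%:R * (c1 * A).
    by apply: le_trans hy; rewrite ler_wpM2r.
  apply: (@le_trans _ _ (k5 * A)); last by rewrite leK// /K; lra.
  rewrite /k5 (_ : 32 * m%:R * c1 / dl * A = 32 * m%:R * c1 * A / dl); last by field; rewrite gt_eqF.
  rewrite ler_pdivlMr//; lra.
Qed.

End step_case.

(** * Rates of convergence for step functions *)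

Section step_rates.
Context {R : realType}.
Local Notation mu := (@lebesgue_measure R).
Local Notation I01 := (`[0%R, 1%R[%classic : set R).
Implicit Types (f F G : R -> R) (U V Y h g : nat -> R) (n m : nat).

Lemma S_to_D_neq1 f (t : R) : t != 1 -> S_to_D f t = f t.
Proof. by rewrite /S_to_D => /negbTE ->. Qed.

Lemma S_to_D_cvg f (l : R) : f x @[x --> 1^'-] --> l ->
  S_to_D f x @[x --> 1^'-] --> S_to_D f 1.
Proof.
move=> h; have -> : S_to_D f 1 = l by rewrite /S_to_D eqxx; exact: cvg_lim h.
apply: cvg_trans h; apply: near_eq_cvg; near=> x.
by rewrite S_to_D_neq1// lt_eqF//; near: x; exact: nbhs_left_lt.
Unshelve. all: end_near. Qed.

(** Noise over [l] indices is at most the square root of [A * l], hence at most [l + A]. *)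
Lemma prefix_sum_close n (A M r : R) (x y : nat -> R) p q : 0 <= A -> 0 <= M ->
  noise_bound A n x -> (forall i, (i < n)%N -> `|y i| <= M) -> (p <= n)%N -> (q <= n)%N ->
  `|p%:R - q%:R| <= r ->
  `|\sum_(0 <= i < p) (y i + x i) - \sum_(0 <= i < q) (y i + x i)| <= (M + 1) * r + A.
Proof.
move=> A0 M0 hx hy; wlog pq : p q / (p <= q)%N.
  move=> H pn qn hr; case/orP: (leq_total p q) => pq; first exact: H.
  by rewrite distrC; apply: H => //; rewrite distrC.
move=> pn qn; rewrite distrC -natrB// ger0_norm// => hr.
rewrite (big_cat_nat (n := p) (p := q))//= distrC addrAC subrr add0r big_split/=.
have [->|ne] := eqVneq p q.
  rewrite !big_geq// addr0 normr0 addr_ge0// mulr_ge0//; first lra.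
  exact: le_trans hr.
have h1 : `|\sum_(p <= i < q) y i| <= M * (q - p)%:R.
  rewrite (le_trans (ler_norm_sum _ _ _))// -(@sum_block _ p q (fun=> M) M)//.
  by apply: ler_sum_nat => i /andP[_ iq]; apply: hy; exact: leq_trans qn.
have h2 : `|\sum_(p <= i < q) x i| <= (q - p)%:R + A.
  rewrite -(@ler_pXn2r _ 2) ?nnegrE ?addr_ge0// real_normK ?num_real//.
  apply: le_trans (hx p q _) _; first by rewrite qn andbT ltn_neqAle ne.
  have := mulr_ge0 A0 (ler0n R (q - p)); have := sqr_ge0 (q - p)%:R; have := sqr_ge0 A; nra.
apply: le_trans (ler_normD _ _) _.
have : M * (q - p)%:R <= M * r by rewrite ler_wpM2l.
lra.
Qed.

(** [U p] is the data mean over [[p, q)]. Moving both ends to the grid breaks changes the prefix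
    sums by an amount governed by [r] and [A]; what remains is the noise sum over a fixed cell,
    bounded by [W]. *)
Lemma step_height f m s h dl D M n (A r W G : R) x U j p q : step_data f m s h dl D M ->
  mu.-integrable I01 (EFin \o f) -> (0 < n)%N -> 0 <= A -> 0 <= G -> 1 <= n%:R * dl ->
  (j < m)%N ->
  noise_bound A n x -> nat_minimizer n G (fun i => fbar f n i + x i) U ->
  segment n U p q -> `|p%:R - n%:R * s j| <= r -> `|q%:R - n%:R * s j.+1| <= r ->
  `|\sum_(grid n s j <= i < grid n s j.+1) x i| <= W ->
  (n%:R * dl - 2 * r) * `|U p - h j| <= 2 * M * m%:R + W + 2 * ((2 * M + 1) * (r + 1) + A).
Proof.
move=> sd fi n0 A0 G0 nd jm hx hU hseg hp hq hW.
have [[hs m0 d0 D0 M1] gap hD [hM hfM] hf] := sd.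
have M0 : 0 <= M by lra.
have [/andP[pq qn] _ _ _] := hseg.
have pn : (p <= n)%N by apply/ltnW: (leq_trans pq qn).
have /andP[a1 a2] := grid_itv n0 hs (ltnW jm); have /andP[b1 b2] := grid_itv n0 hs jm.
have /andP[ab bn] : (grid n s j + 0 <= grid n s j.+1 <= n)%N.
  by apply: (grid_len n0 hs jm (gap j jm)); rewrite add0r.
rewrite addn0 in ab.
pose y i := fbar f n i - h j.
have hy i : (i < n)%N -> `|y i| <= 2 * M.
  move=> i_n; have h1 := fbar_bound n0 fi hfM i_n; have h2 := hM j jm.
  by apply: le_trans (ler_normB _ _) _; lra.
have close k l : (k <= n)%N -> (l <= n)%N -> `|k%:R - l%:R| <= r + 1 ->
   `|\sum_(0 <= i < k) (y i + x i) - \sum_(0 <= i < l) (y i + x i)| <= (2 * M + 1) * (r + 1) + A.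
  by move=> kn ln; apply: prefix_sum_close hx hy kn ln; rewrite ?mulr_ge0.
have e1 := close p (grid n s j) pn (leq_trans ab bn).
have {}e1 := e1 ltac:(by move: hp => /ler_normlP[? ?]; apply/ler_normlP; split; lra).
have e2 := close q (grid n s j.+1) qn bn.
have {}e2 := e2 ltac:(by move: hq => /ler_normlP[? ?]; apply/ler_normlP; split; lra).
have diff k l : (k <= l)%N -> \sum_(k <= i < l) (y i + x i) =
    \sum_(0 <= i < l) (y i + x i) - \sum_(0 <= i < k) (y i + x i).
  by move=> kl; rewrite (big_cat_nat (m := 0) (n := k) (p := l))//= addrAC subrr add0r.
have e3 : `|\sum_(grid n s j <= i < grid n s j.+1) y i| <= 2 * M * m%:R.
  have [g hg] : exists g : nat -> R, forall j i, (j < m)%N ->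
    (grid n s j <= i < grid n s j.+1)%N -> g i = h j.
    apply: cell_values => k km.
    have /andP[] : (grid n s k + 0 <= grid n s k.+1 <= n)%N.
      by apply: (grid_len n0 hs km (gap k km)); rewrite add0r.
    by rewrite addn0.
  have := @sum_fbar _ n m s n0 hs f h g 0 M (grid n s j) (grid n s j.+1) fi (lexx 0) M0 _ hfM hM hg.
  rewrite mul0r add0r /y => H; rewrite (eq_big_nat _ _ (F2 := fun i => fbar f n i - g i)).
    apply: H; last by rewrite ab.
    by move=> k z km hz; rewrite (hf k)// subrr normr0.
  by move=> i hi; rewrite (hg j).
have e4 : (q - p)%:R * (U p - h j) = \sum_(p <= i < q) (y i + x i).
  have q0 : (q - p)%:R != 0 :> R by rewrite pnatr_eq0 -lt0n subn_gt0.
  rewrite (opt_mean hU G0 hseg) /mean mulrBr mulrC divfK//.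
  rewrite [_ * h j]mulrC -(@sum_block _ p q (fun=> h j) (h j) (ltnW pq))// -sumrB.
  by apply: eq_bigr => i _; rewrite /y; ring.
rewrite (diff p q (ltnW pq)) in e4.
have := diff _ _ ab; rewrite big_split /= => e5.
have e6 : n%:R * dl - 2 * r <= (q - p)%:R.
  rewrite natrB ?(ltnW pq)//; have := ler_wpM2l (ler0n R n) (gap j jm).
  by move: hp hq => /ler_normlP[? ?] /ler_normlP[? ?]; lra.
apply: (@le_trans _ _ `|(q - p)%:R * (U p - h j)|).
  by rewrite normrM ger0_norm// ler_wpM2r.
rewrite e4; move: e1 e2 e3 hW e5.
set S1 := \sum_(0 <= i < p) _; set S2 := \sum_(0 <= i < grid n s j) _.
set S3 := \sum_(0 <= i < q) _; set S4 := \sum_(0 <= i < grid n s j.+1) _.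
move=> /ler_normlP[? ?] /ler_normlP[? ?] /ler_normlP[? ?] /ler_normlP[? ?] ?.
by apply/ler_normlP; split; lra.
Qed.

(** The first bound combines knot errors [A / n] with height errors sqrt([A / n]) from
    [step_structure]. In the second, heights come from [step_height], so only [m] fixed noise sums
    matter, and the knot error is dominated because [A <= W * sqrt n]. *)
Theorem step_rates f : in_S f -> in_L2 f -> exists m (s : nat -> R) (K : R), [/\ cells m s, 1 <= K &
  forall n (A gamma : R) x F U, (0 < n)%N -> 1 <= A -> K * A <= gamma * n%:R ->
    gamma * K <= 1 -> K * A <= n%:R -> noise_bound A n x ->
    nat_minimizer n (gamma * n%:R) (fun i => fbar f n i + x i) U -> grid_fun n F U ->
    (skorokhod (S_to_D F) (S_to_D f) <= (K * Num.sqrt (A / n%:R))%:E)%E /\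
    forall W, A <= W * Num.sqrt n%:R ->
      (forall j, (j < m)%N ->
        `|\sum_(grid n s j <= i < grid n s j.+1) x i| <= W * Num.sqrt n%:R) ->
      (skorokhod (S_to_D F) (S_to_D f) <= (K * (W * Num.sqrt n%:R^-1))%:E)%E].
Proof.
move=> fS f2; have fi := in_L2_integrable f2.
have [m' [t' [a' hr']]] := in_S_step fS.
have {m' t' a' hr'} [m [s [h [_ hr]]]] := step_reduce hr'.
have [dl [D [M sd]]] := reduced_step_data hr.
have [K K1 hK] := step_structure sd fi.
have [[hs m0 d0 D0 M1] gap hD [hM hfM] hf] := sd.
have [s0 sm sinc] := hs.
have f1 : S_to_D f x @[x --> 1^'-] --> S_to_D f 1.
  apply: (@S_to_D_cvg _ (h m.-1)); case: hr => hr _ _.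
  apply: (step_left_cvg hr); rewrite ?prednK// sm lexx andbT -sm -{2}(prednK m0).
  by apply: sinc; rewrite prednK.
have mR0 : 0 < m.+1%:R :> R by rewrite ltr0n.
have mE : m.+1%:R = m%:R + 1 :> R by rewrite natr1.
pose k1 := 2 * m.+1%:R * K / dl; pose k2 := 4 * K / dl + 1 / dl.
have k10 : 0 <= k1 by rewrite divr_ge0 ?(ltW d0)// !mulr_ge0//; lra.
pose c3 := 2 * M * m%:R + 1 + 2 * ((2 * M + 1) * (K + 1) + 1).
have c30 : 0 <= c3.
  by rewrite /c3; have := mulr_ge0 (ltW (lt_le_trans ltr01 M1)) (ler0n R m); have : 0 <= (2 * M + 1) * (K + 1) by [rewrite mulr_ge0//; lra]; lra.
have k20 : 0 <= k2 by rewrite addr_ge0 ?divr_ge0 ?(ltW d0)//; lra.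
pose k3 := 2 / dl * c3.
have k30 : 0 <= k3 by rewrite mulr_ge0// divr_ge0// ltW.
exists m, s, (K + k1 + k2 + k3); split=> //; first by lra.
set K' := K + k1 + k2 + k3.
have K'0 : 0 <= K' by rewrite /K'; lra.
move=> n A gamma x F U n0 A1 hKG hgK hKn hx hU hF.
have n0' : 0 < n%:R :> R by rewrite ltr0n.
have A0 : 0 < A by lra.
have leK k : k <= K' -> k * A <= K' * A by move=> kK; rewrite ler_wpM2r// ltW.
have KK' : K * A <= K' * A by apply: leK; rewrite /K'; lra.
have gamma0 : 0 < gamma.
  have : 0 < gamma * n%:R by apply: lt_le_trans hKG; rewrite mulr_gt0// /K'; lra.
  by rewrite pmulr_lgt0.
have [|sg [sg0 sgm sgn sgs hsg]] :=
  hK n A gamma x U n0 A1 (le_trans KK' hKG) _ (le_trans KK' hKn) hx hU.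
  by apply: le_trans hgK; rewrite ler_pM2l// /K'; lra.
have h1 : 2 * m.+1%:R * (K * A) <= n%:R * dl.
  have := le_trans (leK k1 ltac:(by rewrite /K'; lra)) hKn.
  rewrite (_ : k1 * A = 2 * m.+1%:R * (K * A) / dl) ?ler_pdivrMr//; last by rewrite /k1; ring.
have h2 : (4 * K + 1) * A <= n%:R * dl.
  have := le_trans (leK k2 ltac:(by rewrite /K'; lra)) hKn.
  rewrite (_ : k2 * A = (4 * K + 1) * A / dl) ?ler_pdivrMr//; last by rewrite /k2; ring.
have KA0 : 0 <= K * A by rewrite mulr_ge0//; lra.
have KA : A <= K * A by rewrite ler_peMl// ltW.
have skor e : (forall j, (j < m)%N -> `|U (sg j) - h j| <= e) ->
    (skorokhod (S_to_D F) (S_to_D f) <= (Num.max (2 * (m.+1%:R * (K * A) / (n%:R * dl))) e)%:E)%E.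
  move=> he; apply: (skorokhod_grid n0 hF hs d0 gap KA0 h1 sg0 sgm sgn) => //.
  move=> j i t jm hi ht; have [_ hc _ _] := sgs j jm.
  rewrite (hc i hi) S_to_D_neq1.
    by rewrite (hf j)//; exact: he.
  apply: contraTneq ht => ->; rewrite negb_and -leNgt; apply/orP; right.
  by have /andP[] := cells_ge0 hs jm.
have e1 : 2 * (m.+1%:R * (K * A) / (n%:R * dl)) = k1 * (A / n%:R).
  by rewrite /k1; field; rewrite !gt_eqF.
split.
  have An : A / n%:R <= 1 by rewrite ler_pdivrMr// mul1r (le_trans KA)// (le_trans KK').
  have An0 : 0 <= A / n%:R by rewrite divr_ge0// ltW.
  have q0 := sqrtr_ge0 (A / n%:R).
  have qE := sqr_sqrtr An0.
  apply: le_trans (skor (K * Num.sqrt (A / n%:R)) _) _.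
    move=> j jm; rewrite -(@ler_pXn2r _ 2) ?nnegrE ?mulr_ge0//; last lra.
    rewrite real_normK ?num_real// exprMn qE.
    rewrite mulrA ler_pdivlMr//; apply: le_trans (hsg j jm) _.
    by rewrite ler_wpM2r ?(ltW A0)//; nra.
  rewrite lee_fin ge_max e1; apply/andP; split.
    apply: (@le_trans _ _ (k1 * Num.sqrt (A / n%:R))).
      by rewrite ler_wpM2l// -{1}qE; nra.
    by rewrite ler_wpM2r// /K'; lra.
  by rewrite ler_wpM2r// /K'; lra.
move=> W hA hW; set N := Num.sqrt n%:R in hA hW.
have NE : N ^+ 2 = n%:R by rewrite sqr_sqrtr// ler0n.
have N0 : 0 < N by rewrite sqrtr_gt0.
have -> : Num.sqrt n%:R^-1 = N^-1 :> R by rewrite sqrtrV// ler0n.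
have W0 : 0 < W by move: (lt_le_trans A0 hA); rewrite pmulr_lgt0.
apply: le_trans (skor (k3 * (W / N)) _) _.
  move=> j jm.
  have nd : 1 <= n%:R * dl by apply: le_trans h2; nra.
  have G0 : 0 <= gamma * n%:R by rewrite mulr_ge0 ?ltW.
  have := step_height sd fi n0 (ltW A0) G0 nd jm hx hU (sgs j jm) (sgn j (ltnW jm)) (sgn j.+1 jm) (hW j jm).
  set y := `|_| => hy.
  have y0 : 0 <= y by rewrite /y.
  have l1 : n%:R * dl / 2 * y <= (n%:R * dl - 2 * (K * A)) * y.
    by rewrite ler_wpM2r//; lra.
  have l2 : 2 * M * m%:R + W * N + 2 * ((2 * M + 1) * (K * A + 1) + A) <= c3 * (W * N).
    have Mm : 0 <= M * m%:R by rewrite mulr_ge0//; lra.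
    have MK : 0 <= (2 * M + 1) by lra.
    have WN1 : 1 <= W * N := le_trans A1 hA.
    have q1 : 2 * M * m%:R <= 2 * M * m%:R * (W * N) by rewrite ler_peMr//; lra.
    have q2 : (2 * M + 1) * (K * A + 1) <= (2 * M + 1) * (K + 1) * (W * N).
      by rewrite -mulrA ler_wpM2l//; nra.
    rewrite /c3; lra.
  rewrite /k3 (_ : _ * (W / N) = c3 * (W * N) / (N ^+ 2 * dl / 2)); last first.
    by field; rewrite !gt_eqF.
  rewrite NE ler_pdivlMr; last by rewrite divr_gt0// mulr_gt0.
  by rewrite mulrC; lra.
have WN : 0 <= W / N by rewrite divr_ge0// ltW.
rewrite lee_fin ge_max e1; apply/andP; split; last by rewrite ler_wpM2r// /K'; lra.
apply: (@le_trans _ _ (k1 * (W / N))); last by rewrite ler_wpM2r// /K'; lra.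
rewrite ler_wpM2l// -NE ler_pdivrMr ?exprn_gt0//.
by rewrite (_ : W / N * N ^+ 2 = W * N)//; field; rewrite gt_eqF.
Qed.

End step_rates.

(** * Compactness of partitions and stability of the unique minimizer *)

Section compactness.
Context {R : realType}.
Local Notation mu := (@lebesgue_measure R).
Local Notation I01 := (`[0%R, 1%R[%classic : set R).
Implicit Types (f g : R -> R).

Lemma ultra_fmap (S T : Type) (a : S -> T) (F : set_system S) :
  UltraFilter F -> UltraFilter (a @ F).
Proof.
move=> FU; have FP := @ultra_proper _ _ FU; split; first exact: fmap_proper_filter.
move=> H HP FH; apply/seteqP; split=> // A HA.
have [//|hA] := @in_ultra_setVsetC _ F (a @^-1` A) FU.
have : H (A `&` ~` A) by apply: filterI => //; apply: FH.
by rewrite setICr => /(@filter_not_empty _ H).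
Qed.

Lemma ultra_cvg (S : Type) (F : set_system S) (a : S -> R) : UltraFilter F ->
  (forall x, 0 <= a x <= 1) -> exists2 l : R, 0 <= l <= 1 & a x @[x --> F] --> l.
Proof.
move=> FU ha; have := @segment_compact R 0 1; rewrite compact_ultra.
move=> /(_ (a @ F) (ultra_fmap a FU)) [].
  have FP := @ultra_proper _ _ FU.
  apply: (@filterS _ F _ setT); last exact: filterT.
  by move=> x _; rewrite /= in_itv/=; exact: ha.
by move=> l [/=]; rewrite in_itv/= => hl al; exists l.
Qed.

Lemma prim_cvg (S : Type) (F : set_system S) {FF : Filter F} (a : S -> R) (l : R) f :
  mu.-integrable I01 (EFin \o f) -> (forall x, 0 <= a x <= 1) -> 0 <= l <= 1 ->
  a x @[x --> F] --> l -> prim f (a x) @[x --> F] --> prim f l.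
Proof.
move=> fi ha hl al.
have c := prim_continuous fi; have := c (l : subspace `[0, 1]).
apply: cvg_comp; rewrite -nbhs_subspace_in; last by rewrite /= in_itv.
move=> A /= hA; have := al _ hA; rewrite /nbhs/=; apply: filterS => x; apply.
by rewrite /= in_itv /=.
Qed.

(* the inner product of the orthogonal projections of [f] and [g] on the
   constants of [a, b); division by zero makes it vanish when [a = b] *)
Definition proj_dot f g (a b : R) : R :=
  (prim f b - prim f a) * (prim g b - prim g a) / (b - a).

Definition itv_mean f (a b : R) : R := (prim f b - prim f a) / (b - a).

(** Nonnegativity of [quad] at the mean is the Cauchy-Schwarz inequality against constants; the
    product is then split by the arithmetic-geometric mean inequality. *)
Lemma proj_dot_le f g a b : in_L2 f -> in_L2 g -> 0 <= a <= b -> b <= 1 ->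
  `|proj_dot f g a b| <= (prim (fun x => f x ^+ 2) b - prim (fun x => f x ^+ 2) a) +
    (prim (fun x => g x ^+ 2) b - prim (fun x => g x ^+ 2) a).
Proof.
move=> f2 g2 ab b1; have /andP[a0] := ab; rewrite le_eqVlt => /orP[/eqP ->|lab].
  by rewrite /proj_dot !subrr !mul0r normr0 addr0.
have ba : 0 < b - a by rewrite subr_gt0.
have := quad_ge0 (itv_mean f a b) f2 ab b1; have := quad_ge0 (itv_mean g a b) g2 ab b1.
rewrite /quad /itv_mean /proj_dot; set df := prim f b - _; set dg := prim g b - _.
set Qf := prim (fun x => f x ^+ 2) b - _; set Qg := prim (fun x => g x ^+ 2) b - _.
have e d : d / (b - a) = d / (b - a) by [].
rewrite (_ : Qg - _ + _ = Qg - dg ^+ 2 / (b - a)); last by field; rewrite gt_eqF.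
rewrite (_ : Qf - _ + _ = Qf - df ^+ 2 / (b - a)); last by field; rewrite gt_eqF.
rewrite !subr_ge0 !ler_pdivrMr// normrM normfV [`|b - a|]gtr0_norm// ler_pdivrMr// => h1 h2.
have := sqr_ge0 (`|df| - `|dg|); rewrite normrM -(real_normK (num_real df)) -(real_normK (num_real dg)) in h1 h2 *.
set u := `|df| in h1 h2 *; set v := `|dg| in h1 h2 * => h3.
have := sqr_ge0 u; have := sqr_ge0 v; nra.
Qed.

(** If the interval collapses in the limit, the quotient is controlled by [proj_dot_le], whose right
    side tends to 0. *)
Lemma proj_dot_cvg (S : Type) (F : set_system S) {FF : Filter F} (a b : S -> R) (la lb : R) f g :
  in_L2 f -> in_L2 g -> (forall x, [/\ 0 <= a x, a x <= b x & b x <= 1]) ->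
  0 <= la -> la <= lb -> lb <= 1 -> a x @[x --> F] --> la -> b x @[x --> F] --> lb ->
  proj_dot f g (a x) (b x) @[x --> F] --> proj_dot f g la lb.
Proof.
move=> f2 g2 hab la0 lab lb1 al bl.
have ha x : 0 <= a x <= 1 by have [-> h1 h2] := hab x; rewrite (le_trans h1).
have hb x : 0 <= b x <= 1 by have [h0 h1 ->] := hab x; rewrite (le_trans h0).
have hla : 0 <= la <= 1 by rewrite la0 (le_trans lab).
have hlb : 0 <= lb <= 1 by rewrite lb1 (le_trans la0).
have pc h : mu.-integrable I01 (EFin \o h) ->
    (prim h (b x) - prim h (a x)) @[x --> F] --> prim h lb - prim h la.
  by move=> hi; apply: cvgB; apply: prim_cvg.
have [fi gi] := (in_L2_integrable f2, in_L2_integrable g2).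
move: lab; rewrite le_eqVlt => /orP[/eqP e|lab].
  subst lb.
  rewrite {2}/proj_dot !subrr !mul0r; apply: norm_cvg0.
  have := cvgD (pc _ (in_L2_sqr_integrable f2)) (pc _ (in_L2_sqr_integrable g2)).
  rewrite !subrr addr0 => h; apply: (squeeze_cvgr _ (cvg_cst 0) (h _)).
  apply: nearW => x; have [a0 abx b1] := hab x.
  by rewrite normr_ge0 proj_dot_le// a0.
apply: cvgM; first by apply: cvgM; exact: pc.
by apply: cvgV; [rewrite subr_eq0 gt_eqF|exact: cvgB].
Qed.

Lemma quad_split f a b c : a <= b -> quad f a b c =
  quad f a b (itv_mean f a b) + (b - a) * (c - itv_mean f a b) ^+ 2.
Proof.
rewrite le_eqVlt => /orP[/eqP ->|ab]; first by rewrite /quad !subrr !mul0r !mulr0 !addr0.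
by rewrite /quad /itv_mean; field; rewrite gt_eqF// subr_gt0.
Qed.

Lemma quad_itv_mean f g a b : a <= b -> quad g a b (itv_mean f a b) =
  (prim (fun x => g x ^+ 2) b - prim (fun x => g x ^+ 2) a)
    - 2 * proj_dot f g a b + proj_dot f f a b.
Proof.
rewrite le_eqVlt => /orP[/eqP ->|ab]; first by rewrite /quad /proj_dot !subrr !mul0r !mulr0 !addr0.
by rewrite /quad /itv_mean /proj_dot; field; rewrite gt_eqF// subr_gt0.
Qed.

Lemma quad_mean_cvg (S : Type) (F : set_system S) {FF : Filter F} (a b : S -> R) (la lb : R) f g :
  in_L2 f -> in_L2 g -> (forall x, [/\ 0 <= a x, a x <= b x & b x <= 1]) ->
  0 <= la -> la <= lb -> lb <= 1 -> a x @[x --> F] --> la -> b x @[x --> F] --> lb ->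
  quad g (a x) (b x) (itv_mean f (a x) (b x)) @[x --> F] -->
    quad g la lb (itv_mean f la lb).
Proof.
move=> f2 g2 hab la0 lab lb1 al bl.
rewrite quad_itv_mean//.
under eq_fun => x do rewrite (quad_itv_mean _ _ (let: And3 _ ab _ := hab x in ab)).
have hla : 0 <= la <= 1 by rewrite la0 (le_trans lab).
have hlb : 0 <= lb <= 1 by rewrite lb1 (le_trans la0).
have g2i := in_L2_sqr_integrable g2.
apply: cvgD; last exact: (proj_dot_cvg f2 f2 hab).
apply: cvgB; last by apply: cvgM; [exact: cvg_cst|exact: (proj_dot_cvg f2 g2 hab)].
apply: cvgB; apply: prim_cvg => //.
- by move=> x; have [h0 h1 ->] := hab x; rewrite (le_trans h0).
- by move=> x; have [-> h1 h2] := hab x; rewrite (le_trans h1).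
Qed.

Definition step_fun m (t alpha : nat -> R) x : R :=
  \sum_(j < m) alpha j * \1_(`[t j, t j.+1[) x.

Lemma step_fun_rep m (t alpha : nat -> R) : t 0%N = 0 -> t m = 1 ->
  (forall j, (j < m)%N -> t j <= t j.+1) -> step_rep m t alpha (step_fun m t alpha).
Proof.
move=> t0 tm inc; split=> // j x jm /andP[h1 h2].
rewrite /step_fun (bigD1 (Ordinal jm))//= big1 ?addr0 => [|i ne].
  by rewrite indicE mem_set ?mulr1//= in_itv/= h1.
rewrite indicE memNset ?mulr0//= in_itv/= => /andP[h3 h4].
have im := ltn_ord i; case: (ltngtP i j) => hij.
- by have := @wk_mono _ m t inc i.+1 j; rewrite hij ltnW// => /(_ isT); lra.
- by have := @wk_mono _ m t inc j.+1 i; rewrite hij ltnW// => /(_ isT); lra.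
- by move: ne => /eqP; apply; apply/val_inj.
Qed.

Lemma quad_step_eq0 m (t alpha : nat -> R) g : step_rep m t alpha g ->
  forall j, (j < m)%N -> quad g (t j) (t j.+1) (alpha j) = 0.
Proof.
move=> hr j jm; have [t0 tm inc hg] := hr; have wk := wk_mono inc.
have h0 : 0 <= t j by rewrite -{1}t0; apply: wk; exact: ltnW.
have h1 : t j.+1 <= 1 by rewrite -tm wk// jm leqnn.
have := integral_sqr_sub (f := g) (a := t j) (b := t j.+1) (alpha j) (in_L2_step hr).
rewrite h0 inc// => /(_ isT h1) e; apply/EFin_inj; rewrite -e.
apply: integral0_eq => x; rewrite /= in_itv/= => hx.
by rewrite (hg j)// subrr expr0n.
Qed.

(** Otherwise there are partitions with values tending to the minimum whose cell means of [f] stay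
    away from [g]. Along an ultrafilter finer than infinity the knots converge, possibly merging,
    and both functionals pass to the limit by [quad_mean_cvg]. The limit step function is a
    minimizer, so it is [fg] by uniqueness, and its distance to [g] is 0, a contradiction. *)
Lemma limit_minimizer_compact (gamma mst : R) f fg m (s h : nat -> R) J (e : R) :
  0 <= gamma -> in_L2 f -> unique_potts_limit_minimizer gamma f fg ->
  potts_limit gamma fg f = mst%:E -> step_rep m s h (S_version fg) ->
  eq_L2 (S_version fg) fg -> 0 < e ->
  exists2 dl : R, 0 < dl & forall t : nat -> R, t 0%N = 0 -> t J.+1 = 1 ->
    (forall j, (j <= J)%N -> t j <= t j.+1) ->
    \sum_(j < J.+1) quad f (t j) (t j.+1) (itv_mean f (t j) (t j.+1)) + gamma * J%:R < mst + dl ->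
    \sum_(j < J.+1) quad (S_version fg) (t j) (t j.+1) (itv_mean f (t j) (t j.+1)) < e.
Proof.
move=> gamma0 f2 [[fg2 fgmin] uniq] hmst hr eqg e0; set g := S_version fg.
have g2 : in_L2 g := in_L2_step hr.
apply: contrapT => hno.
have bad (k : nat) : exists t : nat -> R, [/\ t 0%N = 0, t J.+1 = 1,
    forall j, (j <= J)%N -> t j <= t j.+1,
    \sum_(j < J.+1) quad f (t j) (t j.+1) (itv_mean f (t j) (t j.+1)) + gamma * J%:R
      < mst + k.+1%:R^-1 &
    e <= \sum_(j < J.+1) quad g (t j) (t j.+1) (itv_mean f (t j) (t j.+1))].
  apply: contrapT => hk; apply: hno; exists k.+1%:R^-1 => // t t0 t1 inc hN.
  by rewrite ltNge; apply/negP => he; apply: hk; exists t.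
have [T hT] := boolp.choice bad.
have [G [GU oG]] := @ultraFilterLemma nat \oo _.
have GP := @ultra_proper _ _ GU.
have Tin k j : (j <= J.+1)%N -> 0 <= T k j <= 1.
  move=> jJ; have [t0 t1 inc _ _] := hT k.
  have wk := @wk_mono _ J.+1 (T k) inc.
  by rewrite -{1}t0 -t1 !wk ?leqnn ?andbT.
have lim (j : nat) : exists l : R, (j <= J.+1)%N -> 0 <= l <= 1 /\ T k j @[k --> G] --> l.
  have [jJ|] := leqP j J.+1; last by exists 0.
  by have [l l01 hl] := @ultra_cvg _ G (fun k => T k j) GU (fun k => Tin k j jJ); exists l.
have [l hl] := boolp.choice lim.
have l0 : l 0%N = 0.
  have [_ h0] := hl 0%N isT; apply: (cvg_unique _ h0); first exact: Rhausdorff.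
  have -> : T^~ 0%N = cst 0 by apply/funext => k; have [] := hT k.
  exact: cvg_cst.
have l1 : l J.+1 = 1.
  have [_ h0] := hl J.+1 (leqnn _); apply: (cvg_unique _ h0); first exact: Rhausdorff.
  have -> : T^~ J.+1 = cst 1 by apply/funext => k; have [] := hT k.
  exact: cvg_cst.
have linc j : (j <= J)%N -> l j <= l j.+1.
  move=> jJ; have [_ h1] := hl j (leqW jJ); have [_ h2] := hl j.+1 jJ.
  apply: (ler_cvg_to h1 h2); apply: nearW => k.
  by have [_ _ inc _ _] := hT k; exact: inc.
pose al j := itv_mean f (l j) (l j.+1).
have hr0 : step_rep J.+1 l al (step_fun J.+1 l al) by apply: step_fun_rep.
have lims (u : R -> R) : in_L2 u ->
    \sum_(j < J.+1) quad u (T k j) (T k j.+1) (itv_mean f (T k j) (T k j.+1)) @[k --> G] -->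
    \sum_(j < J.+1) quad u (l j) (l j.+1) (al j).
  move=> u2; apply: cvg_big => [|j _]; first exact: add_continuous.
  have jJ : (j <= J)%N := ltn_ord j.
  have [/andP[la _] h1] := hl j (leqW jJ); have [/andP[_ lb] h2] := hl j.+1 jJ.
  apply: quad_mean_cvg => //; last exact: linc.
  move=> k; have [_ _ inc _ _] := hT k.
  by have /andP[-> _] := Tin k j (leqW jJ); have /andP[_ ->] := Tin k j.+1 jJ; split=> //; exact: inc.
have hmin : \sum_(j < J.+1) quad f (l j) (l j.+1) (al j) <= mst - gamma * J%:R.
  have c : (mst - gamma * J%:R + k.+1%:R^-1) @[k --> G] --> mst - gamma * J%:R.
    apply: cvg_trans (_ : _ @[k --> \oo] --> _); first exact: cvg_app.
    rewrite -[X in _ --> X]addr0; apply: cvgD; first exact: cvg_cst.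
    exact: cvg_harmonic.
  apply: (ler_cvg_to (lims f f2) c); apply: nearW => k.
  by have [_ _ _ hN _] := hT k; move: hN; rewrite -ltrBrDr addrAC => /ltW.
have step0 : eq_L2 (step_fun J.+1 l al) fg.
  apply: uniq; split; first exact: in_L2_step hr0.
  move=> u u2; apply: le_trans (fgmin u u2); rewrite hmst.
  by apply: le_trans (potts_limit_step gamma0 f2 hr0) _; rewrite lee_fin /=; lra.
have geq x : 0 <= x < 1 -> step_fun J.+1 l al x = g x.
  apply: (eq_L2_step hr hr0).
  exact: ae_eq_trans step0 (ae_eq_sym eqg).
have hrg : step_rep J.+1 l al g.
  have [_ _ _ hs] := hr0; split=> // j x jJ hx; rewrite -(hs j x jJ hx) geq//.
  have /andP[h1 h2] := hx; have wk := @wk_mono _ J.+1 l linc.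
  rewrite (le_trans _ h1) ?(lt_le_trans h2)//; first by rewrite -l1 wk// jJ leqnn.
  by rewrite -{1}l0; apply: wk; exact: ltnW.
have z : \sum_(j < J.+1) quad g (l j) (l j.+1) (al j) = 0.
  by rewrite big1// => j _; rewrite (quad_step_eq0 hrg).
have := lims g g2; rewrite z => hz.
have : e <= 0; last by rewrite leNgt e0.
apply: (ler_cvg_to (cvg_cst e) hz); apply: nearW => k.
by have [] := hT k.
Qed.

End compactness.

(** * Discrete cost against continuous cost *)

Section discretization.
Context {R : realType}.
Local Notation mu := (@lebesgue_measure R).
Local Notation I01 := (`[0%R, 1%R[%classic : set R).
Implicit Types (f g : R -> R) (U V Y W h c : nat -> R) (n m : nat).

Lemma sum_blocks m (p : nat -> nat) (u : nat -> R) : p 0%N = 0%N ->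
  (forall j, (j < m)%N -> (p j <= p j.+1)%N) ->
  \sum_(0 <= i < p m) u i = \sum_(j < m) \sum_(p j <= i < p j.+1) u i.
Proof.
move=> p0; elim: m => [|m IH] inc; first by rewrite p0 big_geq// big_ord0.
rewrite big_ord_recr /= -IH => [|j jm]; last by apply: inc; exact: ltnW.
by rewrite -big_cat_nat// inc.
Qed.

Lemma sum_quad f n a b (c : R) : (a <= b)%N ->
  \sum_(a <= i < b) quad f (i%:R / n%:R) (i.+1%:R / n%:R) c = quad f (a%:R / n%:R) (b%:R / n%:R) c.
Proof.
move=> ab; pose u i := prim (fun x => f x ^+ 2) (i%:R / n%:R)
  - 2 * c * prim f (i%:R / n%:R) + c ^+ 2 * (i%:R / n%:R).
rewrite (eq_bigr (fun i => u i.+1 - u i)) => [|i _]; last by rewrite /quad /u; ring.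
by rewrite telescope_sumr// /quad /u; ring.
Qed.

(** [n] times the squared L^2 distance of [f] from its grid averages. *)
Definition fbar_gap f n : R :=
  n%:R * prim (fun x => f x ^+ 2) 1 - \sum_(0 <= i < n) fbar f n i ^+ 2.

Lemma sqr_fbar f n i (c : R) : (0 < n)%N -> (c - fbar f n i) ^+ 2 =
  n%:R * quad f (i%:R / n%:R) (i.+1%:R / n%:R) c -
  (n%:R * quad f (i%:R / n%:R) (i.+1%:R / n%:R) 0 - fbar f n i ^+ 2).
Proof.
move=> n0; rewrite /quad /fbar -[i.+1%:R]natr1; field.
by rewrite pnatr_eq0 -lt0n.
Qed.

(** The scaled continuous cost exceeds the discrete one by a quantity independent of the fitted
    signal, which cancels when two signals are compared. *)
Lemma cost_fbar f n m (p : nat -> nat) c W : (0 < n)%N -> p 0%N = 0%N -> p m = n ->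
  (forall j, (j < m)%N -> (p j <= p j.+1)%N) ->
  (forall j i, (j < m)%N -> (p j <= i < p j.+1)%N -> W i = c j) ->
  cost n (fbar f n) W =
    n%:R * \sum_(j < m) quad f ((p j)%:R / n%:R) ((p j.+1)%:R / n%:R) (c j) - fbar_gap f n.
Proof.
move=> n0 p0 pm inc hW; rewrite /cost (eq_bigr _ (fun i _ => sqr_fbar f i (W i) n0)) sumrB.
congr (_ - _); last first.
  rewrite sumrB -mulr_sumr sum_quad// /fbar_gap; congr (_ * _ - _).
  by rewrite /quad mul0r divff ?pnatr_eq0 -?lt0n// !prim0; ring.
rewrite -mulr_sumr; congr (_ * _); rewrite -{1}pm sum_blocks//.
apply: eq_bigr => j _; rewrite -sum_quad ?inc//.
by apply: eq_big_nat => i hi; rewrite (hW j).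
Qed.

(** With [W = fbar f n] the discrete cost vanishes, so the gap equals a continuous cost. *)
Lemma fbar_gap_ge0 f n : (0 < n)%N -> in_L2 f -> 0 <= fbar_gap f n.
Proof.
move=> n0 f2; have n0' : 0 < n%:R :> R by rewrite ltr0n.
have hc j i : (j < n)%N -> (j <= i < j.+1)%N -> fbar f n i = fbar f n j.
  by move=> _; rewrite ltnS => hi; have -> : i = j by apply/eqP; rewrite eqn_leq andbC.
have := @cost_fbar f n n id (fbar f n) (fbar f n) n0 erefl erefl (fun j _ => leqnSn j) hc.
rewrite {1}/cost big1 => [/esym/eqP|i _]; last by rewrite subrr expr0n.
rewrite subr_eq0 => /eqP <-; rewrite mulr_ge0//; apply: sumr_ge0 => j _.
apply: quad_ge0 => //; last by rewrite ler_pdivrMr// mul1r ler_nat.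
by rewrite divr_ge0//= ler_pM2r ?invr_gt0// ler_nat.
Qed.

Lemma grid_quad_cvg f m (s h : nat -> R) : in_L2 f -> cells m s ->
  \sum_(j < m) quad f ((grid n s j)%:R / n%:R) ((grid n s j.+1)%:R / n%:R) (h j)
    @[n --> \oo] --> \sum_(j < m) quad f (s j) (s j.+1) (h j).
Proof.
move=> f2 hs; have f2i := in_L2_sqr_integrable f2; have fi := in_L2_integrable f2.
pose t n j : R := if (0 < n)%N then (grid n s j)%:R / n%:R else 0.
have tin n j : (j <= m)%N -> 0 <= t n j <= 1.
  move=> jm; rewrite /t; case: ifP => [n0|_]; last by rewrite lexx ler01.
  have n0' : 0 < n%:R :> R by rewrite ltr0n.
  rewrite divr_ge0//= ler_pdivrMr// mul1r ler_nat.
  have /andP[_ h1] := grid_itv n0 hs jm; have /andP[_ s1] := cells_ge0 hs jm.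
  rewrite -ltnS -(ltr_nat R) -natr1 (lt_le_trans h1)// lerD2r.
  by rewrite -{2}[n%:R]mulr1 ler_wpM2l.
have tc j : (j <= m)%N -> t n j @[n --> \oo] --> s j.
  move=> jm; apply/cvgrPdist_le => e e0; near=> n.
  have n0 : (0 < n)%N by near: n; exact: nbhs_infty_gt.
  have n0' : 0 < n%:R :> R by rewrite ltr0n.
  rewrite /t n0; have /andP[h1 h2] := grid_itv n0 hs jm.
  have en : e^-1 <= n%:R by near: n; exact: nbhs_infty_ger.
  have {}en : 1 <= e * n%:R by rewrite -ler_pdivrMl// mulr1.
  rewrite -(ler_pM2r n0') -{2}(ger0_norm (ltW n0')) -normrM mulrBl divfK ?gt_eqF//.
  by apply/ler_normlP; split; lra.
have c : \sum_(j < m) quad f (t n j) (t n j.+1) (h j) @[n --> \oo] -->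
    \sum_(j < m) quad f (s j) (s j.+1) (h j).
  apply: cvg_big => [|j _]; first exact: add_continuous.
  have [j0 j1] : (j <= m)%N /\ (j.+1 <= m)%N by split=> //; exact: ltnW.
  have pc u : mu.-integrable I01 (EFin \o u) ->
      (prim u (t n j.+1) - prim u (t n j)) @[n --> \oo] --> prim u (s j.+1) - prim u (s j).
    move=> ui; apply: cvgB; apply: prim_cvg => //; try exact: tc; try exact: (cells_ge0 hs);
    by move=> n; exact: tin.
  apply: cvgD; last by apply: cvgM; [exact: cvg_cst|apply: cvgB; exact: tc].
  by apply: cvgB; [exact: pc|apply: cvgM; [exact: cvg_cst|exact: pc]].
apply: cvg_trans c; apply: near_eq_cvg; near=> n.
have n0 : (0 < n)%N by near: n; exact: nbhs_infty_gt.
by apply: eq_bigr => j _; rewrite /t n0.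
Unshelve. all: end_near. Qed.

(** The parallelogram law with the nonnegative term at [2 * d - c] dropped. *)
Lemma quad_parallelogram g (a b c d : R) : in_L2 g -> 0 <= a <= b -> b <= 1 ->
  quad g a b c <= 2 * quad g a b d + 2 * (b - a) * (c - d) ^+ 2.
Proof.
move=> g2 ab b1; have := quad_ge0 (2 * d - c) g2 ab b1.
by rewrite /quad; lra.
Qed.

Lemma cost_triangle n V U Y : cost n V U <= 2 * cost n Y U + 2 * cost n Y V.
Proof.
rewrite /cost !mulr_sumr -big_split; apply: ler_sum => i _ /=.
by have := sqr_ge0 ((U i - Y i) + (V i - Y i)); lra.
Qed.

(** A leading factor close to 1 is what the final jump count of [near_minimizer] requires. *)
Lemma cost_triangle_eps n V U Y (th : R) : 0 < th ->
  cost n Y V <= (1 + th) * cost n Y U + (1 + th^-1) * cost n V U.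
Proof.
move=> th0; rewrite /cost !mulr_sumr -big_split; apply: ler_sum => i _ /=.
set u := U i - Y i; set w := U i - V i; have -> : V i - Y i = u - w by rewrite /u /w; ring.
have : 0 <= th^-1 * (th * u + w) ^+ 2 by rewrite mulr_ge0 ?sqr_ge0// invr_ge0 ltW.
rewrite (_ : th^-1 * _ = th * u ^+ 2 + 2 * u * w + th^-1 * w ^+ 2); last by field; rewrite gt_eqF.
lra.
Qed.

(* With [u = ||U - f||^2], [v = ||V - f||^2], [w = ||U - V||^2] (all divided by
   n), the hypothesis is the basic inequality for the estimator [U]. *)
Lemma apriori (gamma gamma' ka u v w J jV m B : R) :
  u + gamma' * J <= v + gamma' * jV + w / 4 + 4 * ka * (J + jV + 1) ->
  w <= 2 * u + 2 * v -> v <= B -> 0 <= jV -> jV <= m - 1 -> 0 <= ka -> 16 * ka <= gamma ->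
  gamma <= 2 * gamma' -> gamma' <= 2 * gamma -> 0 <= u -> 0 <= J ->
  gamma * J <= 6 * B + 9 * gamma * m /\ u <= 3 * B + 5 * gamma * m.
Proof.
move=> h1 h2 vB jV0 jVm ka0 hka g1 g2 u0 J0.
have m1 : 0 <= m - 1 by lra.
have gm : 0 <= gamma * m by rewrite mulr_ge0; lra.
have e1 : gamma' * jV <= 2 * gamma * (m - 1).
  apply: (@le_trans _ _ (gamma' * (m - 1))); first by rewrite ler_wpM2l//; lra.
  by rewrite ler_wpM2r.
have e2 : 4 * ka * (jV + 1) <= gamma / 4 * m.
  by apply: ler_pM; lra.
have e3 : gamma / 4 * J <= (gamma' - 4 * ka) * J by rewrite ler_wpM2r//; lra.
have e4 : 0 <= gamma / 4 * J by rewrite mulr_ge0; lra.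
by split; lra.
Qed.

End discretization.

(** * From L^2 closeness to Skorokhod closeness *)

Section limit_case.
Context {R : realType}.
Local Notation mu := (@lebesgue_measure R).
Local Notation I01 := (`[0%R, 1%R[%classic : set R).
Implicit Types (f g F : R -> R) (U V Y h : nat -> R) (n m : nat).

(** [step_recovery] with windows of about [rho * n] indices: [rho] is small against [dl * e], so the
    time change is cheap, and [eps] is small against [rho * D^2] and [e^2 * dl], so each window
    contains a jump and heights are within [e]. *)
Lemma recovery_skorokhod g m (s h : nat -> R) (dl D M e : R) :
  step_data g m s h dl D M -> step_rep m s h g -> 0 < e ->
  exists2 eps, 0 < eps & exists2 N : R, 0 < N & forall n V U F, (0 < n)%N -> N <= n%:R ->
    (forall j i, (j < m)%N -> (grid n s j <= i < grid n s j.+1)%N -> V i = h j) ->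
    (jumps n U <= m.-1)%N -> cost n V U <= eps * n%:R -> grid_fun n F U ->
    (skorokhod (S_to_D F) (S_to_D g) <= e%:E)%E.
Proof.
move=> sd hr e0; have [[hs m0 d0 D0 M1] gap hD [hM hgM] hg] := sd.
have [s0 sm sinc] := hs.
have mR : 2 <= m.+1%:R :> R by rewrite ler_nat ltnS.
pose e' := Num.min e 1.
have [e'0 e'e e'1] : [/\ 0 < e', e' <= e & e' <= 1].
  by rewrite /e' lt_min e0 ltr01 !ge_min !lexx orbT.
pose rho := dl * e' / (8 * m.+1%:R).
have rho0 : 0 < rho by rewrite divr_gt0 ?mulr_gt0//; lra.
have rhoE : 8 * m.+1%:R * rho = dl * e' by rewrite /rho; field; rewrite lt0r_neq0//; lra.
have D20 : 0 < D ^+ 2 by rewrite exprn_gt0.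
have e20 : 0 < e ^+ 2 by rewrite exprn_gt0.
exists (Num.min (rho * D ^+ 2 / 2) (e ^+ 2 * dl / 4)).
  by rewrite lt_min !divr_gt0 ?mulr_gt0.
exists (24 * m.+1%:R / (e' * dl)); first by rewrite divr_gt0 ?mulr_gt0//; lra.
set eps := Num.min _ _ => n V U F n0.
have n0' : 0 < n%:R :> R by rewrite ltr0n.
have ed0 : 0 < e' * dl by rewrite mulr_gt0.
rewrite ler_pdivrMr// => Nn hV jU hc hF.
have [eps1 eps2] : eps <= rho * D ^+ 2 / 2 /\ eps <= e ^+ 2 * dl / 4.
  by rewrite /eps !ge_min !lexx orbT.
have nd0 : 0 < n%:R * dl by rewrite mulr_gt0.
have nd : 24 * m.+1%:R <= n%:R * dl.
  by apply: (le_trans Nn); rewrite [e' * _]mulrC mulrA ler_piMr// ltW.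
have rn0 : 0 <= rho * n%:R by rewrite mulr_ge0 ?ltW.
have /andP[r1 r2] := ceiln_itv rn0; pose r := (ceiln (rho * n%:R)).+1.
have [rl ru] : rho * n%:R + 1 <= r%:R /\ r%:R <= rho * n%:R + 2.
  by rewrite /r -[(ceiln _).+1%:R]natr1; split; lra.
have rhod : 16 * (rho * n%:R) <= n%:R * dl.
  have h1 : 16 * rho <= 8 * m.+1%:R * rho by rewrite ler_wpM2r ?(ltW rho0)//; lra.
  have h2 : dl * e' <= dl by rewrite ler_piMr// ltW.
  by rewrite mulrA mulrC ler_wpM2l ?(ltW n0')//; lra.
have nd2 : 0 <= n%:R * dl / 2 by lra.
have /andP[L1 L2] := ceiln_itv nd2; pose L := ceiln (n%:R * dl / 2); rewrite -/L in L1 L2.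
have r4L : (4 * r <= L)%N by rewrite -(ler_nat R) natrM; lra.
have ha j : (j < m)%N -> (grid n s j + L <= grid n s j.+1 <= n)%N.
  by move=> jm; apply: (grid_len n0 hs jm (gap j jm)); lra.
have hE : 2 * (eps * n%:R) < r%:R * D ^+ 2.
  apply: (@le_lt_trans _ _ (rho * n%:R * D ^+ 2)); last by rewrite ltr_pM2r//; lra.
  by have := ler_wpM2r (ltW n0') eps1; lra.
have [_ [sg [sg0 sgm sgn sgi hsg]]] := @step_recovery _ n m (grid n s) h L r D (eps * n%:R) U V
  m0 (grid0 n hs) (gridn n hs) (fun j jm => proj1 (andP (ha j jm))) hV (ltW D0) hD jU hc isT
  ltac:(by apply: leq_trans r4L; rewrite leq_mul2r orbT)
  hE.
have rr0 : 0 <= r%:R + 1 :> R by have := ler0n R r; lra.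
have mr : m.+1%:R * (r%:R + 1) <= n%:R * (dl * e') / 4.
  have : m.+1%:R * (r%:R + 1) <= m.+1%:R * (rho * n%:R + 3).
    by rewrite ler_wpM2l//; lra.
  have : 8 * m.+1%:R * rho * n%:R = dl * e' * n%:R by rewrite rhoE.
  lra.
have de : n%:R * (dl * e') <= n%:R * dl by rewrite ler_pM2l// ler_piMr// ltW.
have hr' : 2 * m.+1%:R * (r%:R + 1) <= n%:R * dl by lra.
apply: le_trans (skorokhod_grid (e := e) n0 hF hs d0 gap rr0 hr' sg0 sgm _ _ _) _.
- move=> j jm; have /andP[g1 g2] := sgn j jm; have /andP[g3 g4] := grid_itv n0 hs jm.
  have {}g1 : (sg j)%:R <= (grid n s j)%:R + r%:R :> R by rewrite -natrD ler_nat ltnW.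
  have {}g2 : (grid n s j)%:R <= (sg j)%:R + r%:R :> R by rewrite -natrD ler_nat ltnW.
  by apply/ler_normlP; split; lra.
- move=> j i t jm hi ht; have [hu hsq] := hsg j jm; rewrite (hu i hi) S_to_D_neq1; last first.
    apply: contraTneq ht => ->; rewrite negb_and -leNgt; apply/orP; right.
    by have /andP[] := cells_ge0 hs jm.
  rewrite (hg j)// -(@ler_pXn2r _ 2) ?nnegrE ?(ltW e0)// real_normK ?num_real//.
  have l1 : n%:R * dl / 4 <= (L - 2 * r)%:R.
    rewrite natrB; last by apply: leq_trans r4L; rewrite leq_mul2r orbT.
    have : (4 * r)%:R <= L%:R :> R by rewrite ler_nat.
    by rewrite !natrM; lra.
  have l2 : n%:R * dl / 4 * (U (sg j) - h j) ^+ 2 <= n%:R * dl / 4 * e ^+ 2.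
    apply: (@le_trans _ _ ((L - 2 * r)%:R * (U (sg j) - h j) ^+ 2)).
      by rewrite ler_wpM2r// sqr_ge0.
    by apply: (le_trans hsq); have := ler_wpM2r (ltW n0') eps2; lra.
  by move: l2; rewrite ler_pM2l//; lra.
- apply: (@S_to_D_cvg _ _ (h m.-1)); apply: (step_left_cvg hr); rewrite ?prednK// sm lexx andbT -sm -{2}(prednK m0).
  by apply: sinc; rewrite prednK.
rewrite lee_fin ge_max lexx andbT mulrA ler_pdivrMr//.
have : n%:R * (dl * e') <= n%:R * dl * e by rewrite mulrA ler_pM2l.
lra.
Qed.

End limit_case.

(** * Discrete minimizers are close to the limit minimizer *)

Section near_minimizer.
Context {R : realType}.
Local Notation mu := (@lebesgue_measure R).
Local Notation I01 := (`[0%R, 1%R[%classic : set R).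
Implicit Types (f g F : R -> R) (U V Y h : nat -> R) (n m : nat).

(** [V] samples the limit minimizer [g]. The basic inequality with factor 1/4 and [apriori] bounds
    the jumps and the cost of [U] independently of [n]; with a small factor [t] it then shows that
    the continuous Potts value of [U] exceeds the minimum by less than [w0]. That value splits into
    the part [Phi] of the cell means of [f] and the deviation [Psi] from them. [Phi] with its
    penalty cannot beat the minimum, so [Psi] is small, and compactness puts the cell means near
    [g]; hence [U] is near [V]. A surplus jump would cost about [gamma], while the costs of [U] and
    [V] almost agree. *)
Lemma near_minimizer (gamma : R) f fg m (s h : nat -> R) (eps : R) :
  0 < gamma -> in_L2 f -> unique_potts_limit_minimizer gamma f fg ->
  step_rep m s h (S_version fg) -> cells m s -> eq_L2 (S_version fg) fg ->
  potts_limit gamma fg f =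
    (gamma * m.-1%:R + \sum_(j < m) quad f (s j) (s j.+1) (h j))%:E -> 0 < eps ->
  exists2 K, 1 <= K & forall n (A gamma' : R) x U V, (0 < n)%N -> K <= n%:R -> 0 <= A ->
    K * A <= n%:R -> `|gamma' - gamma| * K <= 1 -> noise_bound A n x ->
    nat_minimizer n (gamma' * n%:R) (fun i => fbar f n i + x i) U ->
    (forall j i, (j < m)%N -> (grid n s j <= i < grid n s j.+1)%N -> V i = h j) ->
    (jumps n U <= m.-1)%N /\ cost n V U <= eps * n%:R.
Proof.
move=> gamma0 f2 hmin hr hs eqg hmst eps0; set g := S_version fg.
set N0 := \sum_(j < m) _ in hmst.
have g2 : in_L2 g := in_L2_step hr.
have m0 := step_rep_gt0 hr.
have mE : m%:R = m.-1%:R + 1 :> R by rewrite natr1 prednK.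
have m1 : 0 <= m.-1%:R :> R by [].
have N00 : 0 <= N0.
  apply: sumr_ge0 => j _; have [s0 sm sinc] := hs.
  have /andP[sj0 _] := cells_ge0 hs (ltnW (ltn_ord j)); have /andP[_ sj1] := cells_ge0 hs (ltn_ord j).
  by apply: quad_ge0 => //; rewrite sj0 ltW// sinc.
pose B := N0 + 1; pose b := (6 * B + 9 * gamma * m%:R) / gamma.
pose B1 := 3 * B + 5 * gamma * m%:R; pose B2 := 2 * B1 + 2 * B.
have gm : 0 < gamma * m%:R by rewrite mulr_gt0// ltr0n.
have b0 : 0 < b by rewrite divr_gt0// /B; lra.
have B10 : 0 < B1 by rewrite /B1 /B; lra.
have B20 : 0 < B2 by rewrite /B2 /B; lra.
pose th := gamma / (8 * (B1 + 1)).
have th0 : 0 < th by rewrite divr_gt0//; lra.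
have thB : th * B1 <= gamma / 8.
  have : th * (B1 + 1) = gamma / 8 by rewrite /th; field; rewrite gt_eqF//; lra.
  lra.
pose cc := 1 + th^-1; have cc0 : 0 < cc by rewrite addr_gt0// invr_gt0.
(* [10 * e1] will bound the squared distance of [U] and [V] per index; it must be below [eps] and,
   times [cc], below [gamma / 8]. *)
pose e1 := Num.min (eps / 10) (gamma / (80 * cc)).
have e10 : 0 < e1 by rewrite lt_min !divr_gt0 ?mulr_gt0.
have [e1a e1b] : e1 <= eps / 10 /\ e1 <= gamma / (80 * cc).
  by rewrite /e1 !ge_min !lexx orbT.
have {}e1b : cc * (10 * e1) <= gamma / 8.
  by move: e1b; rewrite ler_pdivlMr ?mulr_gt0//; lra.
(* Compactness gives one tolerance for each [J]. Only [J] up to [ceiln b] can occur, so a common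
   positive tolerance [d0] exists. *)
have [dlf hdl] := boolp.choice (fun J => let: ex_intro2 d d0 hd :=
  limit_minimizer_compact J (ltW gamma0) f2 hmin hmst hr eqg e10 in
  ex_intro (fun d => 0 < d /\ _) d (conj d0 hd)).
have [d0 d00 hd0] : exists2 d, 0 < d & forall j, (0 < j < (ceiln b).+2)%N -> d <= dlf j.-1.
  by apply: min_gap => j _; have [] := hdl j.-1.
pose w0 := Num.min d0 (Num.min e1 (gamma / 8)).
have w00 : 0 < w0 by rewrite lt_min d00 lt_min (e10 : 0 < e1) divr_gt0.
have [w0a w0b w0c] : [/\ w0 <= d0, w0 <= e1 & w0 <= gamma / 8].
  have minle (y z : R) : Num.min y z <= y /\ Num.min y z <= z by rewrite !ge_min !lexx orbT.
  have [i1 i2] := minle e1 (gamma / 8).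
  have [j1 j2] := minle d0 (Num.min e1 (gamma / 8)).
  by split=> //; [exact: le_trans j2 i1|exact: le_trans j2 i2].
pose t := w0 / (4 * B2); have t0 : 0 < t by rewrite divr_gt0// mulr_gt0.
have tB : t * B2 = w0 / 4 by rewrite /t; field; rewrite gt_eqF.
pose eta := Num.min (w0 / 4) 1.
have eta0 : 0 < eta by rewrite lt_min divr_gt0 ?ltr01.
have [eta1 eta2] : eta <= w0 / 4 /\ eta <= 1 by rewrite /eta !ge_min !lexx orbT.
pose c4 := (t^-1 + 1) * (b + m%:R).
have mR0 : 0 < m%:R :> R by rewrite ltr0n.
have ti0 : 0 < t^-1 by rewrite invr_gt0.
have c40 : 0 < c4 by rewrite mulr_gt0//; lra.
have [N1 hN1] : exists N1 : nat, forall n, (N1 <= n)%N ->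
    \sum_(j < m) quad f ((grid n s j)%:R / n%:R) ((grid n s j.+1)%:R / n%:R) (h j) <= N0 + eta.
  have := @cvgr_le _ _ \oo _ _ _ (grid_quad_cvg f2 hs (h := h)) (N0 + eta) ltac:(by rewrite ltrDl).
  by move=> [N1 _ hN1]; exists N1 => n nN; exact: hN1.
have [N2 hN2] : exists N2 : nat, forall n, (N2 <= n)%N ->
    \sum_(j < m) quad g ((grid n s j)%:R / n%:R) ((grid n s j.+1)%:R / n%:R) (h j) <= e1.
  have := @cvgr_le _ _ \oo _ _ _ (grid_quad_cvg g2 hs (h := h)) e1
    ltac:(by rewrite big1// => j _; exact: (quad_step_eq0 hr)).
  by move=> [N2 _ hN2]; exists N2 => n nN; exact: hN2.
pose K := 1 + 16 / gamma + 2 / gamma + 8 * c4 / w0 + N1%:R + N2%:R.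
have k1 : 0 < 16 / gamma by rewrite divr_gt0.
have k2 : 0 < 2 / gamma by rewrite divr_gt0.
have k3 : 0 < 8 * c4 / w0 by rewrite divr_gt0// mulr_gt0.
have k4 : 0 <= N1%:R :> R by [].
have k5 : 0 <= N2%:R :> R by [].
exists K; first by rewrite /K; lra.
move=> n A gamma' x U V n0 Kn A0 KA gK hx hU hV.
have n0' : 0 < n%:R :> R by rewrite ltr0n.
have nN1 : (N1 <= n)%N by rewrite -(ler_nat R); apply: le_trans Kn; rewrite /K; lra.
have nN2 : (N2 <= n)%N by rewrite -(ler_nat R); apply: le_trans Kn; rewrite /K; lra.
pose ka := A / n%:R; have ka0 : 0 <= ka by rewrite divr_ge0// ltW.
have leK k (y : R) : 0 <= y -> y * K <= 1 -> k <= K -> y * k <= 1.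
  by move=> y0 yK kK; apply: le_trans yK; rewrite ler_wpM2l.
have kaK : ka * K <= 1 by rewrite /ka mulrAC ler_pdivrMr// mul1r mulrC.
have ka1 : 16 * ka <= gamma.
  have := leK (16 / gamma) ka ka0 kaK ltac:(by rewrite /K; lra).
  by rewrite mulrA ler_pdivrMr// mul1r mulrC.
have ka2 : ka * c4 <= w0 / 8.
  have := leK (8 * c4 / w0) ka ka0 kaK ltac:(by rewrite /K; lra).
  by rewrite mulrA ler_pdivrMr// mul1r; lra.
have gg0 : 0 <= `|gamma' - gamma| by [].
have ga1 : 2 * `|gamma' - gamma| <= gamma.
  have := leK (2 / gamma) _ gg0 gK ltac:(by rewrite /K; lra).
  by rewrite mulrA ler_pdivrMr// mul1r mulrC.
have ga2 : `|gamma' - gamma| * c4 <= w0 / 8.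
  have := leK (8 * c4 / w0) _ gg0 gK ltac:(by rewrite /K; lra).
  by rewrite mulrA ler_pdivrMr// mul1r; lra.
have [ga3 ga4] : gamma' - gamma <= `|gamma' - gamma| /\ gamma - gamma' <= `|gamma' - gamma|.
  by rewrite ler_norm distrC ler_norm.
have [gl gr] : gamma <= 2 * gamma' /\ gamma' <= 2 * gamma.
  by clear - ga1 ga3 ga4 gamma0; lra.
have g'0 : 0 <= gamma' by clear - gl gamma0; lra.
have bm0 : 0 <= b + m%:R by clear - b0 mR0; lra.
have jgR : (jumps n V)%:R <= m%:R - 1 :> R.
  by rewrite mE addrK ler_nat; exact: jumps_cells (grid0 n hs) (fun i => grid_cell n0 hs (i := i)) hV.
set jV := (jumps n V)%:R in jgR; have jV0 : 0 <= jV := ler0n R _.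
pose J := jumps n U; have J0 : 0 <= J%:R :> R by [].
pose q := fbar_gap f n / n%:R; have q0 : 0 <= q by rewrite divr_ge0 ?fbar_gap_ge0// ltW.
have gridle j : (j < m)%N -> (grid n s j <= grid n s j.+1)%N.
  move=> jm; rewrite -ltnS -(ltr_nat R) -natr1.
  have /andP[_ i1] := grid_itv n0 hs (ltnW jm); have /andP[i2 _] := grid_itv n0 hs jm.
  rewrite (lt_le_trans i1)// lerD2r (le_trans _ i2)// ler_wpM2l// ltW//.
  by case: hs => _ _; apply.
pose SV := \sum_(j < m) quad f ((grid n s j)%:R / n%:R) ((grid n s j.+1)%:R / n%:R) (h j).
have costV : cost n (fbar f n) V = n%:R * (SV - q).
  rewrite (cost_fbar f n0 (grid0 n hs) (gridn n hs) gridle hV) /q -/SV; field.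
  by rewrite gt_eqF.
have SVle : SV <= N0 + eta := hN1 n nN1.
have [p [p0 pn pinc hp]] := block_partition U n0; rewrite -/J in pn pinc hp.
have pinc' j : (j < J.+1)%N -> (p j <= p j.+1)%N by move=> jJ; rewrite ltnW// pinc.
pose tau j : R := (p j)%:R / n%:R.
have tau0 : tau 0%N = 0 by rewrite /tau p0 mul0r.
have tau1 : tau J.+1 = 1 by rewrite /tau pn divff// gt_eqF.
have tinc j : (j <= J)%N -> tau j <= tau j.+1.
  by move=> jJ; rewrite /tau ler_pM2r ?invr_gt0// ler_nat ltnW// pinc.
pose SU := \sum_(j < J.+1) quad f (tau j) (tau j.+1) (U (p j)).
have costU : cost n (fbar f n) U = n%:R * (SU - q).
  rewrite (cost_fbar f n0 p0 pn pinc' hp) /q -/SU; field.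
  by rewrite gt_eqF.
pose w := cost n V U / n%:R; have costW : cost n V U = n%:R * w by rewrite /w mulrC divfK// gt_eqF.
have u0 : 0 <= SU - q.
  by rewrite -(pmulr_rge0 _ n0') -costU; apply: sumr_ge0 => i _; exact: sqr_ge0.
have hw : w <= 2 * (SU - q) + 2 * (SV - q).
  rewrite -(ler_pM2l n0') -costW; apply: le_trans (cost_triangle _ _ _ (fbar f n)) _.
  by rewrite costU costV; clear; lra.
have hx' : noise_bound A n (fun i => fbar f n i + x i - fbar f n i).
  by move=> a' b' hab; have := hx a' b' hab; congr (_ <= _); congr (_ ^+ 2);
    apply: eq_bigr => i _; rewrite addrAC subrr add0r.
have basic y : 0 < y -> (SU - q) + gamma' * J%:R <=
    (SV - q) + gamma' * jV + y * w + ka / y * (J%:R + jV + 1).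
  move=> y0; have := potts_basic V A0 y0 hx' hU; rewrite -[(_ + _).+1%:R]natr1 natrD.
  rewrite costU costV costW -/jV -/J => hb.
  have e : A / y * (J%:R + jV + 1) = n%:R * (ka / y * (J%:R + jV + 1)).
    by rewrite /ka; field; rewrite !gt_eqF.
  by rewrite e in hb; rewrite -(ler_pM2l n0'); clear - hb; lra.
have [gJ uB] : gamma * J%:R <= 6 * B + 9 * gamma * m%:R /\ SU - q <= 3 * B + 5 * gamma * m%:R.
  apply: (@apriori R gamma gamma' ka (SU - q) (SV - q) w J%:R jV m%:R B) => //.
    have := basic 4^-1 ltac:(by rewrite invr_gt0); rewrite invrK => i1; clear - i1; lra.
  by rewrite /B; clear - SVle eta2 q0; lra.
have {}gJ : J%:R <= b by rewrite /b ler_pdivlMr// mulrC.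
have wB : w <= B2 by rewrite /B2 /B1 /B; rewrite /B in uB; clear - hw uB SVle eta2 q0; lra.
have noisy : ka / t * (J%:R + jV + 1) <= ka / t * (b + m%:R).
  have kt : 0 <= ka / t by apply: divr_ge0 => //; exact: ltW.
  by apply: ler_wpM2l => //; clear - gJ jgR; lra.
have twB : t * w <= w0 / 4 by rewrite -tB ler_pM2l.
have bt := basic t t0.
have gV : gamma' * jV <= gamma' * (m%:R - 1) by rewrite ler_wpM2l.
have total : SU + gamma * J%:R < (gamma * m.-1%:R + N0) + w0.
  have i1 : gamma * J%:R <= gamma' * J%:R + `|gamma' - gamma| * b.
    have : (gamma - gamma') * J%:R <= `|gamma' - gamma| * b by apply: (@le_trans _ _ (`|gamma' - gamma| * J%:R)); [rewrite ler_wpM2r|rewrite ler_wpM2l].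
    by clear; lra.
  have i2 : gamma' * (m%:R - 1) <= gamma * (m%:R - 1) + `|gamma' - gamma| * m%:R.
    have : (gamma' - gamma) * (m%:R - 1) <= `|gamma' - gamma| * m%:R.
      by apply: (@le_trans _ _ (`|gamma' - gamma| * (m%:R - 1))); [rewrite ler_wpM2r//; clear - jV0 jgR; lra|rewrite ler_wpM2l//; clear; lra].
    by clear; lra.
  have i3 : ka / t * (b + m%:R) <= w0 / 8.
    have : ka / t * (b + m%:R) + ka * (b + m%:R) = ka * c4 by rewrite /c4; ring.
    have : 0 <= ka * (b + m%:R) by rewrite mulr_ge0.
    by clear - ka2; lra.
  have i4 : `|gamma' - gamma| * (b + m%:R) <= w0 / 8.
    have : `|gamma' - gamma| / t * (b + m%:R) + `|gamma' - gamma| * (b + m%:R) =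
      `|gamma' - gamma| * c4 by rewrite /c4; ring.
    have : 0 <= `|gamma' - gamma| / t * (b + m%:R) by apply: mulr_ge0 => //; apply: divr_ge0 => //; exact: ltW.
    by clear - ga2; lra.
  have -> : m.-1%:R = m%:R - 1 :> R by rewrite mE addrK.
  clear - bt gV twB noisy SVle eta1 i1 i2 i3 i4 w00; lra.
pose Phi := \sum_(j < J.+1) quad f (tau j) (tau j.+1) (itv_mean f (tau j) (tau j.+1)).
pose Psi := \sum_(j < J.+1) (tau j.+1 - tau j) * (U (p j) - itv_mean f (tau j) (tau j.+1)) ^+ 2.
have SUE : SU = Phi + Psi.
  rewrite /SU /Phi /Psi -big_split; apply: eq_bigr => j _; apply: quad_split.
  exact: tinc (ltn_ord j).
have Psi0 : 0 <= Psi.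
  by apply: sumr_ge0 => j _; rewrite mulr_ge0 ?sqr_ge0// subr_ge0; exact: tinc (ltn_ord j).
have PhiE : gamma * m.-1%:R + N0 <= Phi + gamma * J%:R.
  have hr0 := step_fun_rep (fun j => itv_mean f (tau j) (tau j.+1)) tau0 tau1 tinc.
  rewrite -lee_fin -hmst; have [[_ hm] _] := hmin.
  apply: (le_trans (hm _ (in_L2_step hr0))).
  by have := potts_limit_step (ltW gamma0) f2 hr0; rewrite addrC.
have PsiE : Psi <= e1 by clear - total SUE PhiE w0b; lra.
have Jb : (0 < J.+1 < (ceiln b).+2)%N.
  rewrite /= !ltnS -(ler_nat R); have /andP[i1 _] := ceiln_itv (ltW b0).
  exact: le_trans i1.
have := hd0 J.+1 Jb; rewrite /= => dJ.
have [_ hJ] := hdl J; have {}hJ := hJ tau tau0 tau1 tinc.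
have gPhi : \sum_(j < J.+1) quad g (tau j) (tau j.+1) (itv_mean f (tau j) (tau j.+1)) < e1.
  by apply: hJ; rewrite -/Phi; clear - total SUE Psi0 dJ w0a; lra.
have gU : \sum_(j < J.+1) quad g (tau j) (tau j.+1) (U (p j)) <= 4 * e1.
  apply: (@le_trans _ _ (2 * \sum_(j < J.+1) quad g (tau j) (tau j.+1) (itv_mean f (tau j) (tau j.+1))
     + 2 * Psi)); last by clear - gPhi PsiE; lra.
  rewrite /Psi !mulr_sumr -big_split; apply: ler_sum => j _ /=; rewrite mulrA.
  have wk := @wk_mono _ J.+1 tau tinc; have jJ := ltn_ord j.
  apply: quad_parallelogram => //.
    by rewrite tinc ?andbT// -{1}tau0; apply: wk; exact: ltnW.
  by rewrite -tau1; apply: wk; rewrite jJ leqnn.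
have gap0 : 0 <= fbar_gap g n := fbar_gap_ge0 n0 g2.
have wE : cost n V U <= 10 * e1 * n%:R.
  apply: le_trans (cost_triangle _ _ _ (fbar g n)) _.
  rewrite (cost_fbar g n0 p0 pn pinc' hp) (cost_fbar g n0 (grid0 n hs) (gridn n hs) gridle hV).
  have i1 := ler_wpM2l (ltW n0') gU; have i2 := ler_wpM2l (ltW n0') (hN2 n nN2).
  by clear - i1 i2 gap0; lra.
have wE' : w <= 10 * e1 by rewrite /w ler_pdivrMr.
split; last first.
  by apply: (le_trans wE); rewrite ler_wpM2r ?(ltW n0')//; clear - e1a; lra.
(* Suppose [J >= m]. Then [U] pays at least one penalty more than [V] may, which the almost equal
   costs cannot compensate. *)
rewrite leqNgt; apply/negP => hJm.
have JmR : m%:R <= J%:R :> R by rewrite ler_nat -(prednK m0).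
have vle : SV - q <= (1 + th) * (SU - q) + cc * w.
  have := cost_triangle_eps n V U (fbar f n) th0; rewrite costU costV costW => i1.
  by rewrite -(ler_pM2l n0') /cc; clear - i1; lra.
have i1 : th * (SU - q) <= th * B1 by rewrite ler_wpM2l// ltW.
have i2 : cc * w <= cc * (10 * e1) by rewrite ler_wpM2l// ltW.
have i3 : gamma' * m%:R <= gamma' * J%:R.
  by rewrite ler_wpM2l.
have i4 : ka / t * (b + m%:R) <= w0 / 8.
  have : ka / t * (b + m%:R) + ka * (b + m%:R) = ka * c4 by rewrite /c4; ring.
  have : 0 <= ka * (b + m%:R) by rewrite mulr_ge0.
  by clear - ka2; lra.
clear - vle i1 i2 i3 i4 thB e1b bt gV twB noisy w0c ga1 ga4 gamma0; lra.
Qed.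

End near_minimizer.

(** * Deterministic limit theorem and uniform convergence *)

Section deterministic_limits.
Context {R : realType}.
Local Notation mu := (@lebesgue_measure R).
Local Notation I01 := (`[0%R, 1%R[%classic : set R).
Implicit Types (f g F : R -> R) (U V Y h : nat -> R) (n m : nat).

(** [near_minimizer] feeds [recovery_skorokhod]; the minimum is finite since the zero function has a
    finite value. *)
Theorem limit_deterministic (gamma : R) f fg (e : R) : 0 < gamma -> in_L2 f ->
  unique_potts_limit_minimizer gamma f fg -> 0 < e ->
  exists2 K, 1 <= K & forall n (A gamma' : R) x F U, (0 < n)%N -> K <= n%:R -> 0 <= A ->
    K * A <= n%:R -> `|gamma' - gamma| * K <= 1 -> noise_bound A n x ->
    nat_minimizer n (gamma' * n%:R) (fun i => fbar f n i + x i) U -> grid_fun n F U ->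
    (skorokhod (S_to_D F) (S_to_D (S_version fg)) <= e%:E)%E.
Proof.
move=> gamma0 f2 hmin e0; have [[fg2 fgmin] _] := hmin.
have fin : (potts_limit gamma fg f < +oo)%E.
  have hr0 : step_rep 1 (fun j => j%:R) (fun=> 0) (step_fun 1 (fun j => j%:R) (fun=> (0 : R))).
    by apply: step_fun_rep => // j _; rewrite ler_nat.
  apply: (le_lt_trans (fgmin _ (in_L2_step hr0))).
  by apply: (le_lt_trans (potts_limit_step (ltW gamma0) f2 hr0)); rewrite ltry.
have [m [s [h [hred eqg hmst]]]] := potts_limit_rep f2 fg2 fin.
have [dl [D [M sd]]] := reduced_step_data hred.
have [hr inc _] := hred; have hs : cells m s by case: hr.
have [eps eps0 [N N0 hrec]] := recovery_skorokhod sd hr e0.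
have [K K1 hK] := near_minimizer gamma0 f2 hmin hr hs eqg hmst eps0.
exists (K + N); first by lra.
move=> n A gamma' x F U n0 Kn A0 KA gK hx hU hF.
have gridle j : (j < m)%N -> (grid n s j <= grid n s j.+1)%N.
  move=> jm; rewrite -ltnS -(ltr_nat R) -natr1.
  have /andP[_ i1] := grid_itv n0 hs (ltnW jm); have /andP[i2 _] := grid_itv n0 hs jm.
  by rewrite (lt_le_trans i1)// lerD2r (le_trans _ i2)// ler_wpM2l// ltW// inc.
have [V hV] := cell_values h gridle.
have [] := hK n A gamma' x U V n0 _ A0 _ _ hx hU hV.
- by lra.
- by apply: le_trans KA; rewrite ler_wpM2r//; lra.
- by apply: le_trans gK; rewrite ler_wpM2l//; lra.
by move=> jU hc; apply: (hrec n V U F) => //; lra.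
Qed.

(** Points at distance at most [dl / 2] lie in one cell or in two adjacent ones, and left continuity
    bounds the change across a cell up to its right knot. *)
Lemma unif_continuous f (e : R) : in_D f -> {within `[0, 1], continuous f} -> 0 < e ->
  exists2 d, 0 < d & forall x y, 0 <= x <= 1 -> 0 <= y <= 1 -> `|x - y| <= d ->
    `|f x - f y| <= e.
Proof.
move=> fD fc e0; have e40 : 0 < e / 4 by rewrite divr_gt0.
have [m [s [hs hc]]] := cadlag_cells fD e40.
have [dl d0 gap] := cells_gap hs; have [s0 sm inc] := hs.
have [_ _ f1] := fD.
have left j : (j < m)%N -> `|f (s j.+1) - f (s j)| <= e / 2.
  move=> jm; have cl : f x @[x --> (s j.+1)^'-] --> f (s j.+1).
    have [jm'|] := ltnP j.+1 m; last first.
      by move=> mj; have -> : j.+1 = m by [apply/eqP; rewrite eqn_leq jm]; rewrite sm.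
    have [ci _ _] := (@continuous_within_itvP R R R 0 1 f ltr01).1 fc.
    apply: cvg_at_left_filter; apply: ci; rewrite in_itv /=.
    have /andP[sj0 _] := cells_ge0 hs (ltnW jm); have /andP[_ sj1] := cells_ge0 hs jm'.
    by rewrite (le_lt_trans sj0 (inc _ jm)) (lt_le_trans (inc _ jm') sj1).
  have /cvgrPdist_le /(_ _ e40) hcl := cl.
  near (s j.+1)^'- => x.
  have h1 : `|f (s j.+1) - f x| <= e / 4 by near: x; exact: hcl.
  have h2 : `|f x - f (s j)| <= e / 4.
    apply: hc => //; apply/andP; split; last by near: x; exact: nbhs_left_lt.
    by near: x; apply: nbhs_left_ge; exact: inc.
  by have := ler_distD (f x) (f (s j.+1)) (f (s j)); lra.
exists (dl / 2); first by rewrite divr_gt0.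
move=> x y; wlog xy : x y / x <= y.
  move=> H hx hy hd; case/orP: (le_total x y) => xy; first exact: H.
  by rewrite distrC; apply: H => //; rewrite distrC.
move=> /andP[x0 x1] /andP[y0 y1]; rewrite distrC ger0_norm ?subr_ge0// => hd.
have [x1'|] := ltP x 1; last first.
  by move=> h1; have -> : x = y by [lra]; rewrite subrr normr0 ltW.
have [j jm hj] := cell_of hs (x := x) ltac:(by rewrite x0).
have hx := hc j x jm hj; have /andP[j1 j2] := hj.
have [yj|yj] := ltP y (s j.+1).
  have hy := hc j y jm ltac:(by rewrite yj andbT (le_trans j1)).
  by rewrite distrC; have := ler_distD (f (s j)) (f y) (f x); rewrite [`|f (s j) - f x|]distrC; lra.
have hl := left j jm.
have hy : `|f y - f (s j.+1)| <= e / 4.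
  have [jm'|mj] := ltnP j.+1 m.
    apply: hc => //; rewrite yj /=; have := gap j.+1 jm'; lra.
  have ej : j.+1 = m by apply/eqP; rewrite eqn_leq jm.
  have -> : y = s j.+1 by rewrite ej sm in yj *; lra.
  by rewrite subrr normr0 ltW.
rewrite distrC; have := ler_distD (f (s j.+1)) (f y) (f x).
have := ler_distD (f (s j)) (f (s j.+1)) (f x); rewrite [`|f (s j) - f x|]distrC; lra.
Unshelve. all: end_near. Qed.

(** The point 1 is a null set, so a bound on [[0, 1)] suffices. *)
Lemma Linfnorm_le g (e : R) : 0 <= e -> (forall x, 0 <= x < 1 -> `|g x| <= e) ->
  (0 <= Linfnorm g <= e%:E)%E.
Proof.
move=> e0 hg; rewrite /Linfnorm unlock; case: ifPn => [m0|_]; last by rewrite lexx lee_fin.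
apply/andP; split.
  by apply: ess_sup_gee => //; apply: aeW => x; rewrite /= lee_fin.
apply/ess_supP.
exists [set 1]; split=> //; first exact: lebesgue_measure_set1.
move=> x /=; rewrite patchE; case: ifPn => [|_]; last by rewrite lee_fin normr0.
rewrite inE /= in_itv /= lee_fin => /andP[x0 x1] hx; apply: contrapT => /eqP x1'.
by apply: hx; apply: hg; rewrite x0 lt_neqAle x1'.
Qed.

(** Skorokhod closeness compares [F x] with [f t] at a nearby [t]; uniform continuity replaces [t]
    by [x]. *)
Lemma skorokhod_unif f (e : R) : in_D f -> {within `[0, 1], continuous f} -> 0 < e ->
  exists2 eta : R, 0 < eta & forall F, (skorokhod (S_to_D F) f < eta%:E)%E ->
    (0 <= Linfnorm (F \- f)%R <= e%:E)%E.
Proof.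
move=> fD fc e0; have e20 : 0 < e / 2 by rewrite divr_gt0.
have [d d0 hd] := unif_continuous fD fc e20.
pose eta := Num.min (1 / 2) (Num.min (d / 2) (e / 2)).
have [h1 h2 h3] : [/\ eta <= 1 / 2, eta <= d / 2 & eta <= e / 2].
  by split; rewrite /eta !ge_min ?lexx ?orbT//= ?lexx ?orbT.
have h0 : 0 < eta by rewrite !lt_min !divr_gt0.
exists eta => // F hF; apply: Linfnorm_le; first exact: ltW.
move=> x /andP[x0 x1].
have x01 : 0 <= x <= 1 by rewrite x0 ltW.
have eta01 : 0 < eta <= 1 / 2 by rewrite h0.
have [t [t01 xt hx]] := skorokhod_lt_dist eta01 hF x01.
rewrite S_to_D_neq1 ?lt_eqF// in hx.
have := hd x t x01 t01 ltac:(lra).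
have := ler_distD (f t) (F x) (f x); rewrite [`|f t - f x|]distrC /=; lra.
Qed.

End deterministic_limits.

(** * Asymptotic comparisons and crude bounds for small n *)

Section analytic_tools.
Context {R : realType}.
Implicit Types (f F G : R -> R) (u : nat -> \bar R).

Lemma skorokhod_ge0 f F : (0 <= skorokhod f F)%E.
Proof.
apply: le_ereal_inf_tmp => _ [lam _ <-]; rewrite le_max; apply/orP; left.
apply: (@le_trans _ _ `|ln ((lam 1 - lam 0) / (1 - 0))|%:E); first by rewrite lee_fin.
by apply: ereal_sup_ubound; exists (1, 0) => //=; rewrite !lexx !ler01; split=> //; apply/eqP; rewrite oner_eq0.
Qed.

Lemma ereal_cvg0 u : (forall n, (0 <= u n)%E) ->
  (forall e : R, 0 < e -> exists N, forall n, (N <= n)%N -> (u n <= e%:E)%E) ->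
  u n @[n --> \oo] --> 0%E.
Proof.
move=> u0 h; apply/fine_cvgP; split.
  have [N hN] := h 1 ltr01; near=> n; rewrite ge0_fin_numE//.
  apply: (@le_lt_trans _ _ 1%:E); last exact: ltry.
  by apply: hN; near: n; exact: nbhs_infty_ge.
apply/cvgr0Pnorm_le => e e0; have [N hN] := h e e0; near=> n.
have h1 : (u n <= e%:E)%E by apply: hN; near: n; exact: nbhs_infty_ge.
rewrite /= ger0_norm ?fine_ge0//; move: h1 (u0 n); case: (u n) => [r| |]//=.
Unshelve. all: end_near. Qed.

Lemma ln_le_sqrt n : (0 < n)%N -> ln n%:R <= 2 * Num.sqrt n%:R :> R.
Proof.
move=> n0; have s0 : 0 < Num.sqrt n%:R :> R by rewrite sqrtr_gt0 ltr0n.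
rewrite -{1}(@sqr_sqrtr _ n%:R)// lnXn// -[ln _ *+ 2]mulr_natl ler_pM2l//.
have := @ln_sublinear R (Num.sqrt n%:R); lra.
Qed.

Lemma eventually_log (C K : R) : 0 <= C -> 0 <= K -> exists N, forall n, (N <= n)%N ->
  [/\ (0 < n)%N, 1 <= ln n%:R :> R & K * (C * ln n%:R + 1) <= n%:R].
Proof.
(* The square makes sqrt n dominate [K * (2 * C + 1)], and [expR 1] gives [1 <= ln n]. *)
move=> C0 K0; pose x := (1 + K * (2 * C + 1)) ^+ 2 + expR 1; exists (Num.truncn x).+1 => n nx.
have {}nx : x <= n%:R by apply: (le_trans (ltW (truncnS_gt _))); rewrite ler_nat.
have x1 : 0 < expR 1 :> R by exact: expR_gt0.
have q0 := sqr_ge0 (1 + K * (2 * C + 1)).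
have n0' : 0 < n%:R :> R by apply: lt_le_trans nx; rewrite /x; lra.
have n0 : (0 < n)%N by rewrite -(ltr_nat R).
split=> //.
  by rewrite -[leLHS]expRK ler_ln ?posrE//; apply: le_trans nx; rewrite /x; lra.
have s0 : 0 < Num.sqrt n%:R :> R by rewrite sqrtr_gt0.
have c0 : 0 <= K * (2 * C + 1) by rewrite mulr_ge0//; lra.
have sq : Num.sqrt n%:R ^+ 2 = n%:R :> R by rewrite sqr_sqrtr// ltW.
have hs : 1 + K * (2 * C + 1) <= Num.sqrt n%:R.
  rewrite -(@ler_pXn2r _ 2) ?nnegrE ?(ltW s0)//; last by lra.
  by rewrite sq; apply: le_trans nx; rewrite /x; lra.
apply: (@le_trans _ _ (K * (2 * C + 1) * Num.sqrt n%:R)).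
  rewrite -mulrA ler_wpM2l//; have := ler_wpM2l C0 (ln_le_sqrt n0); lra.
by rewrite -[leRHS]sq expr2 ler_wpM2r ?(ltW s0)//; lra.
Qed.

Lemma eventually_rate (gam : nat -> R) (C K : R) : 0 <= C -> 0 <= K ->
  gam n @[n --> \oo] --> (0 : R) -> gam n * n%:R / ln n%:R @[n --> \oo] --> +oo ->
  exists N, forall n, (N <= n)%N ->
    K * (C * ln n%:R + 1) <= gam n * n%:R /\ gam n * K <= 1.
Proof.
move=> C0 K0 g0 ginf; have [N1 h1] := eventually_log C0 K0.
have K1 : 0 < (K + 1)^-1 by rewrite invr_gt0; lra.
have [N2 _ h2] := @cvgr_le _ _ \oo _ _ _ g0 _ K1.
move/cvgryPge: ginf => /(_ (K * (C + 1))) [N3 _ h3].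
exists (maxn N1 (maxn N2 N3)) => n; rewrite !geq_max => /and3P[n1 n2 n3].
have [n0 l1 _] := h1 n n1; split.
  have := h3 n n3; rewrite /= ler_pdivlMr; last by lra.
  apply: le_trans; rewrite -mulrA ler_wpM2l//; lra.
have := h2 n n2; rewrite /= => h4; apply: (@le_trans _ _ ((K + 1)^-1 * K)).
  by rewrite ler_wpM2r.
by rewrite mulrC ler_pdivrMr; lra.
Qed.

(** Enlarges an asymptotic constant so that it also covers the finitely many [n < N]. *)
Lemma bound_patch N (a : nat -> R) (M : nat -> R) (C : R) : exists C' : R, C <= C' /\
  forall n, (n < N)%N -> 0 < a n -> M n <= C' * a n.
Proof.
exists (`|C| + \sum_(n < N) `|M n| / `|a n|).
have s0 (p : pred 'I_N) : 0 <= \sum_(n < N | p n) `|M n| / `|a n|.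
  by apply: sumr_ge0 => i _; rewrite divr_ge0.
split; first by have := ler_norm C; have := s0 xpredT; lra.
move=> n nN an; rewrite -ler_pdivrMr// (bigD1 (Ordinal nN))//= (gtr0_norm an).
have : M n / a n <= `|M n| / a n by rewrite ler_pM2r ?invr_gt0// ler_norm.
have := s0 (fun i => i != Ordinal nN); have := normr_ge0 C; lra.
Qed.

Lemma noise_bound_le n (A A' : R) z : A <= A' -> noise_bound A n z -> noise_bound A' n z.
Proof. by move=> AA' h a b ab; apply: (le_trans (h a b ab)); rewrite ler_wpM2r. Qed.

(** Comparison with the zero signal. The penalty may have either sign for small [n], hence [|G|]. *)
Lemma minimizer_bound n (G M : R) Y U i : nat_minimizer n G Y U -> (forall i, (i < n)%N -> `|Y i| <= M) ->
  (i < n)%N -> `|U i| <= M + 1 + n%:R * M ^+ 2 + n%:R * `|G|.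
Proof.
move=> hU hY i_n; have := hU (fun=> 0).
have -> : jumps n (fun=> 0 : R) = 0%N by rewrite /jumps big1// => p _; rewrite /jump eqxx.
rewrite mulr0 addr0 => h.
have h1 : cost n Y (fun=> 0) <= n%:R * M ^+ 2.
  rewrite /cost (le_trans (ler_sum_nat (G := fun=> M ^+ 2) _))//; last first.
    by rewrite sumr_const_nat subn0 mulr_natl.
  move=> k /andP[_ kn]; rewrite sub0r sqrrN -[Y k ^+ 2]real_normK ?num_real//.
  by rewrite ler_pXn2r ?nnegrE ?hY// (le_trans (normr_ge0 (Y k)))// hY.
have h2 : - (n%:R * `|G|) <= G * (jumps n U)%:R.
  have jn : (jumps n U <= n)%N.
    rewrite jumps_count size_filter (leq_trans (count_size _ _))// size_iota; exact: leq_subr.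
  have : `|G * (jumps n U)%:R| <= n%:R * `|G|.
    by rewrite normrM mulrC ler_wpM2r// ger0_norm// ler_nat.
  by rewrite ler_norml => /andP[].
have h3 : (U i - Y i) ^+ 2 <= cost n Y U.
  rewrite /cost big_mkord (bigD1 (Ordinal i_n))//= lerDl sumr_ge0// => k _; exact: sqr_ge0.
have h4 : `|U i - Y i| <= 1 + (U i - Y i) ^+ 2.
  by rewrite -[(U i - Y i) ^+ 2]real_normK ?num_real//; have := sqr_ge0 (`|U i - Y i| - 2^-1); lra.
have := ler_distD (Y i) (U i) 0; rewrite !subr0; have := hY i i_n; lra.
Qed.

Lemma step_skorokhod_bound f : in_S f -> exists2 M : R, 0 <= M & forall n F U (B : R), (0 < n)%N ->
  grid_fun n F U -> (forall i, (i < n)%N -> `|U i| <= B) ->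
  (skorokhod (S_to_D F) (S_to_D f) <= (B + M)%:E)%E.
Proof.
move=> fS; have [m' [t' [a' hr']]] := in_S_step fS.
have {m' t' a' hr'} [m [s [h [_ hred]]]] := step_reduce hr'.
have [dl [D [M sd]]] := reduced_step_data hred.
have [[hs m0 d0 D0 M1] gap hD [hM hfM] hf] := sd.
have [s0 sm sinc] := hs.
have f1 : S_to_D f 1 = h m.-1.
  rewrite /S_to_D eqxx; apply: cvg_lim => //; case: hred => hr _ _.
  apply: (step_left_cvg hr); rewrite ?prednK// sm lexx andbT -sm -{2}(prednK m0).
  by apply: sinc; rewrite prednK.
exists M; first by lra.
move=> n F U B n0 hF hU.
have B0 : 0 <= B by apply: le_trans (hU 0%N n0).
apply: skorokhod_le_dist; last by lra.
- move=> x y /andP[x0 x1] /andP[y0 y1]; rewrite !S_to_D_neq1 ?lt_eqF//.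
  have [i i_n hi] := grid_index n0 (x := x) ltac:(by rewrite x0).
  rewrite (hF i)//; apply: (le_trans (ler_normB _ _)).
  by apply: lerD; [exact: hU|apply: hfM; rewrite y0].
- rewrite (S_to_D_grid n0 hF) f1; apply: (le_trans (ler_normB _ _)).
  by apply: lerD; [apply: hU; rewrite prednK|apply: hM; rewrite prednK].
Qed.

End analytic_tools.

(** * Probabilistic conclusions for the estimator *)

Section estimator.
Context (d : measure_display) (T : measurableType d) (R : realType) (P : probability T R).
Context (f : R -> R) (hf : in_L2 f).
Context (xi : forall n : nat, 'I_n -> {RV P >-> R}).
Arguments xi : clear implicits.
Context (hxi : conditionA P (fun n i => xi n i : T -> R)).
Context (gamma_ : nat -> {RV P >-> R}) (fhat : nat -> T -> R -> R).
Context (hfhat : forall (n : nat) (w : T), (0 < n)%N ->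
  (@iota_step R n @` potts_minimizers (gamma_ n w)
    (observations f (fun n i => xi n i : T -> R) n w)) (fhat n w)).

(** The added 1 ensures [1 <= A], as [cadlag_deterministic] and [step_rates] require. *)
Lemma noise_eventually : exists C : R, 0 < C /\
  {ae P, forall w, exists N, forall n, (N <= n)%N ->
    noise_bound (C * ln n%:R + 1) n (ext (fun i => xi n i w))}.
Proof.
have [beta [C [F [[C0 _] _ Fev hF _]]]] := noise_as hxi; exists C; split=> //.
apply: filterS Fev => w [N hN]; exists N => n nN.
by apply: noise_bound_le (hF n w (hN n nN)); rewrite lerDl.
Qed.

Lemma skorokhod_limit (gamma : R) (fgamma : R -> R) : 0 < gamma ->
  unique_potts_limit_minimizer gamma f fgamma ->
  {ae P, forall w, gamma_ n w @[n --> \oo] --> gamma} ->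
  {ae P, forall w, skorokhod (S_to_D (fhat n w)) (S_to_D (S_version fgamma)) @[n --> \oo] --> 0%E}.
Proof.
move=> gamma0 hmin hg; have [C [C0 hC]] := noise_eventually.
apply: filterS2 hg hC => w hg [N hN]; apply: ereal_cvg0; first by move=> n; exact: skorokhod_ge0.
move=> e e0; have [K K1 hK] := limit_deterministic gamma0 hf hmin e0.
have K0 : 0 <= K by lra.
have [N1 h1] := eventually_log (ltW C0) K0.
have Ki : 0 < K^-1 by rewrite invr_gt0; lra.
have /cvgrPdist_le /(_ _ Ki) [N2 _ h2] := hg.
exists (maxn N (maxn N1 (maxn N2 (Num.truncn K).+1))) => n.
rewrite !geq_max => /and4P[nN n1 n2 n3].
have [n0 l1 hKn] := h1 n n1.
have [U [hU hF]] := fhat_grid n0 hf (hfhat w n0).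
have A0 : 0 <= C * ln n%:R + 1 by rewrite addr_ge0// mulr_ge0; lra.
apply: (hK n _ _ _ _ _ n0 _ A0 hKn _ (hN n nN) hU hF).
  by apply: (le_trans (ltW (truncnS_gt _))); rewrite ler_nat.
have := h2 n n2; rewrite /= distrC => h3; rewrite -ler_pdivlMr ?div1r//; lra.
Qed.

Let small_gamma := {ae P, forall w, gamma_ n w @[n --> \oo] --> (0 : R)}.
Let large_gamma := {ae P, forall w, gamma_ n w * n%:R / ln n%:R @[n --> \oo] --> +oo}.

Lemma skorokhod_cadlag : in_D f -> small_gamma -> large_gamma ->
  {ae P, forall w, skorokhod (S_to_D (fhat n w)) f @[n --> \oo] --> 0%E}.
Proof.
move=> fD g0 ginf; have [C [C0 hC]] := noise_eventually.
apply: filterS3 g0 ginf hC => w g0 ginf [N hN].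
apply: ereal_cvg0 => [n|e e0]; first exact: skorokhod_ge0.
have e13 : 0 < e / 13 by rewrite divr_gt0.
have [K K0 hK] := cadlag_deterministic fD hf e13.
have [N1 h1] := eventually_log (ltW C0) (ltW K0).
have [N2 h2] := eventually_rate (ltW C0) (ltW K0) g0 ginf.
exists (maxn N (maxn N1 N2)) => n; rewrite !geq_max => /and3P[nN n1 n2].
have [n0 l1 hKn] := h1 n n1; have [h3 h4] := h2 n n2.
have [U [hU hF]] := fhat_grid n0 hf (hfhat w n0).
have A1 : 1 <= C * ln n%:R + 1 by rewrite lerDr mulr_ge0; lra.
have -> : e = 13 * (e / 13) by rewrite mulrC divfK.
exact: hK n _ _ _ _ _ n0 A1 h3 h4 hKn (hN n nN) hU hF.
Qed.

Lemma Linfnorm_continuous : in_D f -> {within `[0, 1], continuous f} -> small_gamma -> large_gamma ->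
  {ae P, forall w, Linfnorm (fhat n w \- f) @[n --> \oo] --> 0%E}.
Proof.
move=> fD fc g0 ginf; apply: filterS (skorokhod_cadlag fD g0 ginf) => w hw.
have ev e : 0 < e -> exists N, forall n, (N <= n)%N ->
    (0 <= Linfnorm (fhat n w \- f)%R <= e%:E)%E.
  move=> e0; have [eta eta0 heta] := skorokhod_unif fD fc e0.
  move/fine_cvgP: hw => [[N1 _ h1] /cvgr0Pnorm_lt /(_ _ eta0) [N2 _ h2]].
  exists (maxn N1 N2) => n; rewrite geq_max => /andP[n1 n2]; apply: heta.
  have := h1 n n1; have := h2 n n2; rewrite /=.
  case: (skorokhod _ _) => //= r; rewrite lte_fin => h3 _.
  exact: le_lt_trans (ler_norm _) h3.
have [N hN] := ev 1 ltr01.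
apply/fine_cvgP; split.
  near=> n; have /andP[h1 h2] : (0 <= Linfnorm (fhat n w \- f)%R <= 1%:E)%E.
    by apply: hN; near: n; exact: nbhs_infty_ge.
  by rewrite ge0_fin_numE// (le_lt_trans h2)// ltry.
apply/cvgr0Pnorm_le => e e0; have [N' hN'] := ev e e0; near=> n.
have /andP[] : (0 <= Linfnorm (fhat n w \- f)%R <= e%:E)%E.
  by apply: hN'; near: n; exact: nbhs_infty_ge.
rewrite /=; case: (Linfnorm _) => //= r; rewrite !lee_fin => r0 re.
by rewrite ger0_norm.
Unshelve. all: end_near. Qed.

Lemma step_rate_as : in_S f -> small_gamma -> large_gamma ->
  bigO_as P (fun n w => skorokhod (S_to_D (fhat n w)) (S_to_D f))
    (fun n => Num.sqrt (ln n%:R / n%:R)).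
Proof.
move=> fS g0 ginf; have [C [C0 hC]] := noise_eventually.
apply: filterS3 g0 ginf hC => w g0 ginf [N hN].
have [m [s [K [hs K1 hK]]]] := step_rates fS hf.
have K0 : 0 <= K by lra.
have [N1 h1] := eventually_log (ltW C0) K0.
have [N2 h2] := eventually_rate (ltW C0) K0 g0 ginf.
pose N' := maxn N (maxn N1 N2); pose C' := K * (C + 1).
have large n : (N' <= n)%N ->
    (skorokhod (S_to_D (fhat n w)) (S_to_D f) <= (C' * Num.sqrt (ln n%:R / n%:R))%:E)%E.
  rewrite /N' !geq_max => /and3P[nN n1 n2].
  have [n0 l1 hKn] := h1 n n1; have [h3 h4] := h2 n n2.
  have [U [hU hF]] := fhat_grid n0 hf (hfhat w n0).
  have A1 : 1 <= C * ln n%:R + 1 by rewrite lerDr mulr_ge0; lra.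
  have [+ _] := hK n _ _ _ _ _ n0 A1 h3 h4 hKn (hN n nN) hU hF.
  move/le_trans; apply; rewrite lee_fin /C' -mulrA ler_wpM2l//.
  have n0' : 0 < n%:R :> R by rewrite ltr0n.
  have q0 : 0 <= ln n%:R / n%:R :> R by rewrite divr_ge0 ?(ltW n0')//; lra.
  rewrite -(@ler_pXn2r _ 2) ?nnegrE ?mulr_ge0 ?sqrtr_ge0//; last lra.
  rewrite exprMn !sqr_sqrtr//; last by rewrite divr_ge0 ?(ltW n0')//; lra.
  rewrite [leRHS]mulrA ler_pM2r ?invr_gt0//.
  have : (C + 1) * ln n%:R <= (C + 1) ^+ 2 * ln n%:R :> R by rewrite ler_wpM2r//; nra.
  lra.
have [M0 _ hM0] := step_skorokhod_bound fS.
have fin n : exists M : R, (0 < n)%N -> (skorokhod (S_to_D (fhat n w)) (S_to_D f) <= M%:E)%E.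
  case: (posnP n) => [->|n0]; first by exists 0.
  have [U [hU hF]] := fhat_grid n0 hf (hfhat w n0).
  exists (\sum_(i < n) `|U i| + M0) => _; apply: (hM0 n _ U) => // i i_n.
  by rewrite (bigD1 (Ordinal i_n))//= lerDl sumr_ge0.
have [M hM] := boolp.choice fin.
have [C2 [CC2 hC2]] := bound_patch N' (fun n => Num.sqrt (ln n%:R / n%:R)) M C'.
exists C2 => n n1; have [nN|nN] := ltnP n N'.
  apply: (le_trans (hM n (ltnW n1))); rewrite lee_fin hC2//.
  by rewrite sqrtr_gt0 divr_gt0 ?ltr0n 1?ltnW// ln_gt0// ltr1n.
by apply: (le_trans (large n nN)); rewrite lee_fin ler_wpM2r.
Qed.

(** For fixed [n] the noise and the penalty are finite random variables, hence tight, and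
    [minimizer_bound] turns this into a bound on the estimator outside a measurable event. *)
Lemma skorokhod_tight n (eps : R) : in_S f -> (0 < n)%N -> 0 < eps ->
  exists (M : R) (A : set T), [/\ measurable A, (P A <= eps%:E)%E &
    forall w, ~ A w -> (skorokhod (S_to_D (fhat n w)) (S_to_D f) <= M%:E)%E].
Proof.
move=> fS n0 e0; have e20 : 0 < eps / 2 by rewrite divr_gt0.
have [M0 _ hM0] := step_skorokhod_bound fS.
have mX : measurable_fun setT (fun w => \sum_(i < n) `|xi n i w|).
  by apply: measurable_sum => i; apply: measurableT_comp.
have [Mx [Ax [mAx PAx hAx]]] := prob_tight P mX e20.
have [Mg [Ag [mAg PAg hAg]]] := prob_tight P (measurable_funPT (gamma_ n)) e20.
pose MY := \sum_(i < n) `|fbar f n i| + Mx.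
exists (MY + 1 + n%:R * MY ^+ 2 + n%:R * (Mg * n%:R) + M0), (Ax `|` Ag); split.
- exact: measurableU.
- apply: (le_trans (measureU2 _ mAx mAg)); rewrite [eps]splitr EFinD; exact: leeD.
move=> w /not_orP[/hAx hx /hAg hg].
have [U [hU hF]] := fhat_grid n0 hf (hfhat w n0).
apply: (hM0 n _ U) => // i i_n.
have hY k : (k < n)%N -> `|fbar f n k + ext (fun i => xi n i w) k| <= MY.
  move=> kn; apply: (le_trans (ler_normD _ _)); apply: lerD.
    by rewrite (bigD1 (Ordinal kn))//= lerDl sumr_ge0.
  apply: le_trans (le_trans (ler_norm _) hx); rewrite (bigD1 (Ordinal kn))//=.
  by rewrite -[k in ext _ k]/(nat_of_ord (Ordinal kn)) extE lerDl sumr_ge0.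
apply: (le_trans (minimizer_bound hU hY i_n)); rewrite lerD2l ler_wpM2l//.
by rewrite normrM ler_pM// ger0_norm.
Qed.

(** Outside an event of probability [eps / 2] the multiscale noise bound and the conditions on
    [gamma_] hold from a deterministic index on; another [eps / 2] covers the [m] noise sums over
    fixed cells at level [W * sqrt n]. The remaining [n] are handled by [skorokhod_tight]. *)
Lemma step_rate_P : in_S f -> small_gamma -> large_gamma ->
  bigO_P P (fun n w => skorokhod (S_to_D (fhat n w)) (S_to_D f)) (fun n => Num.sqrt n%:R^-1).
Proof.
move=> fS g0 ginf eps e0; have e20 : 0 < eps / 2 by rewrite divr_gt0.
have [beta [C [F [[C0 beta0] mF Fev hF tail]]]] := noise_as hxi.
have [m [s [K [hs K1 hK]]]] := step_rates fS hf.
have K0 : 0 <= K by lra.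
have [N1 h1] := eventually_log (ltW C0) K0.
pose E n := ~` F n `&` ([set w | K * (C * ln n%:R + 1) <= gamma_ n w * n%:R] `&`
  [set w | gamma_ n w * K <= 1]).
have [||N0 [A0 [mA0 PA0 hA0]]] := @eventually_uniform _ T R P E _ _ _ e20.
- move=> n; apply: measurableI; first by apply: measurableC; exact: mF.
  apply: measurableI; rewrite -[X in measurable X]setTI; apply: measurable_fun_le => //;
  by apply: measurable_funM => //; exact: measurable_funPT.
- apply: filterS3 g0 ginf Fev => w g0 ginf [N hN].
  have [N2 h2] := eventually_rate (ltW C0) K0 g0 ginf.
  exists (maxn N N2) => n; rewrite geq_max => /andP[nN n2].
  by have [? ?] := h2 n n2; split; [exact: hN|].
(* [2 * C + 2] yields [A <= W * sqrt n] through [ln n <= 2 * sqrt n]; the last term makes the [m]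
   Gaussian tails add up to at most [eps / 2], using [1 + y <= expR y]. *)
pose W := 2 * C + 2 + 16 * beta * m%:R / eps.
have q0 : 0 <= 16 * beta * m%:R / eps by rewrite divr_ge0 ?(ltW e0)// !mulr_ge0// ltW.
have W1 : 1 <= W by rewrite /W; lra.
have W0 : 0 < W by lra.
have expW : m%:R * (2 * expR (- (W ^+ 2 / (4 * beta)))) <= eps / 2.
  have b0 : 0 < 4 * beta by rewrite mulr_gt0.
  have hW : 4 * m%:R / eps <= W ^+ 2 / (4 * beta).
    rewrite ler_pdivlMr//; apply: (@le_trans _ _ W); last by rewrite expr2 ler_peMl// ltW.
    by rewrite /W (_ : 4 * _ / _ * _ = 16 * beta * m%:R / eps); [lra|field; rewrite gt_eqF].
  rewrite expRN; have := expR_ge1Dx (W ^+ 2 / (4 * beta)); set y := expR _ => hy.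
  have y0 : 0 < y by exact: expR_gt0.
  rewrite mulrA ler_pdivrMr//.
  have : 4 * m%:R / eps <= y by lra.
  by rewrite ler_pdivrMr//; lra.
have gridn1 n j : (0 < n)%N -> (j <= m)%N -> (grid n s j <= n)%N.
  move=> n0 jm; have /andP[_ i1] := grid_itv n0 hs jm; have /andP[_ s1] := cells_ge0 hs jm.
  rewrite -ltnS -(ltr_nat R) -natr1 (lt_le_trans i1)// lerD2r.
  by rewrite -{2}[n%:R]mulr1 ler_wpM2l.
pose N := maxn N0 N1; pose C' := K * W.
have large n : (N <= n)%N -> exists A : set T, [/\ measurable A, (P A <= eps%:E)%E &
    forall w, ~ A w ->
      (skorokhod (S_to_D (fhat n w)) (S_to_D f) <= (C' * Num.sqrt n%:R^-1)%:E)%E].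
  rewrite /N geq_max => /andP[nN0 n1]; have [n0 l1 hKn] := h1 n n1.
  have n0' : 0 < n%:R :> R by rewrite ltr0n.
  have sn0 : 0 < Num.sqrt n%:R :> R by rewrite sqrtr_gt0.
  pose Sj (j : 'I_m) := partial_sum (xi n) (grid n s j) (grid n s j.+1).
  pose G j := [set w | W * Num.sqrt n%:R <= `|Sj j w|].
  have mG j : measurable (G j).
    rewrite -[X in measurable X]setTI; apply: measurable_fun_le => //.
    apply: measurableT_comp => //; apply: measurable_partial_sum.
    by apply: gridn1 => //; exact: ltn_ord.
  have PG j : (P (G j) <= (2 * expR (- (W ^+ 2 / (4 * beta))))%:E)%E.
    have gn : (grid n s j.+1 <= n)%N by apply: gridn1 => //; exact: ltn_ord.
    have Wn : 0 <= W * Num.sqrt n%:R by rewrite mulr_ge0// ltW.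
    have [ab|ba] := ltnP (grid n s j) (grid n s j.+1); last first.
      rewrite (_ : G j = set0) ?measure0 ?lee_fin ?mulr_ge0 ?expR_ge0//.
      apply/seteqP; split=> // w; rewrite /G /= /Sj /partial_sum big_geq// normr0.
      by rewrite leNgt mulr_gt0.
    apply: (le_trans (tail n _ _ _ _ Wn)); first by rewrite ab.
    rewrite lee_fin ler_wpM2l// ler_expR lerN2 exprMn sqr_sqrtr ?(ltW n0')//.
    have l0 : 0 < (grid n s j.+1 - grid n s j)%:R :> R by rewrite ltr0n subn_gt0.
    have ln : (grid n s j.+1 - grid n s j)%:R <= n%:R :> R.
      by rewrite ler_nat (leq_trans (leq_subr _ _)).
    set l := (_ - _)%:R in l0 ln *.
    rewrite (_ : _ / (4 * beta * l) = W ^+ 2 / (4 * beta) * (n%:R / l)); last first.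
      by field; rewrite !gt_eqF.
    apply: ler_peMr; last by rewrite ler_pdivlMr// mul1r.
    by rewrite divr_ge0 ?sqr_ge0// mulr_ge0// ltW.
  exists (A0 `|` \big[setU/set0]_(j <- index_enum 'I_m) G j).
  have mU : measurable (\big[setU/set0]_(j <- index_enum 'I_m) G j) by exact: bigsetU_measurable.
  split; first exact: measurableU.
    apply: (le_trans (measureU2 _ mA0 mU)); rewrite [eps]splitr EFinD; apply: leeD => //.
    apply: (le_trans (measure_bigsetU_le _ _ mG)).
    apply: (@le_trans _ _ (\sum_(j < m) (2 * expR (- (W ^+ 2 / (4 * beta))))%:E)%E).
      by apply: lee_sum.
    by move: expW; rewrite mulr_natl sumEFin lee_fin sumr_const card_ord.
  move=> w /not_orP[/hA0 /(_ n nN0)] [nF [h3 h4]]; rewrite /= in h3 h4 => nG.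
  have [U [hU hFg]] := fhat_grid n0 hf (hfhat w n0).
  have A1 : 1 <= C * ln n%:R + 1 by rewrite lerDr mulr_ge0; lra.
  have hx : noise_bound (C * ln n%:R + 1) n (ext (fun i => xi n i w)).
    by apply: noise_bound_le (hF n w nF); rewrite lerDl.
  have [_ +] := hK n _ _ _ _ _ n0 A1 h3 h4 hKn hx hU hFg.
  move=> /(_ W); rewrite /C' -mulrA; apply.
    have sn1 : 1 <= Num.sqrt n%:R :> R by rewrite -[leLHS]sqrtr1 ler_sqrt// ler1n.
    have := ler_wpM2l (ltW C0) (ln_le_sqrt n0); have := mulr_ge0 q0 (ltW sn0); rewrite /W; lra.
  move=> j jm; rewrite leNgt; apply/negP => hlt; apply: nG.
  rewrite -bigcup_seq; exists (Ordinal jm); first by rewrite /= mem_index_enum.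
  exact: ltW.
have fin n : exists M : R, (0 < n)%N -> exists A : set T, [/\ measurable A, (P A <= eps%:E)%E &
    forall w, ~ A w -> (skorokhod (S_to_D (fhat n w)) (S_to_D f) <= M%:E)%E].
  case: (posnP n) => [->|n0]; first by exists 0.
  by have [M hM] := skorokhod_tight fS n0 e0; exists M.
have [M hM] := boolp.choice fin.
have [C2 [CC2 hC2]] := bound_patch N (fun n => Num.sqrt n%:R^-1) M C'.
exists C2 => n n0; have [nN|nN] := ltnP n N.
  have [A [mA PA hA]] := hM n n0; exists A; split=> // w /hA /le_trans; apply.
  by rewrite lee_fin hC2// sqrtr_gt0 invr_gt0 ltr0n.
have [A [mA PA hA]] := large n nN; exists A; split=> // w /hA /le_trans; apply.
by rewrite lee_fin ler_wpM2r.
Qed.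

End estimator.

Unset Implicit Arguments.
Set Strict Implicit.
Set Printing Implicit Defensive.

Theorem theorem4 (d : measure_display) (T : measurableType d) (R : realType)
    (P : probability T R)
    (f : R -> R) (hf : in_L2 f)
    (xi : forall n : nat, 'I_n -> {RV P >-> R})
    (hxi : conditionA P (fun n i => xi n i : T -> R))
    (gamma_ : nat -> {RV P >-> R})
    (fhat : nat -> T -> R -> R)
    (hfhat : forall (n : nat) (w : T), (0 < n)%N ->
      (@iota_step R n @` potts_minimizers (gamma_ n w)
         (observations f (fun n i => xi n i : T -> R) n w)) (fhat n w)) :
  [/\ (* (i) *)
      forall (gamma : R) (fgamma : R -> R),
        0 < gamma ->
        unique_potts_limit_minimizer gamma f fgamma ->
        {ae P, forall w, gamma_ n w @[n --> \oo] --> gamma} ->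
        {ae P, forall w,
          skorokhod (S_to_D (fhat n w)) (S_to_D (S_version fgamma))
            @[n --> \oo] --> 0%E},
      (* (ii) *)
      in_D f ->
      {ae P, forall w, gamma_ n w @[n --> \oo] --> (0 : R)} ->
      {ae P, forall w, gamma_ n w * n%:R / ln n%:R @[n --> \oo] --> +oo} ->
      {ae P, forall w,
        skorokhod (S_to_D (fhat n w)) f @[n --> \oo] --> 0%E} /\
      ({within `[0, 1], continuous f} ->
       {ae P, forall w,
         Linfnorm (fhat n w \- f) @[n --> \oo] --> 0%E}) &
      (* (iii) *)
      in_S f ->
      {ae P, forall w, gamma_ n w @[n --> \oo] --> (0 : R)} ->
      {ae P, forall w, gamma_ n w * n%:R / ln n%:R @[n --> \oo] --> +oo} ->
      bigO_as P (fun n w => skorokhod (S_to_D (fhat n w)) (S_to_D f))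
        (fun n => Num.sqrt (ln n%:R / n%:R)) /\
      bigO_P P (fun n w => skorokhod (S_to_D (fhat n w)) (S_to_D f))
        (fun n => Num.sqrt n%:R^-1)].
Proof.
split.
- by move=> gamma fgamma; exact: skorokhod_limit hf _ hxi _ _ hfhat _ _.
- move=> fD g0 ginf; split; first exact: skorokhod_cadlag hf _ hxi _ _ hfhat fD g0 ginf.
  by move=> fc; exact: Linfnorm_continuous hf _ hxi _ _ hfhat fD fc g0 ginf.
- move=> fS g0 ginf; split; first exact: step_rate_as hf _ hxi _ _ hfhat fS g0 ginf.
  exact: step_rate_P hf _ hxi _ _ hfhat fS g0 ginf.
Qed.
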